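(* Assume that a Smale space $(X,\phi)$ is irreducible and $X$ is infinite. Then the fixed point algebra $(\mathcal{R}_\phi^{s,u})^{\delta^\phi}$ of the extended Ruelle algebra $\mathcal{R}_\phi^{s,u}$ under the diagonal action $\delta^\phi$ is isomorphic to the asymptotic Ruelle algebra $\mathcal{R}_\phi^a$.
   Context: Smale spaces. Let $\phi$ be a homeomorphism of a compact metric space $(X,d)$. For $\epsilon>0$ put $\Delta_\epsilon=\{(x,y)\in X\times X: d(x,y)<\epsilon\}$. $(X,\phi)$ is a Smale space if there are $\epsilon_0>0$, $0<\lambda_0<1$ and a continuous map $[\cdot,\cdot]:\Delta_{\epsilon_0}\to X$ such that: (SS1) $[x,x]=x$; $[[x,y],z]=[x,[y,z]]=[x,z]$ whenever $(x,y),(y,z),(x,z),([x,y],z),(x,[y,z])\in\Delta_{\epsilon_0}$; $[\phi(x),\phi(y)]=\phi([x,y])$ whenever $(x,y),(\phi(x),\phi(y))\in\Delta_{\epsilon_0}$; (SS2) with $X^s(x,\epsilon)=\{y: [y,x]=y,\ d(x,y)<\epsilon\}$ and $X^u(x,\epsilon)=\{y:[x,y]=y,\ d(x,y)<\epsilon\}$ for $0<\epsilon\le\epsilon_0$, one has $d(\phi(y),\phi(z))\le\lambda_0d(y,z)$ for $y,z\in X^s(x,\epsilon)$ and $d(\phi^{-1}(y),\phi^{-1}(z))\le\lambda_0d(y,z)$ for $y,z\in X^u(x,\epsilon)$. It is irreducible if for every ordered pair of (nonempty) open sets $U,V\subset X$ there is $K\in\mathbb{N}$ with $\phi^K(U)\cap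 V\ne\emptyset$. Put $G_\phi^{s,0}=\{(x,y): y\in X^s(x,\epsilon_0)\}$, $G_\phi^{u,0}=\{(x,y): y\in X^u(x,\epsilon_0)\}$, and for $n\ge0$, $G_\phi^{s,n}=(\phi\times\phi)^{-n}(G_\phi^{s,0})$, $G_\phi^{u,n}=(\phi\times\phi)^n(G_\phi^{u,0})$, $G_\phi^{a,n}=G_\phi^{s,n}\cap G_\phi^{u,n}$, with the relative topology from $X\times X$; $G_\phi^*=\bigcup_nG_\phi^{*,n}$ with the inductive limit topology, $*=s,u,a$. $\mathcal{R}_\phi^a=C^*(G_\phi^a\rtimes\mathbb{Z})$, where $G_\phi^a\rtimes\mathbb{Z}=\{(x,n,y)\in X\times\mathbb{Z}\times X:(\phi^n(x),y)\in G_\phi^a\}$ is the étale amenable groupoid with topology transported from $G_\phi^a\times\mathbb{Z}$ by $(x,n,y)\mapsto((x,\phi^{-n}(y)),n)$ and operations $(x,n,y)(y,m,w)=(x,n+m,w)$, $(x,n,y)^{-1}=(y,-n,x)$. $\mathcal{R}_\phi^{s,u}=C^*(G_\phi^{s,u}\rtimes\mathbb{Z}^2)$, where $G_\phi^{s,u}\rtimes\mathbb{Z}^2=\{(x,p,q,y)\in X\times\mathbb{Z}\times\mathbb{Z}\times X:(\phi^p(x),y)\in G_\phi^s,\ (\phi^q(x),y)\in G_\phi^u\}$ is the étale amenable groupoid with operations $(x,p,q,y)(y,p',q',w)=(x,p+p',q+q',w)$, $(x,p,q,y)^{-1}=(y,-p,-q,x)$, topologized as the disjoint union over $(p,q)\in\mathbb{Z}^2$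 of the spaces $\bigcup_{n\ge0}\{(x,y):(\phi^p(x),y)\in G_\phi^{s,n},(\phi^q(x),y)\in G_\phi^{u,n}\}$, each with the inductive limit topology of the relative topologies from $X\times X$. Being amenable, its full and reduced $C^*$-algebras coincide, and $\mathcal{R}_\phi^{s,u}$ acts by left convolution on $l^2(G_\phi^{s,u}\rtimes\mathbb{Z}^2)$ (the Hilbert $C(X)$-module completion of $C_c(G_\phi^{s,u}\rtimes\mathbb{Z}^2)$). Here $\mathbb{T}=\{z\in\mathbb{C}:|z|=1\}$. For $(z_1,z_2)\in\mathbb{T}^2$ let $(U_{z_1,z_2}\xi)(x,p,q,y)=z_1^pz_2^{-q}\xi(x,p,q,y)$ on $l^2(G_\phi^{s,u}\rtimes\mathbb{Z}^2)$. The automorphisms $\rho^{s,u}_{\phi,(z_1,z_2)}=\operatorname{Ad}(U_{z_1,z_2})$ restrict to an action of $\mathbb{T}^2$ on $\mathcal{R}_\phi^{s,u}$, and the diagonal action is $\delta^\phi_z=\rho^{s,u}_{\phi,(z,z)}$, $z\in\mathbb{T}$. *)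

(* Defs.v *)
From HB Require Import structures.
From mathcomp Require Import all_boot all_order all_algebra.
From mathcomp Require Import complex finmap ring.
From mathcomp Require Import all_classical all_reals all_analysis.
Set Implicit Arguments.
Unset Strict Implicit.
Unset Printing Implicit Defensive.
Import Order.TTheory GRing.Theory Num.Theory.
Import numFieldNormedType.Exports.
Local Open Scope classical_set_scope.
Local Open Scope ring_scope.

(** * Smale spaces *)

Definition iterz (X : Type) (f fV : X -> X) (n : int) : X -> X :=
  match n with Posz k => iter k f | Negz k => iter k.+1 fV end.

Section local_sets.
Context (R : realType) (X : metricType R) (br : X -> X -> X).

Definition Delta (e : R) : set (X * X) := [set w | mdist w.1 w.2 < e].

Definition Xs (x : X) (e : R) : set X := [set y | br y x = y /\ mdist x y < e].

Definition Xu (x : X) (e : R) : set X := [set y | br x y = y /\ mdist x y < e].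

End local_sets.

(* [bracket] is total for convenience: its values off [Delta eps0] are never
   used. *)
Record smale_space (R : realType) := SmaleSpace {
  space :> metricType R ;
  space_compact : compact [set: space] ;
  phi : space -> space ;
  phiV : space -> space ;
  phi_continuous : continuous phi ;
  phiV_continuous : continuous phiV ;
  phiK : cancel phi phiV ;
  phiVK : cancel phiV phi ;
  eps0 : R ;
  lambda0 : R ;
  bracket : space -> space -> space ;
  eps0_gt0 : 0 < eps0 ;
  lambda0_gt0 : 0 < lambda0 ;
  lambda0_lt1 : lambda0 < 1 ;
  bracket_continuous :
    {within Delta eps0, continuous (fun w => bracket w.1 w.2)} ;
  bracketxx : forall x, bracket x x = x ;
  bracketA : forall x y z,
    Delta eps0 (x, y) -> Delta eps0 (y, z) ->
    Delta eps0 (x, z) -> Delta eps0 (bracket x y, z) ->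
    Delta eps0 (x, bracket y z) ->
    bracket (bracket x y) z = bracket x z /\
    bracket x (bracket y z) = bracket x z ;
  bracket_phi : forall x y,
    Delta eps0 (x, y) -> Delta eps0 (phi x, phi y) ->
    bracket (phi x) (phi y) = phi (bracket x y) ;
  Xs_contract : forall x e y z, 0 < e -> e <= eps0 ->
    Xs bracket x e y -> Xs bracket x e z ->
    mdist (phi y) (phi z) <= lambda0 * mdist y z ;
  Xu_contract : forall x e y z, 0 < e -> e <= eps0 ->
    Xu bracket x e y -> Xu bracket x e z ->
    mdist (phiV y) (phiV z) <= lambda0 * mdist y z
}.

Section smale_relations.
Context (R : realType) (S : smale_space R).

Definition irreducible := forall U V : set S,
  open U -> open V -> U !=set0 -> V !=set0 ->
  exists K : nat, (iter K (@phi R S) @` U) `&` V !=set0.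

Definition phiz (n : int) : S -> S := iterz (@phi R S) (@phiV R S) n.

Definition phiz2 (n : int) (w : S * S) : S * S := (phiz n w.1, phiz n w.2).

Definition Gs0 : set (S * S) := [set w | Xs (@bracket R S) w.1 (eps0 S) w.2].
Definition Gu0 : set (S * S) := [set w | Xu (@bracket R S) w.1 (eps0 S) w.2].
Definition Gs (n : nat) : set (S * S) := phiz2 n%:Z @^-1` Gs0.
Definition Gu (n : nat) : set (S * S) := phiz2 n%:Z @` Gu0.
Definition Ga (n : nat) : set (S * S) := Gs n `&` Gu n.

Definition Gs_all := \bigcup_n Gs n.
Definition Gu_all := \bigcup_n Gu n.
Definition Ga_all := \bigcup_n Ga n.

End smale_relations.

Arguments irreducible {R} S.
Arguments Gs0 {R} S _.
Arguments Gu0 {R} S _.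
Arguments Gs {R} S n _.
Arguments Gu {R} S n _.
Arguments Ga {R} S n _.
Arguments Gs_all {R} S _.
Arguments Gu_all {R} S _.
Arguments Ga_all {R} S _.

(** ** The three relations are [phi]-invariant equivalence relations *)

Section iterz_theory.
Context (X : Type) (f fV : X -> X) (fK : cancel f fV) (fVK : cancel fV f).

Lemma iterzS n x : iterz f fV (n + 1) x = f (iterz f fV n x).
Proof.
case: n => [k|k]; first by rewrite -PoszD addn1.
have -> : Negz k + 1 = - k%:Z by rewrite NegzE -addn1 PoszD opprD addrNK.
by case: k => [|k] /=; rewrite -?NegzE /= fVK.
Qed.

Lemma iterzP n x : iterz f fV (n - 1) x = fV (iterz f fV n x).
Proof. by rewrite -[in RHS](subrK 1 n) iterzS fK. Qed.

Lemma iterzD m n x : iterz f fV (m + n) x = iterz f fV m (iterz f fV n x).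
Proof.
elim: m => [|m IH|m IH]; first by rewrite add0r.
- by rewrite -addn1 PoszD addrAC !iterzS IH.
- by rewrite -addn1 PoszD opprD addrAC !iterzP IH.
Qed.

Lemma iterzK n x : iterz f fV (- n) (iterz f fV n x) = x.
Proof. by rewrite -iterzD addNr. Qed.

Lemma iterzNK n x : iterz f fV n (iterz f fV (- n) x) = x.
Proof. by rewrite -iterzD addrN. Qed.

Lemma iterzN (n : nat) x : iterz f fV (- n%:Z) x = iter n fV x.
Proof. by case: n => [//|n]; rewrite -NegzE. Qed.

End iterz_theory.

(* Written for [phi] and the stable relation; the unstable relation is the same
   thing for [phiV] and the opposite bracket. *)
Section local_relation.
Context (R : realType) (X : metricType R) (Xc : compact [set: X]).
Context (f : X -> X) (b : X -> X -> X) (e0 l0 : R).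
Hypothesis e0_gt0 : 0 < e0.
Hypothesis l0_gt0 : 0 < l0.
Hypothesis l0_lt1 : l0 < 1.
Hypothesis bc : forall x : X,
  \forall w \near (x, x), mdist w.1 w.2 < e0 -> mdist x (b w.1 w.2) < e0 / 2.
Hypothesis bxx : forall x, b x x = x.
Hypothesis bA : forall x y z, mdist x y < e0 -> mdist y z < e0 ->
  mdist x z < e0 -> mdist (b x y) z < e0 -> mdist x (b y z) < e0 ->
  b x (b y z) = b x z.
Hypothesis bf : forall x y, mdist x y < e0 -> mdist (f x) (f y) < e0 ->
  b (f x) (f y) = f (b x y).

Let S0 x y := b y x = y /\ mdist x y < e0.

Hypothesis ctr : forall x y z, S0 x y -> S0 x z ->
  mdist (f y) (f z) <= l0 * mdist y z.

Let S0xx x : S0 x x. Proof. by split; rewrite ?bxx// mdistxx. Qed.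

Lemma loc_dist x y : S0 x y -> mdist (f x) (f y) <= l0 * mdist x y.
Proof. exact: ctr. Qed.

Lemma loc_step x y : S0 x y -> S0 (f x) (f y).
Proof.
move=> xy; have [byx dxy] := xy.
have dle : mdist (f x) (f y) < e0.
  apply: le_lt_trans (loc_dist xy) _; apply: le_lt_trans dxy.
  by rewrite ler_piMl ?mdist_ge0// ltW.
by split => //; rewrite bf ?byx// metric_sym.
Qed.

Lemma loc_iter n x y : S0 x y -> S0 (iter n f x) (iter n f y).
Proof. by move=> xy; elim: n => //= n; exact: loc_step. Qed.

Lemma loc_le n m x y : (n <= m)%N ->
  S0 (iter n f x) (iter n f y) -> S0 (iter m f x) (iter m f y).
Proof. by move=> /subnK <-; rewrite !iterD => /loc_iter; exact. Qed.

Lemma loc_small x y d : 0 < d -> S0 x y ->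
  exists N, forall n, (N <= n)%N -> mdist (iter n f x) (iter n f y) < d.
Proof.
move=> d0 xy.
have le n : mdist (iter n f x) (iter n f y) <= l0 ^+ n * mdist x y.
  elim: n => [|n IH]; first by rewrite expr0 mul1r.
  rewrite /= exprS -mulrA; apply: le_trans (loc_dist (loc_iter n xy)) _.
  by rewrite ler_pM2l.
have c0 : (fun n => l0 ^+ n * mdist x y) @ \oo --> (0 * mdist x y : R^o).
  apply: cvgMr_tmp; apply: cvg_expr.
  by rewrite ger0_norm ?ltW.
rewrite mul0r in c0.
have [N _ HN] := cvgr_lt _ c0 _ d0.
by exists N => n Nn; apply: le_lt_trans (le n) _; exact: (HN n Nn).
Qed.

Lemma loc_unif : exists2 d, 0 < d & forall x y, mdist x y < d ->
  mdist (b x y) x < e0.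
Proof.
have /compact_near_coveringP cov := Xc.
have := cov R (0^'+) (fun d x => forall y, mdist x y < d -> mdist (b x y) x < e0)
  _ _.
case.
  move=> x _.
  have [[U V]/= [Ux Vx] UV] := bc x.
  have /nbhs_ballP[r1 /= r10 r1U] := Ux.
  have /nbhs_ballP[r2 /= r20 r2V] := Vx.
  pose r := Num.min (Num.min r1 r2) e0.
  have r0 : 0 < r by rewrite !lt_min r10 r20.
  exists (ball x (r / 2), [set d : R | d < r / 2]) => /=.
    split; first by apply: nbhsx_ballx; rewrite divr_gt0.
    by apply: nbhs_right_lt; rewrite divr_gt0.
  move=> [x' d] /=; rewrite ballEmdist/= => -[xx' dr] y x'y.
  have rE : r / 2 <= r by rewrite ler_pdivrMr// ler_peMr ?ltW// ltr1n.
  have xy : mdist x y < r.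
    apply: le_lt_trans (metric_triangle x x' y) _.
    by rewrite [ltRHS]splitr ltrD// (lt_trans x'y).
  have H : mdist x (b x' y) < e0 / 2.
    apply: (UV (x', y)) => /=.
      split; [apply: r1U|apply: r2V]; rewrite ballEmdist/=.
        apply: lt_le_trans xx' (le_trans rE _).
        by rewrite /r !ge_min lexx.
      by apply: lt_le_trans xy _; rewrite /r !ge_min lexx orbT.
    apply: lt_le_trans (lt_trans x'y dr) (le_trans rE _).
    by rewrite /r ge_min lexx orbT.
  apply: le_lt_trans (metric_triangle _ x _) _.
  rewrite [ltRHS]splitr metric_sym ltrD//.
  apply: lt_le_trans xx' _; rewrite ler_pM2r ?invr_gt0//.
  by rewrite /r ge_min lexx orbT.
move=> /= r r0 H.
exists (r / 2); first by rewrite divr_gt0.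
move=> x y xy; apply: (H (r / 2)) => //=; last by rewrite divr_gt0.
rewrite sub0r normrN gtr0_norm ?divr_gt0//.
by rewrite ltr_pdivrMr// ltr_pMr// ltr1n.
Qed.

Let G x y := exists n, S0 (iter n f x) (iter n f y).

Lemma loc_refl x : G x x. Proof. by exists 0%N; exact: S0xx. Qed.

Lemma loc_sym x y : G x y -> G y x.
Proof.
have [d d0 Hd] := loc_unif.
move=> [n xy].
have [N HN] := loc_small d0 xy.
exists (N + n)%N; rewrite !iterD.
have [byx dxy] := loc_iter N xy.
split; last by rewrite metric_sym.
move: byx dxy (HN N (leqnn N)).
set u := iter N f (iter n f x); set v := iter N f (iter n f y).
move=> bvu duv duvd.
have dvu : mdist v u < e0 by rewrite metric_sym.
rewrite -[RHS]bxx -(@bA u v u)// ?bvu// ?mdistxx//.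
exact: Hd.
Qed.

Lemma loc_trans x y z : G x y -> G y z -> G x z.
Proof.
have e20 : 0 < e0 / 2 by rewrite divr_gt0.
move=> [n xy] [m yz].
have [N HN] := loc_small e20 xy.
have [M HM] := loc_small e20 yz.
pose k := (maxn N M + maxn n m)%N.
have kN : (N + n <= k)%N by rewrite leq_add// leq_maxl.
have kM : (M + m <= k)%N by rewrite leq_add// leq_maxr.
have kn : (n <= k)%N by exact: leq_trans (leq_addl _ _) kN.
have km : (m <= k)%N by exact: leq_trans (leq_addl _ _) kM.
have [byx dxy] := loc_le kn xy.
have [bzy dyz] := loc_le km yz.
have dxz : mdist (iter k f x) (iter k f z) < e0.
  apply: le_lt_trans (metric_triangle _ (iter k f y) _) _.
  rewrite [ltRHS]splitr ltrD//.
    rewrite -(subnK kn) !iterD; apply: HN.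
    by rewrite leq_subRL// addnC.
  rewrite -(subnK km) !iterD; apply: HM.
  by rewrite leq_subRL// addnC.
exists k; split => //.
by rewrite -(@bA _ (iter k f y)) ?byx ?bzy// metric_sym.
Qed.

Lemma loc_inv x y : G (f x) (f y) <-> G x y.
Proof.
split=> -[n].
  by rewrite -!iterSr => H; exists n.+1.
by move=> /loc_step H; exists n; rewrite -!iterSr.
Qed.

End local_relation.

Section relation_theory.
Context (R : realType) (S : smale_space R).
Local Notation phi := (@phi R S).
Local Notation phiV := (@phiV R S).
Local Notation br := (@bracket R S).
Local Notation e0 := (eps0 S).

Lemma phizD m n (x : S) : phiz (m + n) x = phiz m (phiz n x).
Proof. exact: iterzD (@phiK R S) (@phiVK R S) _ _ _. Qed.

Lemma phizK n (x : S) : phiz (- n) (phiz n x) = x.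
Proof. exact: iterzK (@phiK R S) (@phiVK R S) _ _. Qed.

Lemma phizNK n (x : S) : phiz n (phiz (- n) x) = x.
Proof. exact: iterzNK (@phiK R S) (@phiVK R S) _ _. Qed.

Lemma bracket_near (x : S) : \forall w \near (x, x),
  mdist w.1 w.2 < e0 -> mdist x (br w.1 w.2) < e0 / 2.
Proof.
have e2 : 0 < e0 / 2 by rewrite divr_gt0// eps0_gt0.
have Dx : Delta e0 (x, x) by rewrite /Delta/= mdistxx eps0_gt0.
have nB : nbhs (br x x) (ball x (e0 / 2)).
  by rewrite bracketxx; exact: nbhsx_ballx.
have : nbhs_subspace ((x, x) : subspace (Delta e0))
    ((fun w => br w.1 w.2) @^-1` ball x (e0 / 2)).
  exact: (@bracket_continuous R S (x, x) _ nB).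
rewrite -nbhs_subspace_in// => -[UV UVx UVB].
exists UV => // w /UVB wB dw; have := wB dw.
by rewrite /preimage/= ballEmdist.
Qed.

Lemma GsE n (x y : S) :
  Gs S n (x, y) <-> br (iter n phi y) (iter n phi x) = iter n phi y /\
                    mdist (iter n phi x) (iter n phi y) < e0.
Proof. by []. Qed.

Lemma GuE n (x y : S) :
  Gu S n (x, y) <-> br (iter n phiV x) (iter n phiV y) = iter n phiV y /\
                    mdist (iter n phiV x) (iter n phiV y) < e0.
Proof.
have H z : iter n phiV z = phiz (- n%:Z) z by rewrite /phiz iterzN.
split.
  by move=> [[u v] uv [<- <-]]; rewrite !H !phizK.
rewrite !H => xy; exists (phiz (- n%:Z) x, phiz (- n%:Z) y) => //.
by congr pair; exact: phizNK.
Qed.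

Let bA (x y z : S) : mdist x y < e0 -> mdist y z < e0 ->
  mdist x z < e0 -> mdist (br x y) z < e0 -> mdist x (br y z) < e0 ->
  br x (br y z) = br x z.
Proof. by move=> *; apply: (bracketA _ _ _ _ _).2. Qed.

Let bA' (x y z : S) : mdist x y < e0 -> mdist y z < e0 ->
  mdist x z < e0 -> mdist (br y x) z < e0 -> mdist x (br z y) < e0 ->
  br (br z y) x = br z x.
Proof.
by move=> *; apply: (bracketA _ _ _ _ _).1; rewrite /Delta/= metric_sym.
Qed.

Let bf (x y : S) : mdist x y < e0 -> mdist (phi x) (phi y) < e0 ->
  br (phi x) (phi y) = phi (br x y).
Proof. exact: bracket_phi. Qed.

Lemma bracket_phiV (x y : S) : mdist x y < e0 -> mdist (phiV x) (phiV y) < e0 ->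
  br (phiV y) (phiV x) = phiV (br y x).
Proof.
move=> xy xy'; apply: (can_inj (@phiK R S)); rewrite phiVK.
by rewrite -bf ?phiVK// metric_sym.
Qed.

Let near' (x : S) : \forall w \near (x, x),
  mdist w.1 w.2 < e0 -> mdist x (br w.2 w.1) < e0 / 2.
Proof.
have [[U V]/= [Ux Vx] UV] := bracket_near x.
exists (V, U) => //= -[y z]/= [Vy Uz]; rewrite metric_sym.
exact: (UV (z, y)).
Qed.

Let ctr (x y z : S) : br y x = y /\ mdist x y < e0 ->
  br z x = z /\ mdist x z < e0 ->
  mdist (phi y) (phi z) <= lambda0 S * mdist y z.
Proof. exact: (Xs_contract (eps0_gt0 S)). Qed.

Let ctr' (x y z : S) : br x y = y /\ mdist x y < e0 ->
  br x z = z /\ mdist x z < e0 ->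
  mdist (phiV y) (phiV z) <= lambda0 S * mdist y z.
Proof. exact: (Xu_contract (eps0_gt0 S)). Qed.

Let c := @space_compact R S.
Let e00 := eps0_gt0 S.
Let l0 := lambda0_gt0 S.
Let l1 := lambda0_lt1 S.
Let bxx := @bracketxx R S.

Lemma Gs_allE (x y : S) : Gs_all S (x, y) <-> exists n, Gs S n (x, y).
Proof. by split=> -[n]; exists n. Qed.

Lemma Gu_allE (x y : S) : Gu_all S (x, y) <-> exists n,
  br (iter n phiV x) (iter n phiV y) = iter n phiV y /\
  mdist (iter n phiV x) (iter n phiV y) < e0.
Proof.
by split=> -[n]; [move=> _ /GuE; exists n|move=> /GuE; exists n].
Qed.

Lemma Gs_refl (x : S) : Gs_all S (x, x).
Proof. by apply/Gs_allE; exact: (loc_refl phi e00 bxx x). Qed.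

Lemma Gs_sym (x y : S) : Gs_all S (x, y) -> Gs_all S (y, x).
Proof.
by move=> /Gs_allE h; apply/Gs_allE; exact: (loc_sym c e00 l0 l1 bracket_near bxx bA bf ctr h).
Qed.

Lemma Gs_trans (x y z : S) :
  Gs_all S (x, y) -> Gs_all S (y, z) -> Gs_all S (x, z).
Proof.
move=> /Gs_allE h /Gs_allE k; apply/Gs_allE.
exact: (loc_trans e00 l0 l1 bxx bA bf ctr h k).
Qed.

Lemma Gs_phi (x y : S) : Gs_all S (phi x, phi y) <-> Gs_all S (x, y).
Proof.
split=> /Gs_allE h; apply/Gs_allE.
  by apply/(loc_inv e00 l1 bxx bf ctr).
by apply/(loc_inv e00 l1 bxx bf ctr).
Qed.

Lemma Gu_refl (x : S) : Gu_all S (x, x).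
Proof. by apply/Gu_allE; exact: (@loc_refl _ _ phiV (fun a b => br b a) _ e00 bxx x). Qed.

Lemma Gu_sym (x y : S) : Gu_all S (x, y) -> Gu_all S (y, x).
Proof.
move=> /Gu_allE h; apply/Gu_allE.
exact: (@loc_sym _ _ c phiV (fun a b => br b a) _ _ e00 l0 l1 near' bxx bA' bracket_phiV ctr' _ _ h).
Qed.

Lemma Gu_trans (x y z : S) :
  Gu_all S (x, y) -> Gu_all S (y, z) -> Gu_all S (x, z).
Proof.
move=> /Gu_allE h /Gu_allE k; apply/Gu_allE.
exact: (@loc_trans _ _ phiV (fun a b => br b a) _ _ e00 l0 l1 bxx bA' bracket_phiV ctr' _ _ _ h k).
Qed.

Lemma Gu_phiV (x y : S) : Gu_all S (phiV x, phiV y) <-> Gu_all S (x, y).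
Proof.
have H := @loc_inv _ _ phiV (fun a b => br b a) _ _ e00 l1 bxx bracket_phiV ctr' x y.
by split=> /Gu_allE h; apply/Gu_allE; exact/H.
Qed.

End relation_theory.

Section relation_invariance.
Context (R : realType) (S : smale_space R).

Lemma Gs_le n m (x y : S) : (n <= m)%N -> Gs S n (x, y) -> Gs S m (x, y).
Proof.
move=> nm /GsE h; apply/GsE.
exact: (loc_le (eps0_gt0 S) (lambda0_lt1 S) (@bracketxx R S)
  (@bracket_phi R S) (fun x y z => Xs_contract (eps0_gt0 S) (lexx _))
  nm h).
Qed.

Lemma Gu_le n m (x y : S) : (n <= m)%N -> Gu S n (x, y) -> Gu S m (x, y).
Proof.
move=> nm /GuE h; apply/GuE.
exact: (@loc_le _ _ _ (fun a b => bracket b a) _ _ (eps0_gt0 S)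
  (lambda0_lt1 S) (@bracketxx R S) (@bracket_phiV R S)
  (fun x y z => Xu_contract (eps0_gt0 S) (lexx _)) _ _ _ _ nm h).
Qed.

Lemma Ga_allE (w : S * S) : Ga_all S w <-> Gs_all S w /\ Gu_all S w.
Proof.
split=> [[n _ [sn un]]|[[n _ sn] [m _ um]]]; first by split; exists n.
case: w sn um => x y sn um; exists (maxn n m) => //; split.
  exact: Gs_le (leq_maxl _ _) sn.
exact: Gu_le (leq_maxr _ _) um.
Qed.

Lemma phiz1 n (x : S) : phiz (n + 1) x = phi (phiz n x).
Proof. exact: iterzS (@phiVK R S) _ _. Qed.

Lemma phizB1 n (x : S) : phiz (n - 1) x = phiV (phiz n x).
Proof. exact: iterzP (@phiK R S) (@phiVK R S) _ _. Qed.

Lemma Gs_phiz n (x y : S) : Gs_all S (phiz n x, phiz n y) <-> Gs_all S (x, y).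
Proof.
elim: n x y => [//|n IH|n IH] x y.
  by rewrite -addn1 PoszD !phiz1 Gs_phi.
by rewrite -addn1 PoszD opprD !phizB1 -Gs_phi !phiVK.
Qed.

Lemma Gu_phiz n (x y : S) : Gu_all S (phiz n x, phiz n y) <-> Gu_all S (x, y).
Proof.
elim: n x y => [//|n IH|n IH] x y.
  by rewrite -addn1 PoszD !phiz1 -Gu_phiV !phiK.
by rewrite -addn1 PoszD opprD !phizB1 Gu_phiV.
Qed.

Lemma Ga_phiz n (x y : S) : Ga_all S (phiz n x, phiz n y) <-> Ga_all S (x, y).
Proof. by rewrite !Ga_allE Gs_phiz Gu_phiz. Qed.

Lemma Ga_refl (x : S) : Ga_all S (x, x).
Proof. by apply/Ga_allE; split; [exact: Gs_refl|exact: Gu_refl]. Qed.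

Lemma Ga_sym (x y : S) : Ga_all S (x, y) -> Ga_all S (y, x).
Proof.
by move=> /Ga_allE[s u]; apply/Ga_allE; split; [exact: Gs_sym|exact: Gu_sym].
Qed.

Lemma Ga_trans (x y z : S) :
  Ga_all S (x, y) -> Ga_all S (y, z) -> Ga_all S (x, z).
Proof.
move=> /Ga_allE[s u] /Ga_allE[s' u']; apply/Ga_allE; split.
  exact: Gs_trans s s'.
exact: Gu_trans u u'.
Qed.

End relation_invariance.

(** * Groupoids and their reduced C*-algebras *)

(* A groupoid whose arrows carry a topology.  [mul a b] is only meaningful when
   [src a = rng b].  Continuity of the operations and etaleness are not
   recorded because the constructions below do not refer to them. *)
Record groupoid := Groupoid {
  obj : Type ;
  arr : topologicalType ;
  rng : arr -> obj ;
  src : arr -> obj ;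
  unit_arr : obj -> arr ;
  mul : arr -> arr -> arr ;
  inv : arr -> arr ;
  rng_unit : forall x, rng (unit_arr x) = x ;
  src_unit : forall x, src (unit_arr x) = x ;
  rng_mul : forall a b, src a = rng b -> rng (mul a b) = rng a ;
  src_mul : forall a b, src a = rng b -> src (mul a b) = src b ;
  mul_assoc : forall a b c, src a = rng b -> src b = rng c ->
    mul a (mul b c) = mul (mul a b) c ;
  mul_unitl : forall a, mul (unit_arr (rng a)) a = a ;
  mul_unitr : forall a, mul a (unit_arr (src a)) = a ;
  rng_inv : forall a, rng (inv a) = src a ;
  src_inv : forall a, src (inv a) = rng a ;
  mul_inv : forall a, mul a (inv a) = unit_arr (rng a) ;
  inv_mul : forall a, mul (inv a) a = unit_arr (src a)
}.

Section reduced_algebra.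
Context (R : realType) (G : groupoid).
Local Notation C := (R[i]^o).
Local Notation normc := (@ComplexField.Normc.normc R).

Definition Cc (f : arr G -> C) :=
  continuous f /\ compact (closure [set g | f g != 0]).

Definition fibre (x : obj G) : set (arr G) := [set g | src g = x].

(* The square of the norm of the Hilbert C(X)-module, X the unit space:
   sup over x of the sum of |xi g|^2 over the arrows g with source x. *)
Definition norm2 (xi : arr G -> C) : \bar R :=
  ereal_sup [set (\esum_(g in fibre x) ((normc (xi g)) ^+ 2)%:E)%E | x in setT].

(* The completion of [Cc] is realized inside functions on the arrows: uniformly
   bounded families of square summable functions on the source fibres form a
   Banach space for [norm2], in which we take the closure of [Cc]. *)
Definition in_l2 : {pred arr G -> C} := fun xi =>
  `[< forall e : R, 0 < e -> exists2 f, Cc f & (norm2 (xi - f)%R <= e%:E)%E >].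

Lemma Cc0 : Cc 0.
Proof.
split; first by move=> x; exact: cvg_cst.
rewrite [X in closure X](_ : _ = set0) ?closure0; first exact: compact0.
by apply/seteqP; split => x //=; rewrite eqxx.
Qed.

Lemma Cc_lin (a : R[i]) (f g : arr G -> C) : Cc f -> Cc g -> Cc (a *: f + g).
Proof.
move=> [cf kf] [cg kg]; split.
  move=> x; apply: (@cvgD _ C _ _ _ (fun y => a *: f y)); last exact: cg.
  by apply: (@cvgZl_tmp _ C); exact: cf.
apply: (@subclosed_compact _ _
    (closure [set x | f x != 0] `|` closure [set x | g x != 0])).
- exact: closed_closure.
- exact: compactU.
- rewrite -closureU; apply: closure_subset => x /=.
  apply: contraPP => /not_orP[/negP + /negP]; rewrite !negbK => /eqP fx /eqP gx.
  by apply/negP; rewrite negbK /= !fctE fx gx scaler0 addr0.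
Qed.

Lemma normc_ge0 (z : R[i]) : 0 <= normc z.
Proof. by case: z => a b; rewrite sqrtr_ge0. Qed.

Lemma normc_lin (a z w : R[i]) :
  normc (a * z + w) ^+ 2 <= 2 * (normc a ^+ 2 * normc z ^+ 2 + normc w ^+ 2).
Proof.
have h : normc (a * z + w) <= normc a * normc z + normc w.
  by rewrite -ComplexField.Normc.normcM; exact: le_normcD.
have n0 := @normc_ge0.
apply: (@le_trans _ _ ((normc a * normc z + normc w) ^+ 2)).
  by rewrite ler_sqr// nnegrE ?addr_ge0 ?mulr_ge0.
rewrite -exprMn -subr_ge0.
have -> : 2 * ((normc a * normc z) ^+ 2 + normc w ^+ 2) -
  (normc a * normc z + normc w) ^+ 2 = (normc a * normc z - normc w) ^+ 2.
  by ring.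
exact: sqr_ge0.
Qed.

Lemma norm2_lin (a : R[i]) (f g : arr G -> C) (r s : R) :
  (norm2 f <= r%:E -> norm2 g <= s%:E ->
   norm2 (a *: f + g)%R <= (2 * ((normc a) ^+ 2 * r + s))%R%:E)%E.
Proof.
move=> fr gs; apply: ge_ereal_sup => _ [x _ <-].
have H (u : arr G -> C) t (A : {fset arr G}) : (norm2 u <= t%:E)%E ->
    [set` A] `<=` fibre x -> \sum_(h <- A) normc (u h) ^+ 2 <= t.
  move=> ut Ax; rewrite -lee_fin; apply: le_trans ut.
  apply: le_trans (ereal_sup_ubound _); last by exists x.
  apply: ereal_sup_ubound; exists [set` A]; first by split.
  by rewrite fsbig_finite//= set_fsetK sumEFin.
apply: ge_ereal_sup => _ [A [Afin Ax] <-].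
rewrite fsbig_finite//= sumEFin lee_fin.
apply: le_trans (ler_sum _ (fun h _ => normc_lin a (f h) (g h))) _.
rewrite -mulr_sumr big_split/= -mulr_sumr ler_pM2l// lerD//.
  by apply: ler_wpM2l; [exact: sqr_ge0|apply: H => //; rewrite fset_setK].
by apply: H => //; rewrite fset_setK.
Qed.

Lemma norm20 (e : R) : 0 < e -> (norm2 0%R <= e%:E)%E.
Proof.
move=> e0; apply: ge_ereal_sup => _ [x _ <-].
rewrite esum1 ?lee_fin ?ltW// => g _.
have -> : normc ((0 : arr G -> C) g) = 0 by exact: ComplexField.Normc.normc0.
by rewrite expr0n.
Qed.

Lemma in_l2_submod : submod_closed in_l2.
Proof.
split.
  by apply/asboolP => e e0; exists 0; [exact: Cc0|rewrite subr0; exact: norm20].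
move=> a f g /asboolP fl /asboolP gl; apply/asboolP => e e0.
pose c := 2 * ((normc a) ^+ 2 + 1).
have c0 : 0 < c by rewrite mulr_gt0// ltr_wpDl// sqr_ge0.
have [f' cf ff'] := fl (e / c) (divr_gt0 e0 c0).
have [g' cg gg'] := gl (e / c) (divr_gt0 e0 c0).
exists (a *: f' + g'); first exact: Cc_lin.
have -> : a *: f + g - (a *: f' + g') = a *: (f - f') + (g - g').
  by rewrite scalerBr opprD addrACA.
apply: le_trans (norm2_lin a ff' gg') _.
rewrite lee_fin -[X in _ + X]mul1r -mulrDl mulrA -/c mulrC divfK//.
by rewrite gt_eqF.
Qed.

HB.instance Definition _ :=
  GRing.isSubmodClosed.Build R[i] (arr G -> C) in_l2 in_l2_submod.

Record l2 := L2 { l2_val :> arr G -> C ; l2P : l2_val \in in_l2 }.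

HB.instance Definition _ := [isSub for l2_val].
HB.instance Definition _ := [Choice of l2 by <:].
HB.instance Definition _ := [SubChoice_isSubLmodule of l2 by <:].

(* Sums of absolutely summable families, through positive and negative parts
   and then real and imaginary parts. *)
Definition rsum (D : set (arr G)) (u : arr G -> R) : R :=
  fine (\esum_(g in D) (Num.max (u g) 0)%:E)%E -
  fine (\esum_(g in D) (Num.max (- u g) 0)%:E)%E.

Definition csum (D : set (arr G)) (u : arr G -> C) : C :=
  (rsum D (fun g => complex.Re (u g)) +i* rsum D (fun g => complex.Im (u g)))%C.

Definition inner (xi eta : l2) (x : obj G) : C :=
  csum (fibre x) (fun g => (xi g)^*%C * eta g).

Definition is_adjoint (T T' : l2 -> l2) :=
  forall xi eta x, inner (T xi) eta x = inner xi (T' eta) x.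

(* On an etale groupoid this sum has finitely many nonzero terms when [f] has
   compact support. *)
Definition conv (f xi : arr G -> C) : arr G -> C := fun g =>
  \sum_(h \in [set h | rng h = rng g]) f h * xi (mul (inv h) g).

(* The C*-algebra in its regular representation: the operator-norm closure,
   among the adjointable operators of [l2], of the left convolution operators
   by elements of [Cc].  It is the reduced C*-algebra, hence also the full one
   when the groupoid is amenable.  Involution is the adjoint.  The bound on
   [norm2] says that the squared operator norm of the difference is at most
   [e]. *)
Definition Cstar : set (l2 -> l2) := [set T |
  (exists T', is_adjoint T T') /\
  forall e : R, 0 < e -> exists2 f, Cc f &
    forall xi, (norm2 (l2_val (T xi) - conv f xi)%R <= e%:E * norm2 xi)%E].

End reduced_algebra.

Arguments l2 : clear implicits.
Arguments Cstar : clear implicits.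

(* Isomorphism of *-algebras between the operator algebras [A] and [B]; for
   C*-algebras such a map is automatically isometric. *)
Definition star_isomorphic (R : realType) (G H : groupoid)
    (A : set (l2 R G -> l2 R G)) (B : set (l2 R H -> l2 R H)) :=
  exists Phi : (l2 R G -> l2 R G) -> (l2 R H -> l2 R H),
  [/\ set_bij A B Phi,
      forall (c : R[i]) T T', A T -> A T' ->
        Phi (c *: T + T') = c *: Phi T + Phi T',
      forall T T', A T -> A T' -> Phi (T \o T') = Phi T \o Phi T' &
      forall T T', A T -> A T' -> is_adjoint T T' ->
        is_adjoint (Phi T) (Phi T')].

(** * The groupoids of a Smale space *)

(* Open sets of the disjoint union over [i : I] of the inductive limits of the
   increasing sequences [E i n] of subspaces of [Y], the [i]-th piece being
   embedded in [A] by [j i]. *)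
Definition indlim_open (T I : Type) (Y : topologicalType) (A : set T)
    (E : I -> nat -> set Y) (j : I -> Y -> T) (V : set (set_type A)) :=
  forall i n, exists2 O : set Y, open O &
    E i n `&` j i @^-1` (set_val @` V) = E i n `&` O.

Section indlim.
Context (T I : Type) (Y : topologicalType) (A : set T).
Context (E : I -> nat -> set Y) (j : I -> Y -> T).
Hypothesis EA : forall i n y, E i n y -> A (j i y).

Lemma indlim_openT : indlim_open E j [set: set_type A].
Proof.
move=> i n; exists setT; first exact: openT.
apply/seteqP; split=> y [Ey _]; split=> //=.
by exists (exist _ (j i y) (mem_set (EA Ey))).
Qed.

Lemma indlim_openI : setI_closed (@indlim_open T I Y A E j).
Proof.
move=> V W oV oW i n.
have [ O oO EO] := oV i n; have [P oP EP] := oW i n.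
exists (O `&` P); first exact: openI.
rewrite setIIr -EO -EP -setIIr -preimage_setI; congr (_ `&` (_ @^-1` _)).
apply/seteqP; split=> [_ [v [Vv Wv] <-]|t]; first by split; exists v.
by move=> [[v Vv <-] [w Ww /val_inj wv]]; exists v; last by []; split=> //; rewrite -wv.
Qed.

Lemma indlim_open_bigU (K : Type) (V : K -> set (set_type A)) :
  (forall k, indlim_open E j (V k)) -> indlim_open E j (\bigcup_k V k).
Proof.
move=> oV i n.
have /choice[ O HO] (k : K) : exists O : set Y, open O /\
    E i n `&` j i @^-1` (set_val @` V k) = E i n `&` O.
  by have [ O oO EO] := oV k i n; exists O.
exists (\bigcup_k O k); first by apply: bigcup_open => k _; exact: (HO k).1.
rewrite setI_bigcupr; under [RHS]eq_bigcupr do rewrite -(HO _).2.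
rewrite -setI_bigcupr; congr (_ `&` _).
apply/seteqP; split=> y.
  by move=> [v [k _ Vv] vy]; exists k => //; exists v.
by move=> [k _ [v Vv vy]]; exists v => //; exists k.
Qed.

End indlim.

Section smale_groupoids.
Context (R : realType) (S : smale_space R).

Definition asym_set : set (S * int * S) :=
  [set g | let: (x, n, y) := g in Ga_all S (phiz n x, y)].

Definition asym_arr : Type := set_type asym_set.

HB.instance Definition _ := Choice.copy asym_arr (set_type asym_set).

(* [(x, n, y)] corresponds to [((x, phi^-n y), n)] in [Ga_all S * int], so that
   [((x, w), n)] corresponds to [(x, n, phi^n w)]. *)
Definition asym_emb (n : int) (w : S * S) : S * int * S :=
  (w.1, n, phiz n w.2).

Definition asym_open : set (set asym_arr) :=
  @indlim_open _ _ _ asym_set (fun _ : int => Ga S) asym_emb.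

Lemma asym_embP n m w : Ga S m w -> asym_set (asym_emb n w).
Proof.
by case: w => x y xy; apply/Ga_phiz; exists m.
Qed.

HB.instance Definition _ := @isOpenTopological.Build asym_arr asym_open
  (indlim_openT asym_embP) (@indlim_openI _ _ _ _ _ _)
  (@indlim_open_bigU _ _ _ _ _ _).

Definition su_set : set (S * int * int * S) := [set g |
  let: (x, p, q, y) := g in Gs_all S (phiz p x, y) /\ Gu_all S (phiz q x, y)].

Definition su_arr : Type := set_type su_set.

HB.instance Definition _ := Choice.copy su_arr (set_type su_set).

Definition su_piece (pq : int * int) (n : nat) : set (S * S) := [set w |
  Gs S n (phiz pq.1 w.1, w.2) /\ Gu S n (phiz pq.2 w.1, w.2)].

Definition su_emb (pq : int * int) (w : S * S) : S * int * int * S :=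
  (w.1, pq.1, pq.2, w.2).

Definition su_open : set (set su_arr) :=
  @indlim_open _ _ _ su_set su_piece su_emb.

Lemma su_embP pq n w : su_piece pq n w -> su_set (su_emb pq w).
Proof. by case: w => x y [s u]; split; exists n. Qed.

HB.instance Definition _ := @isOpenTopological.Build su_arr su_open
  (indlim_openT su_embP) (@indlim_openI _ _ _ _ _ _)
  (@indlim_open_bigU _ _ _ _ _ _).

Lemma asym_composable (x y z : S) (m n : int) :
  Ga_all S (phiz m x, y) -> Ga_all S (phiz n y, z) ->
  Ga_all S (phiz (m + n) x, z).
Proof.
move=> xy yz; rewrite addrC phizD.
by apply: Ga_trans yz; exact/Ga_phiz.
Qed.

Lemma asym_inverse (x y : S) (n : int) :
  Ga_all S (phiz n x, y) -> Ga_all S (phiz (- n) y, x).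
Proof. by move=> /Ga_sym; rewrite -(Ga_phiz (- n)) phizK. Qed.

Lemma su_composable (x y z : S) (p q p' q' : int) :
  Gs_all S (phiz p x, y) /\ Gu_all S (phiz q x, y) ->
  Gs_all S (phiz p' y, z) /\ Gu_all S (phiz q' y, z) ->
  Gs_all S (phiz (p + p') x, z) /\ Gu_all S (phiz (q + q') x, z).
Proof.
move=> [sxy uxy] [syz uyz]; rewrite (addrC p) (addrC q) !phizD; split.
  by apply: Gs_trans syz; exact/Gs_phiz.
by apply: Gu_trans uyz; exact/Gu_phiz.
Qed.

Lemma su_inverse (x y : S) (p q : int) :
  Gs_all S (phiz p x, y) /\ Gu_all S (phiz q x, y) ->
  Gs_all S (phiz (- p) y, x) /\ Gu_all S (phiz (- q) y, x).
Proof.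
by move=> [/Gs_sym + /Gu_sym]; rewrite -(Gs_phiz (- p)) -(Gu_phiz (- q)) !phizK.
Qed.

Definition asym_rng (g : asym_arr) : S := (set_val g).1.1.
Definition asym_src (g : asym_arr) : S := (set_val g).2.
Definition asym_deg (g : asym_arr) : int := (set_val g).1.2.

Lemma asymP (g : asym_arr) :
  Ga_all S (phiz (asym_deg g) (asym_rng g), asym_src g).
Proof.
by rewrite /asym_deg /asym_rng /asym_src; case: g => [[[x n] y] /= /set_mem].
Qed.

Definition asym_mk (x : S) (n : int) (y : S)
    (h : Ga_all S (phiz n x, y)) : asym_arr :=
  exist _ (x, n, y) (mem_set (h : asym_set (x, n, y))).

Definition asym_unit (x : S) : asym_arr := @asym_mk x 0 x (Ga_refl x).

Definition asym_inv (g : asym_arr) : asym_arr := asym_mk (asym_inverse (asymP g)).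

(* [insubd a] returns the junk value [a] when [a] and [b] are not composable. *)
Definition asym_mul (a b : asym_arr) : asym_arr :=
  insubd (a : set_type asym_set)
    (asym_rng a, asym_deg a + asym_deg b, asym_src b).

Lemma asym_mulE a b : asym_src a = asym_rng b -> set_val (asym_mul a b) =
  (asym_rng a, asym_deg a + asym_deg b, asym_src b).
Proof.
move=> ab; apply: insubdK; apply/mem_set => /=.
by apply: asym_composable (asymP a) _; rewrite ab; exact: asymP.
Qed.

Lemma asym_eq (a b : asym_arr) : asym_rng a = asym_rng b ->
  asym_deg a = asym_deg b -> asym_src a = asym_src b -> a = b.
Proof.
case: a b => [[[x n] y] ga] [[[x' n'] y'] gb].
rewrite /asym_rng /asym_deg /asym_src /= => xx nn yy.
by apply: val_inj; rewrite /= xx nn yy.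
Qed.

Lemma asym_rngM a b : asym_src a = asym_rng b ->
  asym_rng (asym_mul a b) = asym_rng a.
Proof. by move=> ab; rewrite {1}/asym_rng asym_mulE. Qed.

Lemma asym_srcM a b : asym_src a = asym_rng b ->
  asym_src (asym_mul a b) = asym_src b.
Proof. by move=> ab; rewrite {1}/asym_src asym_mulE. Qed.

Lemma asym_degM a b : asym_src a = asym_rng b ->
  asym_deg (asym_mul a b) = asym_deg a + asym_deg b.
Proof. by move=> ab; rewrite {1}/asym_deg asym_mulE. Qed.

Definition asym_groupoid : groupoid.
Proof.
refine (@Groupoid S asym_arr asym_rng asym_src asym_unit asym_mul asym_inv
  _ _ asym_rngM asym_srcM _ _ _ _ _ _ _) => //.
- move=> a b c ab bc.
  have abc : asym_src (asym_mul a b) = asym_rng c by rewrite asym_srcM.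
  have bca : asym_src a = asym_rng (asym_mul b c) by rewrite asym_rngM.
  by apply: asym_eq; rewrite ?(asym_rngM, asym_srcM, asym_degM)// addrA.
- by move=> a; apply: asym_eq;
    rewrite ?(asym_rngM, asym_srcM, asym_degM)// add0r.
- by move=> a; apply: asym_eq;
    rewrite ?(asym_rngM, asym_srcM, asym_degM)// addr0.
- by move=> a; apply: asym_eq;
    rewrite ?(asym_rngM, asym_srcM, asym_degM)// addrN.
- by move=> a; apply: asym_eq;
    rewrite ?(asym_rngM, asym_srcM, asym_degM)// addNr.
Defined.

Definition su_rng (g : su_arr) : S := (set_val g).1.1.1.
Definition su_src (g : su_arr) : S := (set_val g).2.
Definition su_sdeg (g : su_arr) : int := (set_val g).1.1.2.
Definition su_udeg (g : su_arr) : int := (set_val g).1.2.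

Lemma suP (g : su_arr) :
  Gs_all S (phiz (su_sdeg g) (su_rng g), su_src g) /\
  Gu_all S (phiz (su_udeg g) (su_rng g), su_src g).
Proof.
rewrite /su_sdeg /su_udeg /su_rng /su_src.
by case: g => [[[[x p] q] y] /= /set_mem].
Qed.

Definition su_mk (x : S) (p q : int) (y : S)
    (h : Gs_all S (phiz p x, y) /\ Gu_all S (phiz q x, y)) : su_arr :=
  exist _ (x, p, q, y) (mem_set (h : su_set (x, p, q, y))).

Definition su_unit (x : S) : su_arr :=
  @su_mk x 0 0 x (conj (Gs_refl x) (Gu_refl x)).

Definition su_inv (g : su_arr) : su_arr := su_mk (su_inverse (suP g)).

Definition su_mul (a b : su_arr) : su_arr :=
  insubd (a : set_type su_set)
    (su_rng a, su_sdeg a + su_sdeg b, su_udeg a + su_udeg b, su_src b).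

Lemma su_mulE a b : su_src a = su_rng b -> set_val (su_mul a b) =
  (su_rng a, su_sdeg a + su_sdeg b, su_udeg a + su_udeg b, su_src b).
Proof.
move=> ab; apply: insubdK; apply/mem_set => /=.
by apply: su_composable (suP a) _; rewrite ab; exact: suP.
Qed.

Lemma su_eq (a b : su_arr) : su_rng a = su_rng b ->
  su_sdeg a = su_sdeg b -> su_udeg a = su_udeg b -> su_src a = su_src b ->
  a = b.
Proof.
case: a b => [[[[x p] q] y] ga] [[[[x' p'] q'] y'] gb].
rewrite /su_rng /su_sdeg /su_udeg /su_src /= => xx pp qq yy.
by apply: val_inj; rewrite /= xx pp qq yy.
Qed.

Lemma su_rngM a b : su_src a = su_rng b -> su_rng (su_mul a b) = su_rng a.
Proof. by move=> ab; rewrite {1}/su_rng su_mulE. Qed.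

Lemma su_srcM a b : su_src a = su_rng b -> su_src (su_mul a b) = su_src b.
Proof. by move=> ab; rewrite {1}/su_src su_mulE. Qed.

Lemma su_sdegM a b : su_src a = su_rng b ->
  su_sdeg (su_mul a b) = su_sdeg a + su_sdeg b.
Proof. by move=> ab; rewrite {1}/su_sdeg su_mulE. Qed.

Lemma su_udegM a b : su_src a = su_rng b ->
  su_udeg (su_mul a b) = su_udeg a + su_udeg b.
Proof. by move=> ab; rewrite {1}/su_udeg su_mulE. Qed.

Definition su_groupoid : groupoid.
Proof.
refine (@Groupoid S su_arr su_rng su_src su_unit su_mul su_inv
  _ _ su_rngM su_srcM _ _ _ _ _ _ _) => //.
- move=> a b c ab bc.
  have abc : su_src (su_mul a b) = su_rng c by rewrite su_srcM.
  have bca : su_src a = su_rng (su_mul b c) by rewrite su_rngM.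
  by apply: su_eq; rewrite ?(su_rngM, su_srcM, su_sdegM, su_udegM)// addrA.
- by move=> a; apply: su_eq;
    rewrite ?(su_rngM, su_srcM, su_sdegM, su_udegM)// add0r.
- by move=> a; apply: su_eq;
    rewrite ?(su_rngM, su_srcM, su_sdegM, su_udegM)// addr0.
- by move=> a; apply: su_eq;
    rewrite ?(su_rngM, su_srcM, su_sdegM, su_udegM)// addrN.
- by move=> a; apply: su_eq;
    rewrite ?(su_rngM, su_srcM, su_sdegM, su_udegM)// addNr.
Defined.

End smale_groupoids.

(** * Ruelle algebras and the diagonal action *)

Section ruelle.
Context (R : realType) (S : smale_space R).
Local Notation C := (R[i]^o).
Local Notation normc := (@ComplexField.Normc.normc R).

Definition ruelle_a := Cstar R (asym_groupoid S).

Definition ruelle_su := Cstar R (su_groupoid S).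

Record circle := Circle { circle_val :> R[i] ; circleP : `|circle_val| = 1 }.

Lemma circle_inv_subproof (z : circle) : `|(z : R[i])^-1| = 1.
Proof. by rewrite normfV circleP invr1. Qed.

Definition circle_inv (z : circle) := Circle (circle_inv_subproof z).

Definition phase (z : circle * circle) (g : su_arr S) : R[i] :=
  (z.1 : R[i]) ^ su_sdeg g * (z.2 : R[i]) ^ (- su_udeg g).

Lemma circle_neq0 (z : circle) : (z : R[i]) != 0.
Proof. by rewrite -normr_eq0 circleP oner_eq0. Qed.

Lemma phase_neq0 z g : phase z g != 0.
Proof. by rewrite mulf_neq0// expfz_neq0// circle_neq0. Qed.

Lemma circle_exprz (z : circle) (n : int) : `|(z : R[i]) ^ n| = 1.
Proof.
case: n => n; first by rewrite normrX circleP expr1n.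
by rewrite NegzE -exprnN normfV normrX circleP expr1n invr1.
Qed.

Lemma normr_phase z g : `|phase z g| = 1.
Proof. by rewrite normrM !circle_exprz mulr1. Qed.

Lemma normc_phase z g : normc (phase z g) = 1.
Proof.
have := normr_phase z g; rewrite normc_def.
by case: (phase z g) => a b /= [->].
Qed.

Definition phase_mul (z : circle * circle) (xi : su_arr S -> C) : su_arr S -> C :=
  fun g => phase z g * xi g.

Lemma norm2_phase_mul z (xi : arr (su_groupoid S) -> C) :
  norm2 (phase_mul z xi : arr (su_groupoid S) -> C) = norm2 xi.
Proof.
congr ereal_sup; apply: eq_imagel => x _; apply: eq_esum => g _.
by rewrite ComplexField.Normc.normcM normc_phase mul1r.
Qed.

Lemma Cc_phase_mul z (f : arr (su_groupoid S) -> C) :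
  Cc f -> Cc (phase_mul z f : arr (su_groupoid S) -> C).
Proof.
move=> [cf kf]; split; last first.
  congr (compact (closure _)) : kf; apply/funext => g /=.
  by rewrite mulf_eq0 (negPf (phase_neq0 z g)).
apply/continuousP => O oO; change (su_open (phase_mul z f @^-1` O)) => pq n.
pose c : R[i] := (z.1 : R[i]) ^ pq.1 * (z.2 : R[i]) ^ (- pq.2).
have oO' : open ((fun w : C => c * w : C) @^-1` O).
  apply: open_comp => // w _.
  apply: (@cvgZ _ C C (nbhs w) _ (fun=> c) id c w); [exact: cvg_cst|exact: cvg_id].
have fO : su_open (f @^-1` ((fun w : C => c * w : C) @^-1` O)).
  by move/continuousP: cf; apply.
have [P oP EP] := fO pq n.
exists P => //; rewrite -EP; congr (_ `&` _).
apply/seteqP; split => w [g Og gw]; exists g => //; move: Og;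
  by rewrite /phase_mul /phase /su_sdeg /su_udeg /= gw.
Qed.

Lemma l2_phase_mul z (xi : l2 R (su_groupoid S)) :
  in_l2 (phase_mul z xi : arr (su_groupoid S) -> C).
Proof.
have /asboolP xil := l2P xi; apply/asboolP => e e0.
have [f cf fe] := xil e e0; exists (phase_mul z f); first exact: Cc_phase_mul.
rewrite (_ : _ - _ = phase_mul z (l2_val xi - f)) ?norm2_phase_mul//.
by apply/funext => g; rewrite /phase_mul /= mulrBr.
Qed.

Definition U_op (z : circle * circle) (xi : l2 R (su_groupoid S)) :
  l2 R (su_groupoid S) := L2 (l2_phase_mul z xi).

(* [Ad U_z], the inverse of [U_z] being [U_op] at the inverse of [z]. *)
Definition rho (z : circle * circle)
    (T : l2 R (su_groupoid S) -> l2 R (su_groupoid S)) :=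
  U_op z \o T \o U_op (circle_inv z.1, circle_inv z.2).

Definition delta (z : circle) := rho (z, z).

Definition fixed_point_algebra := [set T | ruelle_su T /\ forall z, delta z T = T].

End ruelle.

Arguments ruelle_a {R} S _.
Arguments fixed_point_algebra {R} S _.

(* Main.v *)
(* Write [G] for the groupoid of [R^{s,u}], [H] for that of [R^a], and [d] for
   the cocycle [(x, p, q, y) |-> p - q] on [G].  The map
   [(x, n, y) |-> (x, n, n, y)] identifies [H] with the clopen subgroupoid
   [d = 0], and [U_op (z, z)] multiplies a function on [G] by [z ^ d].  The
   isomorphism compresses an operator to the functions supported on [d = 0].

   Averaging over the circle shows that an operator fixed by [delta] preserves
   these functions, so that compression is multiplicative on the fixed point
   algebra, and that it is approximated by convolutions by functions supported
   on [d = 0].  Each source fibre of [G] is a disjoint union of translates of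
   source fibres of [H], one for each value of [d], so convolution by such a
   function has the same norm bounds on [G] as on [H].  This gives injectivity,
   and surjectivity because a Cauchy sequence of convolutions on [H] remains
   Cauchy on [G].

   The bounds need only that [G] is etale: arrows between nearby points are
   locally unique by expansiveness, and the bracket supplies the local sections
   of the range map. *)

Require Import Defs.
From mathcomp Require Import all_boot all_order all_algebra.
From mathcomp Require Import complex finmap ring lra zify.
From mathcomp Require Import all_classical all_reals all_analysis.
Set Implicit Arguments.
Unset Strict Implicit.
Unset Printing Implicit Defensive.
Import Order.TTheory GRing.Theory Num.Theory.
Import numFieldNormedType.Exports.
Local Open Scope classical_set_scope.
Local Open Scope ring_scope.

(** * Finite sums and matrices *)

Section finite_sums.
Context (R : realType).
Local Notation C := (R[i]^o).
Local Notation normc := (@ComplexField.Normc.normc R).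

(** On a source fibre, convolution by [f] is the matrix with entries [f (mul g (inv k))], and
    [conv_bounded] bounds all its finite blocks at once; this is the form in which norms are
    compared between [G] and [H]. The obstacle is that a bound known on [H] concerns elements of
    [l2], whose norm is a supremum over all fibres, whereas a block acts on an arbitrary vector on a
    single fibre. [Cc_interpolate] bridges the two: such a vector extends to a continuous compactly
    supported function of no larger norm. Averaging needs no integral, since at a fixed arrow only
    finitely many frequencies occur and each is removed by averaging two points of the circle.
    Members of [Cstar] are bare maps, so equalities between them are proved value by value, with
    errors tending to zero along approximating convolutions. For the topology, the pieces are
    defined by bracket equations; these are traded for strict inequalities along orbits
    ([su_close]), of which contraction leaves only finitely many to control inside each piece. *)

Lemma normcM (z w : C) : normc (z * w) = normc z * normc w.
Proof. exact: ComplexField.Normc.normcM. Qed.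

Lemma normcD (z w : C) : normc (z + w) <= normc z + normc w.
Proof. exact: le_normcD. Qed.

Lemma normcN (z : C) : normc (- z) = normc z.
Proof. exact: complex.normcN. Qed.

Lemma normcJ (z : C) : normc z^*%C = normc z.
Proof. by case: z => a b /=; rewrite sqrrN. Qed.

Lemma normcC (z w : C) : normc (z - w) = normc (w - z).
Proof. by rewrite -normcN opprB. Qed.

Lemma normc0 : normc 0 = 0. Proof. exact: ComplexField.Normc.normc0. Qed.

Lemma normc_sqrE (z : C) : (normc z ^+ 2)%:C%C = z^*%C * z :> R[i].
Proof. by rewrite mulrC -sqr_normc rmorphXn; case: z. Qed.

Lemma normc_real (r : R) : normc r%:C%C = `|r|.
Proof. by rewrite /= expr0n /= addr0 sqrtr_sqr. Qed.

Lemma normc_sqrD (z w : C) :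
  normc (z + w) ^+ 2 <= 2 * (normc z ^+ 2 + normc w ^+ 2).
Proof.
by have := normc_lin 1 z w; rewrite mul1r ComplexField.Normc.normc1 expr1n mul1r.
Qed.

Lemma normc_sqrB (z w : C) :
  normc (z - w) ^+ 2 <= 2 * (normc z ^+ 2 + normc w ^+ 2).
Proof. by rewrite -(normcN w); exact: normc_sqrD. Qed.

Lemma normc_sum (I : Type) (r : seq I) (P : pred I) (F : I -> C) :
  normc (\sum_(i <- r | P i) F i) <= \sum_(i <- r | P i) normc (F i).
Proof.
apply: (big_ind2 (fun (z : C) a => normc z <= a)) => //.
  by rewrite normc0.
by move=> z a w b za wb; apply: le_trans (normcD _ _) _; exact: lerD.
Qed.

(* Cauchy-Schwarz, in a form with no square roots of weights. *)
Lemma sqr_sum_le (I : Type) (r : seq I) (s a b : I -> R) :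
  (forall i, 0 <= a i) -> (forall i, 0 <= b i) ->
  (forall i, s i ^+ 2 <= a i * b i) ->
  (\sum_(i <- r) s i) ^+ 2 <= (\sum_(i <- r) a i) * (\sum_(i <- r) b i).
Proof.
move=> a0 b0 sab; elim: r => [|i r IH]; first by rewrite !big_nil expr0n mul0r.
rewrite !big_cons; move: IH (sab i) (a0 i) (b0 i).
have : 0 <= \sum_(j <- r) a j by exact: sumr_ge0.
have : 0 <= \sum_(j <- r) b j by exact: sumr_ge0.
move: (\sum_(j <- r) s j) (\sum_(j <- r) a j) (\sum_(j <- r) b j) => S A B.
move: (s i) (a i) (b i) => t c d B0 A0 SAB tcd c0 d0.
(* The cross term: its square is at most 4 (A d)(B c), which is at most the square of A d + B c. *)
have tS : 2 * (t * S) <= A * d + B * c.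
  apply: le_trans (ler_norm _) _.
  rewrite -ler_sqr ?nnegrE ?addr_ge0 ?mulr_ge0// real_normK ?num_real//.
  apply: (@le_trans _ _ (4 * ((A * d) * (B * c)))).
    have -> : (2 * (t * S)) ^+ 2 = 4 * (t ^+ 2 * S ^+ 2) by ring.
    have -> : A * d * (B * c) = (c * d) * (A * B) by ring.
    by rewrite ler_pM2l// ler_pM// sqr_ge0.
  rewrite -subr_ge0.
  have -> : (A * d + B * c) ^+ 2 - 4 * (A * d * (B * c)) =
    (A * d - B * c) ^+ 2 by ring.
  exact: sqr_ge0.
rewrite sqrrD; apply: (@le_trans _ _ (c * d + (A * d + B * c) + A * B)).
  by rewrite lerD// lerD// -mulr_natl.
suff -> : c * d + (A * d + B * c) + A * B = (c + A) * (d + B) by [].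
by ring.
Qed.

Lemma sqr_normc_sum_le (I : Type) (r : seq I) (u v : I -> C) :
  normc (\sum_(i <- r) u i * v i) ^+ 2 <=
  (\sum_(i <- r) normc (u i) ^+ 2) * (\sum_(i <- r) normc (v i) ^+ 2).
Proof.
apply: (@le_trans _ _ ((\sum_(i <- r) normc (u i * v i)) ^+ 2)).
  rewrite ler_sqr ?nnegrE ?normc_ge0//; first exact: normc_sum.
  by apply: sumr_ge0 => i _; exact: normc_ge0.
by apply: sqr_sum_le => i; rewrite ?sqr_ge0// normcM exprMn.
Qed.

(** The block of [M] with rows [F] and columns [Q] has squared operator norm at most [c]; squares
    match the convention of [norm2]. *)
Definition mx_bound (I : Type) (F Q : seq I) (M : I -> I -> C) (c : R) :=
  forall v : I -> C,
    \sum_(g <- F) normc (\sum_(k <- Q) M g k * v k) ^+ 2 <=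
    c * \sum_(k <- Q) normc (v k) ^+ 2.

(** With u the image of w under the adjoint, the squared norm s of u is the pairing of M u with w.
    Cauchy-Schwarz and the bound on M give s^2 <= (c s) t, with t the squared norm of w, and s
    cancels. *)
Lemma mx_bound_adjoint (I : Type) (F Q : seq I) (M : I -> I -> C) (c : R) :
  0 <= c -> mx_bound F Q M c -> mx_bound Q F (fun k g => (M g k)^*%C) c.
Proof.
move=> c0 HM w; pose u k : C := \sum_(g <- F) (M g k)^*%C * w g.
set s := leLHS; pose t := \sum_(g <- F) normc (w g) ^+ 2.
have s0 : 0 <= s by apply: sumr_ge0 => k _; exact: sqr_ge0.
have t0 : 0 <= t by apply: sumr_ge0 => k _; exact: sqr_ge0.
have sE : s%:C%C = \sum_(g <- F) (\sum_(k <- Q) M g k * u k)^*%C * w g :> C.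
  rewrite /s rmorph_sum /=.
  under eq_bigr => k _.
    rewrite normc_sqrE -/(u k) [in X in _ * X]/u mulr_sumr.
    under eq_bigr do rewrite mulrA.
    over.
  rewrite exchange_big /=; apply: eq_bigr => g _.
  rewrite rmorph_sum mulr_suml; apply: eq_bigr => k _.
  by rewrite rmorphM /= [(u k)^*%C * _]mulrC.
have : s ^+ 2 <= (c * s) * t.
  have -> : s = normc (s%:C)%C by rewrite normc_real ger0_norm.
  rewrite [in leLHS]sE normc_real ger0_norm//.
  apply: le_trans (sqr_normc_sum_le _ _ _) _.
  apply: ler_wpM2r => //; under eq_bigr do rewrite normcJ.
  exact: HM.
move=> H; have [->|sn0] := eqVneq s 0; first by rewrite mulr_ge0.
rewrite -(@ler_pM2r _ s) ?lt0r ?sn0// -expr2 (le_trans H)//.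
suff -> : c * s * t = c * t * s by []; by ring.
Qed.

(** Schur test: Cauchy-Schwarz with weights [normc (M g k)] in each row spends the row sums, and
    exchanging the sums then spends the column sums. *)
Lemma mx_bound_schur (I : eqType) (F Q : seq I) (M : I -> I -> C) (r : R) :
  {in F, forall g, \sum_(k <- Q) normc (M g k) <= r} ->
  {in Q, forall k, \sum_(g <- F) normc (M g k) <= r} ->
  mx_bound F Q M (r ^+ 2).
Proof.
move=> Mr Mc v.
have n0 := @normc_ge0 R.
apply: (@le_trans _ _ (\sum_(g <- F)
    r * \sum_(k <- Q) normc (M g k) * normc (v k) ^+ 2)).
  rewrite big_seq [leRHS]big_seq; apply: ler_sum => g gF.
  apply: (@le_trans _ _ ((\sum_(k <- Q) normc (M g k)) *
      \sum_(k <- Q) normc (M g k) * normc (v k) ^+ 2)).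
    apply: (@le_trans _ _ ((\sum_(k <- Q) normc (M g k * v k)) ^+ 2)).
      rewrite ler_sqr ?nnegrE//; first exact: normc_sum.
      exact: sumr_ge0.
    apply: sqr_sum_le => // k; first by rewrite mulr_ge0// sqr_ge0.
    by rewrite normcM exprMn [leRHS]mulrA -expr2.
  apply: ler_wpM2r; last exact: Mr.
  by apply: sumr_ge0 => k _; rewrite mulr_ge0// sqr_ge0.
rewrite -mulr_sumr exchange_big /= expr2 -mulrA.
(* Nonnegativity of [r] is read off a column; without columns both sides vanish. *)
have [->|Q0] := eqVneq Q [::]; first by rewrite !big_nil !mulr0.
have r0 : 0 <= r.
  case: Q Q0 Mc {Mr} => // k Q _ Mc.
  by apply: le_trans (Mc k (mem_head _ _)); exact: sumr_ge0.
rewrite ler_wpM2l// mulr_sumr big_seq [leRHS]big_seq.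
apply: ler_sum => k kQ; rewrite -mulr_suml ler_wpM2r ?sqr_ge0//.
exact: Mc.
Qed.

End finite_sums.

(** * Unordered sums *)

Section unordered_sums.
Context (R : realType) (T : choiceType).
Implicit Types (D : set T) (w : T -> R) (A B : {fset T}).

Lemma esum_leP D w (c : R) :
  (\esum_(x in D) (w x)%:E <= c%:E)%E <->
  forall A, [set` A] `<=` D -> \sum_(x <- A) w x <= c.
Proof.
split=> [H A AD|H].
  rewrite -lee_fin; apply: le_trans H; apply: ereal_sup_ubound.
  by exists [set` A]; [split|rewrite fsbig_finite//= set_fsetK sumEFin].
apply: ge_ereal_sup => _ [A [Afin AD] <-].
rewrite fsbig_finite//= sumEFin lee_fin; apply: H.
by rewrite fset_setK.
Qed.

(** Net convergence: one finite set nearly attains the supremum, and larger sets only do better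
    because the terms are nonnegative. *)
Lemma esum_approx D w (c : R) : (forall x, 0 <= w x) ->
  (forall A, [set` A] `<=` D -> \sum_(x <- A) w x <= c) ->
  forall e : R, 0 < e -> exists2 A, [set` A] `<=` D &
    forall B, (A `<=` B)%fset -> [set` B] `<=` D ->
    `|fine (\esum_(x in D) (w x)%:E)%E - \sum_(x <- B) w x| <= e.
Proof.
move=> w0 wc e e0; set s := (\esum_(x in D) _)%E.
have sc : (s <= c%:E)%E by apply/esum_leP.
have s0 : (0 <= s)%E by apply: esum_ge0 => x _; rewrite lee_fin.
have sf : s \is a fin_num by rewrite ge0_fin_numE// (le_lt_trans sc)// ltry.
have [_ [F [Ffin FD] <-]] := ub_ereal_sup_adherent e0 sf.
rewrite -/(esum D _) -/s fsbig_finite//= sumEFin => sF.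
exists (fset_set F); first by rewrite fset_setK.
move=> B FB BD; rewrite ger0_norm ?subr_ge0; last first.
  by apply: (esum_leP D w (fine s)).1 => //; rewrite fineK.
rewrite lerBlDl -lerBlDr; apply/ltW; rewrite -lte_fin EFinB fineK//.
apply: lt_le_trans sF _; rewrite lee_fin.
rewrite (big_fsetID _ (mem (fset_set F)) B) /=.
rewrite (_ : [fset x in B | x \in fset_set F]%fset = fset_set F).
  by rewrite lerDl sumr_ge0.
apply/fsetP => x; rewrite !inE andb_idl// => xF.
exact: (fsubsetP FB).
Qed.

Lemma sum_fsetU (V : nmodType) (f : T -> V) A B : [disjoint A & B]%fset ->
  \sum_(x <- (A `|` B)%fset) f x = \sum_(x <- A) f x + \sum_(x <- B) f x.
Proof.
move=> AB; rewrite -big_cat; apply: perm_big; apply: uniq_perm.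
- exact: fset_uniq.
- rewrite cat_uniq !fset_uniq andbT; apply/hasPn => x xB.
  by apply: contraL AB => xA; apply/negP => /fdisjointP/(_ x xA); rewrite xB.
- by move=> x; rewrite mem_cat inE.
Qed.

(** Cauchy criterion: the sums over [A] and over the union of [A] and [B] are both within e / 2 of
    the total. *)
Lemma sum_tail D w (c : R) : (forall x, 0 <= w x) ->
  (forall A, [set` A] `<=` D -> \sum_(x <- A) w x <= c) ->
  forall e : R, 0 < e -> exists2 A, [set` A] `<=` D &
    forall B, [set` B] `<=` D -> [disjoint A & B]%fset ->
    \sum_(x <- B) w x <= e.
Proof.
move=> w0 wc e e0; have e20 : 0 < e / 2 by rewrite divr_gt0.
have [A AD HA] := esum_approx w0 wc e20.
exists A => // B BD AB.
have ABD : [set` (A `|` B)%fset] `<=` D.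
  by move=> x /=; rewrite inE => /orP[/AD|/BD].
have := HA _ (fsubsetUl A B) ABD; have := HA A (fsubset_refl _) AD.
rewrite sum_fsetU// !ler_norml => /andP[h1 h2] /andP[h3 h4]; lra.
Qed.

End unordered_sums.

Section csum_theory.
Context (R : realType) (G : groupoid).
Local Notation C := (R[i]^o).
Local Notation normc := (@ComplexField.Normc.normc R).

Lemma normc_ReIm (z : R[i]) : normc z <= `|complex.Re z| + `|complex.Im z|.
Proof.
case: z => a b /=; rewrite -[leRHS]ger0_norm ?addr_ge0// -sqrtr_sqr ler_wsqrtr//.
by rewrite sqrrD !real_normK ?num_real// lerD2r lerDl mulrn_wge0// mulr_ge0.
Qed.

Lemma normc_geRe (z : R[i]) : `|complex.Re z| <= normc z.
Proof.
by case: z => a b /=; rewrite -sqrtr_sqr ler_wsqrtr// lerDl sqr_ge0.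
Qed.

Lemma normc_geIm (z : R[i]) : `|complex.Im z| <= normc z.
Proof.
by case: z => a b /=; rewrite -sqrtr_sqr ler_wsqrtr// lerDr sqr_ge0.
Qed.

Lemma rsum_approx (D : set (arr G)) (u : arr G -> R) (c : R) :
  (forall A : {fset arr G}, [set` A] `<=` D -> \sum_(x <- A) `|u x| <= c) ->
  forall e : R, 0 < e -> exists2 A : {fset arr G}, [set` A] `<=` D &
    forall B, (A `<=` B)%fset -> [set` B] `<=` D ->
    `|rsum D u - \sum_(x <- B) u x| <= e.
Proof.
move=> uc e e0; have e20 : 0 < e / 2 by rewrite divr_gt0.
have mx0 (v : arr G -> R) x : 0 <= Num.max (v x) 0 by rewrite le_max lexx orbT.
have mxn (v : arr G -> R) x : Num.max (v x) 0 <= `|v x|.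
  by rewrite ge_max normr_ge0 ler_norm.
have mxnN x : Num.max (- u x) 0 <= `|u x|.
  by rewrite -normrN; exact: (mxn (fun x => - u x)).
have [A1 A1D H1] := esum_approx (mx0 u)
  (fun A AD => le_trans (ler_sum _ (fun x _ => mxn u x)) (uc A AD)) e20.
have [A2 A2D H2] := @esum_approx R _ D (fun x => Num.max (- u x) 0) c
  (mx0 (fun x => - u x))
  (fun A AD => le_trans (ler_sum _ (fun x _ => mxnN x)) (uc A AD)) _ e20.
exists (A1 `|` A2)%fset.
  by move=> x /=; rewrite inE => /orP[/A1D|/A2D].
move=> B; rewrite fsubUset => /andP[AB1 AB2] BD.
have := H1 B AB1 BD; have := H2 B AB2 BD.
have -> : \sum_(x <- B) u x =
    \sum_(x <- B) Num.max (u x) 0 - \sum_(x <- B) Num.max (- u x) 0.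
  rewrite -sumrB; apply: eq_bigr => x _.
  rewrite /Num.max; do 2 case: ifPn; rewrite ?oppr_lt0 -?leNgt => h1 h2; lra.
rewrite /rsum !ler_norml => /andP[h1 h2] /andP[h3 h4]; lra.
Qed.

(** This makes [csum], and with it [inner], a limit of finite sums, so that identities between inner
    products can be checked on finite sets up to an error. *)
Lemma csum_approx (D : set (arr G)) (u : arr G -> C) (c : R) :
  (forall A : {fset arr G}, [set` A] `<=` D -> \sum_(x <- A) normc (u x) <= c) ->
  forall e : R, 0 < e -> exists2 A : {fset arr G}, [set` A] `<=` D &
    forall B, (A `<=` B)%fset -> [set` B] `<=` D ->
    normc (csum D u - \sum_(x <- B) u x) <= e.
Proof.
move=> uc e e0; have e20 : 0 < e / 2 by rewrite divr_gt0.
have [A1 A1D H1] := @rsum_approx D (fun x => complex.Re (u x)) c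
  (fun A AD => le_trans (ler_sum _ (fun x _ => normc_geRe (u x))) (uc A AD)) _ e20.
have [A2 A2D H2] := @rsum_approx D (fun x => complex.Im (u x)) c
  (fun A AD => le_trans (ler_sum _ (fun x _ => normc_geIm (u x))) (uc A AD)) _ e20.
exists (A1 `|` A2)%fset.
  by move=> x /=; rewrite inE => /orP[/A1D|/A2D].
move=> B; rewrite fsubUset => /andP[AB1 AB2] BD.
have -> : \sum_(x <- B) u x = ((\sum_(x <- B) complex.Re (u x)) +i*
    (\sum_(x <- B) complex.Im (u x)))%C :> C.
  elim/big_rec3: _ => // x a b z _ ->.
  by case: (u x).
apply: le_trans (normc_ReIm _) _ => /=.
by rewrite [leRHS]splitr lerD//; [exact: H1|exact: H2].
Qed.

End csum_theory.

Local Notation mul := Defs.mul.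
Local Notation inv := Defs.inv.
Local Notation conv := Defs.conv.

(** * Passing from local to global on a compact set *)

Section compact_induction.
Context (T : topologicalType) (P : set T -> Prop).
Hypothesis P0 : P set0.
Hypothesis PU : forall A B, P A -> P B -> P (A `|` B).
Hypothesis PS : forall A B, A `<=` B -> P B -> P A.

(* Near covering for the filter of large sets satisfying [P]. *)
Lemma compact_ind (K : set T) : compact K ->
  (forall x, K x -> exists2 U, nbhs x U & P U) -> P K.
Proof.
move=> /compact_near_coveringP Kc KP.
pose F : set_system (set T) :=
  [set W | exists2 A, P A & forall B, P B -> A `<=` B -> W B].
have FF : Filter F.
  split; first by exists set0.
  - move=> V W [A PA AV] [B PB BW]; exists (A `|` B); first exact: PU.
    move=> D PD; rewrite subUset => -[AD BD]; split; [exact: AV|exact: BW].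
  - by move=> V W VW [A PA AV]; exists A => // B PB AB; exact/VW/AV.
have [A PA HA] : F [set W : set T | K `<=` W].
  apply: (Kc _ F (fun W x => W x) FF) => x Kx.
  have [U xU PU'] := KP x Kx.
  exists (U, [set W | U `<=` W]) => /=.
    by split => //; exists U.
  by move=> [y W] /= [Uy UW]; exact: UW.
exact: PS (HA A PA (@subset_refl _ A)) PA.
Qed.

End compact_induction.

(** * Convolution on a groupoid *)

Section groupoid_algebra.
Context (G : groupoid).
Implicit Types a b c : arr G.

Lemma mulVgK a b : src a = rng b -> mul (inv a) (mul a b) = b.
Proof.
by move=> ab; rewrite mul_assoc ?src_inv// inv_mul ab mul_unitl.
Qed.

Lemma mulgVK a b : rng a = rng b -> mul a (mul (inv a) b) = b.
Proof.
by move=> ab; rewrite mul_assoc ?src_inv ?rng_inv// mul_inv ab mul_unitl.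
Qed.

Lemma mulgKV a b : src a = src b -> mul (mul a (inv b)) b = a.
Proof.
by move=> ab; rewrite -mul_assoc ?src_inv ?rng_inv// inv_mul -ab mul_unitr.
Qed.

Lemma mulgK a b : src a = rng b -> mul (mul a b) (inv b) = a.
Proof.
by move=> ab; rewrite -mul_assoc ?src_inv ?rng_inv// mul_inv -ab mul_unitr.
Qed.

Lemma inv_unique a b : src a = rng b -> mul a b = unit_arr (rng a) -> b = inv a.
Proof.
move=> ab e; rewrite -[LHS](mulVgK ab) e -(src_inv a).
exact: mul_unitr.
Qed.

Lemma invgK a : inv (inv a) = a.
Proof.
by apply/esym/inv_unique; rewrite ?src_inv ?rng_inv ?inv_mul.
Qed.

Lemma invMg a b : src a = rng b -> inv (mul a b) = mul (inv b) (inv a).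
Proof.
move=> ab; apply/esym/inv_unique; first by rewrite src_mul// rng_mul ?rng_inv// src_inv.
rewrite mul_assoc ?src_mul ?rng_inv ?src_inv// mulgK// rng_mul//.
by rewrite mul_inv.
Qed.

Lemma rng_mulV a b : src a = src b -> rng (mul a (inv b)) = rng a.
Proof. by move=> ab; rewrite rng_mul// rng_inv. Qed.

Lemma src_mulV a b : src a = src b -> src (mul a (inv b)) = rng b.
Proof. by move=> ab; rewrite src_mul ?rng_inv// src_inv. Qed.

Lemma rng_Vmul a b : rng a = rng b -> rng (mul (inv a) b) = src a.
Proof. by move=> ab; rewrite rng_mul ?src_inv// rng_inv. Qed.

Lemma src_Vmul a b : rng a = rng b -> src (mul (inv a) b) = src b.
Proof. by move=> ab; rewrite src_mul ?src_inv. Qed.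

Lemma inv_mulV a b : src a = src b -> inv (mul a (inv b)) = mul b (inv a).
Proof. by move=> ab; rewrite invMg ?rng_inv// invgK. Qed.

Lemma mulV_Vmul a b : src a = src b -> mul (inv (mul a (inv b))) a = b.
Proof. by move=> ab; rewrite inv_mulV// mulgKV. Qed.

(** Convolution matrices are invariant under right translation, which carries a block on one source
    fibre to a block on another. *)
Lemma mulV_translate a b c : src a = src c -> src b = src c ->
  mul (mul a (inv c)) (inv (mul b (inv c))) = mul a (inv b).
Proof.
move=> ac bc; rewrite inv_mulV// mul_assoc ?src_mulV ?rng_inv//.
by rewrite mulgKV.
Qed.

Lemma mulV_inj a b c : src b = src a -> src c = src a ->
  mul a (inv b) = mul a (inv c) -> b = c.
Proof.
move=> ba ca e; rewrite -(mulV_Vmul (esym ba)) e mulV_Vmul//.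
Qed.

Lemma mulgV_inj a b c : src a = src c -> src b = src c ->
  mul a (inv c) = mul b (inv c) -> a = b.
Proof. by move=> ac bc e; rewrite -(mulgKV ac) e mulgKV. Qed.

End groupoid_algebra.

Section convolution.
Context (R : realType) (G : groupoid).
Local Notation C := (R[i]^o).
Local Notation normc := (@ComplexField.Normc.normc R).
Implicit Types (f xi eta : arr G -> C) (x : obj G) (A F Q : {fset arr G}).

(** The part of [norm2] seen by one fibre, kept separate because convolution acts fibre by fibre. *)
Definition fibre_bound x xi (s : R) := forall A, [set` A] `<=` fibre x ->
  \sum_(g <- A) normc (xi g) ^+ 2 <= s.

Lemma norm2_leP xi (s : R) : (norm2 xi <= s%:E)%E <-> forall x, fibre_bound x xi s.
Proof.
split=> [H x|H].
  apply/esum_leP; apply: le_trans H; apply: ereal_sup_ubound; exact: imageT.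
by apply: ge_ereal_sup => _ [x _ <-]; apply/esum_leP; exact: H.
Qed.

Lemma norm2_ge0 xi (g : arr G) : (0 <= norm2 xi)%E.
Proof.
apply: (@le_trans _ _ (\esum_(h in fibre (src g)) (normc (xi h) ^+ 2)%:E)%E).
  by apply: esum_ge0 => h _; rewrite lee_fin sqr_ge0.
by apply: ereal_sup_ubound; exists (src g).
Qed.

Lemma fibre_bound1 x xi s g : src g = x -> fibre_bound x xi s ->
  normc (xi g) ^+ 2 <= s.
Proof.
move=> gx /(_ [fset g]%fset); rewrite big_seq_fset1; apply.
by move=> h /=; rewrite inE => /eqP ->.
Qed.

(** It makes the sum in [conv] a genuine finite sum; on an infinite support the big operator would
    return its default value 0. *)
Definition row_finite f := forall x, finite_set [set h | rng h = x /\ f h != 0].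

(** The substitution k = h^-1 g replaces the arrows with the range of [g] by its source fibre, where
    convolution becomes the action of a matrix. *)
Lemma conv_mx f xi g Q : [set` Q] `<=` fibre (src g) ->
  (forall h, rng h = rng g -> f h != 0 -> mul (inv h) g \in Q) ->
  conv f xi g = \sum_(k <- Q) f (mul g (inv k)) * xi k.
Proof.
move=> Qg fQ; rewrite /conv.
rewrite (@reindex_fsbig _ _ _ _ _ (fun k => mul g (inv k)) (fibre (src g))).
  rewrite (fsbigE (enum_fset Q)) ?fset_uniq//=.
    rewrite [LHS]big_seq_cond [RHS]big_seq; apply: congr_big => //.
      move=> k; rewrite andb_idr// => kQ; apply/mem_set; exact: Qg.
    by move=> k /andP[kQ _]; rewrite mulV_Vmul//; exact/esym/Qg.
  move=> k kg kQ; apply/eqP; rewrite mulf_eq0; apply/orP; left.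
  apply: contraNT kQ => fk.
  have e : src g = src k by rewrite kg.
  rewrite -(mulV_Vmul e); apply: fQ => //.
  by rewrite rng_mulV.
split.
- by move=> k /= kg; rewrite rng_mulV// kg.
- move=> k l /set_mem/= kg /set_mem/= lg; exact: mulV_inj.
- move=> h /= hg; exists (mul (inv h) g).
    by rewrite /fibre/= src_Vmul.
  by rewrite invMg ?src_inv// invgK mulgVK.
Qed.

(** Finitely many rows meet finitely many columns, so any finite part of [conv f xi] is computed by
    one finite block. *)
Lemma row_finite_fset f x F : row_finite f -> [set` F] `<=` fibre x ->
  exists2 Q : {fset arr G}, [set` Q] `<=` fibre x &
    forall g h, g \in F -> rng h = rng g -> f h != 0 -> mul (inv h) g \in Q.
Proof.
move=> fr Fx.
pose W := \bigcup_(g in [set` F])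
  ((fun h => mul (inv h) g) @` [set h | rng h = rng g /\ f h != 0]).
have Wfin : finite_set W.
  apply: bigcup_finite; first exact: finite_fset.
  by move=> g _; exact: finite_image.
exists (fset_set W).
  move=> k /=; rewrite in_fset_set// => /set_mem[g gF [h [hg _] <-]].
  rewrite /fibre /= src_Vmul//; exact: Fx.
move=> g h gF hg fh; rewrite in_fset_set//; apply/mem_set.
by exists g => //; exists h.
Qed.

(** Squared norm of the regular representation of [f], read on finite blocks so that it makes sense
    before any vector of [l2] is given. *)
Definition conv_bounded (c : R) f := forall x F Q,
  [set` F] `<=` fibre x -> [set` Q] `<=` fibre x ->
  mx_bound (enum_fset F) (enum_fset Q) (fun g k => f (mul g (inv k)) : C) c.

Lemma conv_bounded_fibre c f x xi s : 0 <= c -> row_finite f ->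
  conv_bounded c f -> fibre_bound x xi s -> fibre_bound x (conv f xi) (c * s).
Proof.
move=> c0 fr fc xs F Fx.
have [Q Qx HQ] := row_finite_fset fr Fx.
rewrite (eq_fbigr _ (G := fun g =>
    normc (\sum_(k <- Q) f (mul g (inv k)) * xi k) ^+ 2)).
  apply: le_trans (fc x F Q Fx Qx xi) _.
  by rewrite ler_wpM2l//; exact: xs.
move=> g gF _; rewrite (@conv_mx _ _ _ Q)//.
  by rewrite (Fx _ gF : src g = x).
move=> h; exact: HQ.
Qed.

Lemma conv_bounded_norm2 c f xi s : 0 <= c -> row_finite f ->
  conv_bounded c f -> (norm2 xi <= s%:E -> norm2 (conv f xi) <= (c * s)%:E)%E.
Proof.
move=> c0 fr fc /norm2_leP xs; apply/norm2_leP => x.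
exact: conv_bounded_fibre.
Qed.

Lemma row_finiteB f f' : row_finite f -> row_finite f' -> row_finite (f - f').
Proof.
move=> fr fr' x; apply: (@sub_finite_set _ _
  ([set h | rng h = x /\ f h != 0] `|` [set h | rng h = x /\ f' h != 0])).
  move=> h [hx]; have [fh|fh] := eqVneq (f h) 0; last by left.
  have [fh'|fh'] := eqVneq (f' h) 0; last by right.
  by rewrite !fctE fh fh' subrr eqxx.
by rewrite finite_setU.
Qed.

Lemma row_finite2_fset f f' g : row_finite f -> row_finite f' ->
  exists2 Q : {fset arr G}, [set` Q] `<=` fibre (src g) &
    (forall h, rng h = rng g -> f h != 0 -> mul (inv h) g \in Q) /\
    (forall h, rng h = rng g -> f' h != 0 -> mul (inv h) g \in Q).
Proof.
move=> fr fr'; have g1 : [set` [fset g]%fset] `<=` fibre (src g).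
  by move=> h /=; rewrite inE => /eqP ->.
have [Q Qg HQ] := row_finite_fset fr g1.
have [Q' Qg' HQ'] := row_finite_fset fr' g1.
exists (Q `|` Q')%fset; first by move=> h /=; rewrite inE => /orP[/Qg|/Qg'].
split=> h hg fh; rewrite inE; first by rewrite HQ// inE.
by rewrite HQ' ?orbT// inE.
Qed.

Lemma convBr f xi eta : row_finite f ->
  conv f (xi - eta) = conv f xi - conv f eta.
Proof.
move=> fr; apply/funext => g; have [Q Qg [HQ _]] := row_finite2_fset g fr fr.
change (conv f (xi - eta) g = conv f xi g - conv f eta g).
rewrite !(@conv_mx _ _ _ Q)// -sumrB.
by apply: eq_bigr => k _; rewrite !fctE mulrBr.
Qed.

Lemma convBl f f' xi : row_finite f -> row_finite f' ->
  conv (f - f') xi = conv f xi - conv f' xi.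
Proof.
move=> fr fr'; apply/funext => g.
have [Q Qg [H H']] := row_finite2_fset g fr fr'.
have HB h : rng h = rng g -> (f - f') h != 0 -> mul (inv h) g \in Q.
  move=> hg; have [fh|fh] := eqVneq (f h) 0; last by move=> _; exact: H.
  have [fh'|fh'] := eqVneq (f' h) 0; last by move=> _; exact: H'.
  by rewrite !fctE fh fh' subrr eqxx.
change (conv (f - f') xi g = conv f xi g - conv f' xi g).
rewrite !(@conv_mx _ _ _ Q)// -sumrB.
by apply: eq_bigr => k _; rewrite !fctE mulrBl.
Qed.

(** The involution of the convolution algebra: its matrix is the conjugate transpose of that of
    [f]. *)
Definition fadj f : arr G -> C := fun g => (f (inv g))^*%C.

Lemma conv_bounded_fadj c f : 0 <= c -> conv_bounded c f ->
  conv_bounded c (fadj f).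
Proof.
move=> c0 fc x F Q Fx Qx v.
have := mx_bound_adjoint c0 (fc x Q F Qx Fx) v.
rewrite (eq_fbigr _ (G := fun g =>
  normc (\sum_(k <- Q) (fadj f) (mul g (inv k)) * v k) ^+ 2))// => g gF _.
congr (normc _ ^+ 2); apply: eq_fbigr => k kQ _; congr (_ * _).
rewrite /fadj inv_mulV//.
by rewrite (Fx _ gF : src g = x) (Qx _ kQ : src k = x).
Qed.

End convolution.

(** * Etale groupoids *)

(** Objects of a [groupoid] carry no topology, so openness of the range map ([et_open]) and
    separation of its values ([et_sep]) are expressed through arrows having the given ranges.
    [et_bump] plays the part of Urysohn's lemma in a locally compact space. *)
Record etale (R : realType) (G : groupoid) : Prop := Etale {
  et_hausdorff : hausdorff_space (arr G) ;
  et_inv : continuous (fun a : arr G => inv a) ;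
  et_mul : forall a b : arr G, src a = rng b -> forall V, nbhs (mul a b) V ->
    \forall w \near (a, b), src w.1 = rng w.2 -> V (mul w.1 w.2) ;
  et_open : forall (a : arr G) V, nbhs a V -> forall b, rng b = rng a ->
    \forall b' \near b, exists2 a', V a' & rng a' = rng b' ;
  et_sep : forall a b : arr G, rng a <> rng b ->
    \forall w \near (a, b), rng w.1 <> rng w.2 ;
  et_inj : forall a : arr G, exists2 V, nbhs a V &
    forall b c, V b -> V c -> rng b = rng c -> b = c ;
  et_bump : forall (a : arr G) V, nbhs a V -> exists chi : arr G -> R[i]^o,
    [/\ Cc chi, chi a = 1, forall b, chi b != 0 -> V b &
      forall b, ComplexField.Normc.normc (chi b) <= 1]
}.

Section single_term_sums.

Lemma at_most_one (I : eqType) (r : seq I) (P : pred I) :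
  {in r &, forall i j, P i -> P j -> i = j} ->
  {in r, forall i, ~~ P i} \/
  exists2 i, i \in r & {in r, forall j, j != i -> ~~ P j}.
Proof.
move=> P1; have [/hasP[i ir Pi]|/hasPn] := boolP (has P r); last by left.
right; exists i => // j jr; apply: contraNN => Pj.
by rewrite (P1 j i).
Qed.

Lemma sum_single (V : nmodType) (I : eqType) (r : seq I) (F : I -> V) i :
  uniq r -> i \in r -> {in r, forall j, j != i -> F j = 0} ->
  \sum_(j <- r) F j = F i.
Proof.
move=> ru ir F0; rewrite (bigD1_seq i)//= big_seq_cond big1 ?addr0//.
by move=> j /andP[jr]; exact: F0.
Qed.

Lemma sum_at_most_one_le (R : numDomainType) (I : eqType) (r : seq I)
    (F : I -> R) (c : R) : uniq r -> 0 <= c -> {in r, forall i, F i <= c} ->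
  {in r &, forall i j, F i != 0 -> F j != 0 -> i = j} -> \sum_(i <- r) F i <= c.
Proof.
move=> ru c0 Fc /at_most_one[F0|[i ir F0]].
  by rewrite big_seq big1// => i /F0; rewrite negbK => /eqP.
rewrite (sum_single ru ir) ?Fc// => j jr ji.
by apply/eqP; rewrite -[_ == _]negbK F0.
Qed.

End single_term_sums.

Lemma sum_imfset (V : nmodType) (T U : choiceType) (h : T -> U) (F : U -> V)
    (A : {fset T}) : {in A &, injective h} ->
  \sum_(j <- [fset h x | x in A]%fset) F j = \sum_(i <- A) F (h i).
Proof. by move=> hA; rewrite big_imfset. Qed.

Section etale_theory.
Context (R : realType) (G : groupoid) (Get : etale R G).
Local Notation C := (R[i]^o).
Local Notation normc := (@ComplexField.Normc.normc R).
Implicit Types (f xi eta : arr G -> C) (x : obj G) (A F Q : {fset arr G}).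

Lemma et_inj_src (a : arr G) : exists2 V, nbhs a V &
  forall b c, V b -> V c -> src b = src c -> b = c.
Proof.
have [V aV HV] := et_inj Get (inv a).
exists ((fun b => inv b) @^-1` V); first exact: (et_inv Get).
move=> b c bV cV bc; rewrite -(invgK b) -(invgK c); congr inv.
by apply: HV => //; rewrite !rng_inv.
Qed.

Lemma et_sep_src_rng (a b : arr G) : src a <> rng b ->
  \forall w \near (a, b), src w.1 <> rng w.2.
Proof.
rewrite -rng_inv => /(et_sep Get)[[U V]/= [aU bV] UV].
exists ((fun b => inv b) @^-1` U, V) => /=.
  by split=> //; exact: (et_inv Get).
by move=> [c d] /= [cU dV]; rewrite -rng_inv; exact: (UV (inv c, d)).
Qed.

Definition csupp f := closure [set g | f g != 0].

Lemma csuppP f g : f g != 0 -> csupp f g.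
Proof. by move=> fg; exact: subset_closure. Qed.

(** A neighbourhood on which [rng] is injective meets a range fibre at most once, and finitely many
    of them cover the support. *)
Lemma Cc_row_finite f : Cc f -> row_finite f.
Proof.
move=> [_ fK] x; apply: (@sub_finite_set _ _ (csupp f `&` [set h | rng h = x])).
  by move=> h [hx /csuppP].
apply: (@compact_ind _ (fun W => finite_set (W `&` [set h | rng h = x]))) fK _.
- by rewrite set0I.
- by move=> A B Af Bf; rewrite setIUl finite_setU.
- by move=> A B AB; apply: sub_finite_set; exact: setSI.
move=> a _; have [V aV HV] := et_inj Get a; exists V => //.
have [[b [bV bx]]|nb] := pselect (exists b, V b /\ rng b = x).
  apply: (@sub_finite_set _ _ [set b]) => // c [cV cx].
  by apply: HV => //; rewrite cx.
apply: (@sub_finite_set _ _ set0) => // c [cV cx].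
by apply: nb; exists c.
Qed.

(** The bound is uniform in [x]: each of finitely many neighbourhoods covering the support
    contributes at most one term, of modulus at most 1 + |f a| near [a]. *)
Lemma Cc_rng_sum f : Cc f -> exists2 r : R, 0 <= r &
  forall x A, (forall g, g \in A -> rng g = x) -> \sum_(g <- A) normc (f g) <= r.
Proof.
move=> [fc fK].
suff [r r0 H] : exists2 r : R, 0 <= r & forall x A,
    (forall g, g \in A -> rng g = x) -> [set` A] `<=` csupp f ->
    \sum_(g <- A) normc (f g) <= r.
  exists r => // x A Ax.
  rewrite (big_fsetID _ (fun g => f g != 0)) /= [X in _ + X]big1_fset ?addr0.
    apply: (H x) => g /= /[!inE] /andP[gA]; first by move=> _; exact: Ax.
    exact: csuppP.
  by move=> g /[!inE] /andP[_]; rewrite negbK => /eqP ->; rewrite normc0.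
apply: (@compact_ind _ (fun W => exists2 r : R, 0 <= r & forall x A,
    (forall g, g \in A -> rng g = x) -> [set` A] `<=` W ->
    \sum_(g <- A) normc (f g) <= r) _ _ _ _ fK).
- exists 0 => // x A _ A0; rewrite big_seq big1// => g gA.
  by have := A0 g gA.
- move=> V W [r r0 Hr] [s s0 Hs]; exists (r + s); first exact: addr_ge0.
  move=> x A Ax AVW; rewrite (big_fsetID _ (fun g => `[< V g >])) /=.
  apply: lerD; [apply: (Hr x)|apply: (Hs x)] => g /= /[!inE] /andP[gA].
  + by move=> _; exact: Ax.
  + by move=> /asboolP.
  + by move=> _; exact: Ax.
  + by move=> /asboolPn nV; case: (AVW g gA).
- move=> V W VW [r r0 Hr]; exists r => // x A Ax AV.
  by apply: (Hr x) => //; exact: subset_trans VW.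
move=> a _; have [V aV HV] := et_inj Get a.
pose U := f @^-1` [set z | normc (z - f a) <= 1].
have aU : nbhs a U.
  apply: fc; apply/nbhs_ballP; exists 1 => //= z; rewrite /ball /= => zf.
  have : (normc (z - f a))%:C%C < 1 :> R[i].
    by move: zf; rewrite distrC; case: (z - f a).
  by rewrite -[1%R]/((1 : R)%:C)%C ltcR => /ltW.
have r0 : 0 <= 1 + normc (f a) by rewrite addr_ge0// normc_ge0.
exists (V `&` U); first exact: filterI.
exists (1 + normc (f a)) => // x A Ax AV.
apply: sum_at_most_one_le => // g.
  move=> gA; have [_ gU] := AV g gA.
  rewrite -[f g](subrK (f a)); apply: le_trans (normcD _ _) _.
  by rewrite lerD2r.
move=> h gA hA _ _; have [gV _] := AV g gA; have [hV _] := AV h hA.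
by apply: HV => //; rewrite (Ax g)// (Ax h).
Qed.

Lemma Cc_comp_inv f : Cc f -> Cc (f \o (fun g => inv g)).
Proof.
move=> [fc fK]; split.
  by move=> x; apply: continuous_comp; [exact: (et_inv Get)|exact: fc].
have invK' : compact ((fun g => inv g) @` csupp f).
  apply: continuous_compact => //; apply: continuous_subspaceT.
  exact: (et_inv Get).
apply: (subclosed_compact _ invK'); first exact: closed_closure.
rewrite [X in _ `<=` X](closure_id _).1; last first.
  exact: (compact_closed (et_hausdorff Get)).
apply: closureS => g /= fg; exists (inv g); last exact: invgK.
exact: csuppP.
Qed.

Lemma Cc_fadj f : Cc f -> Cc (fadj f).
Proof.
move=> /Cc_comp_inv[fc fK]; split; last first.
  congr (compact (closure _)) : fK; apply/funext => g /=.
  by rewrite /fadj conjc_eq0.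
move=> x; apply: (@continuous_comp _ _ _ (fun g => f (inv g)) (fun z : C => z^*%C : C)).
  exact: fc.
move=> V /nbhs_ballP[e /= e0 eV]; apply/nbhs_ballP; exists e => //= z ze.
apply: eV; move: ze; rewrite /ball /= -rmorphB.
suff -> : `|(f (inv x) - z)^*%C| = `|f (inv x) - z| by [].
exact: complex.normcJ.
Qed.

Lemma Cc_src_sum f : Cc f -> exists2 r : R, 0 <= r &
  forall x A, [set` A] `<=` fibre x -> \sum_(g <- A) normc (f g) <= r.
Proof.
move=> /Cc_comp_inv /Cc_rng_sum[r r0 Hr]; exists r => // x A Ax.
have inv_inj : {in A &, injective (fun g : arr G => inv g)}.
  by move=> g h _ _ e; rewrite -(invgK g) e invgK.
rewrite (eq_bigr (fun g => normc ((f \o (fun g => inv g)) (inv g)))); last first.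
  by move=> g _ /=; rewrite invgK.
rewrite -(sum_imfset (fun h => normc ((f \o (fun g => inv g)) h)) inv_inj).
apply: (Hr x) => h /imfsetP[g /= gA ->]; rewrite rng_inv; exact: Ax.
Qed.

(** Schur test: the row of [g] lists values of [f] on arrows with range [rng g], the column of [k]
    values on arrows with source [rng k], and both kinds of sums are uniformly bounded. *)
Lemma Cc_conv_bounded f : Cc f -> exists2 c : R, 0 <= c & conv_bounded c f.
Proof.
move=> fCc; have [r r0 Hr] := Cc_rng_sum fCc; have [s s0 Hs] := Cc_src_sum fCc.
exists ((r + s) ^+ 2); first exact: sqr_ge0.
move=> x F Q Fx Qx; apply: mx_bound_schur => [g gF|k kQ].
  have gx : src g = x by exact: Fx.
  have inj : {in Q &, injective (fun k => mul g (inv k))}.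
    by move=> k l kQ lQ; apply: mulV_inj; rewrite gx; exact: Qx.
  rewrite -(sum_imfset (fun h => normc (f h)) inj) /=.
  apply: (@le_trans _ _ r); last by rewrite lerDl.
  apply: (Hr (rng g)) => h /imfsetP[k /= kQ ->].
  by rewrite rng_mulV// gx; exact/esym/Qx.
have kx : src k = x by exact: Qx.
have inj : {in F &, injective (fun g => mul g (inv k))}.
  by move=> g h gF hF; apply: mulgV_inj; rewrite kx; exact: Fx.
rewrite -(sum_imfset (fun h => normc (f h)) inj) /=.
apply: (@le_trans _ _ s); last by rewrite lerDr.
apply: (Hs (rng k)) => h /imfsetP[g /= gF ->].
by rewrite /fibre/= src_mulV// kx; exact: Fx.
Qed.

Lemma Cc_norm2 f : Cc f -> exists2 s : R, 0 <= s & (norm2 f <= s%:E)%E.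
Proof.
move=> /Cc_src_sum[r r0 Hr]; exists (r * r); first exact: mulr_ge0.
apply/norm2_leP => x A Ax; apply: (@le_trans _ _ (r * \sum_(g <- A) normc (f g))).
  rewrite mulr_sumr big_seq [leRHS]big_seq; apply: ler_sum => g gA.
  rewrite expr2 ler_wpM2r ?normc_ge0//.
  have := Hr (src g) [fset g]%fset; rewrite big_seq_fset1; apply.
  by move=> h /=; rewrite inE => /eqP ->.
by rewrite ler_wpM2l//; apply: (Hr x).
Qed.

End etale_theory.

(** One set [W (k, l)] is chosen per ordered pair, a neighbourhood of k whose complement is a
    neighbourhood of l; disjointness is then automatic. *)
Lemma hausdorff_separate (T : topologicalType) (Q : {fset T}) :
  hausdorff_space T -> exists V : T -> set T,
    {in Q, forall k, nbhs k (V k)} /\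
    {in Q &, forall k l g, V k g -> V l g -> k = l}.
Proof.
rewrite open_hausdorff => hT.
have /choice[W HW] (kl : T * T) : exists W : set T,
    kl.1 <> kl.2 -> nbhs kl.1 W /\ nbhs kl.2 (~` W).
  have [->|/eqP kl12] := eqVneq kl.1 kl.2; first by exists set0.
  have [|[A B] /= [/set_mem kA /set_mem lB] [oA oB /eqP AB]] := hT kl.1 kl.2.
    exact/eqP.
  exists A => _; split; first exact: open_nbhs_nbhs.
  apply: filterS (open_nbhs_nbhs (conj oB lB)) => g Bg Ag.
  by have : (A `&` B) g by []; rewrite AB.
exists (fun k => \bigcap_(l in [set` (Q `\ k)%fset]) (W (k, l) `&` ~` W (l, k))).
split=> [k kQ|k l kQ lQ g Vk Vl].
  apply: filter_bigI => l; rewrite !inE => /andP[/eqP lk _].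
  have kl : k <> l by move=> e; apply: lk.
  by apply: filterI; [exact: (HW (k, l) kl).1|exact: (HW (l, k) lk).2].
apply/eqP/negPn/negP => kl.
have /Vk[+ _] : [set` (Q `\ k)%fset] l by rewrite /= !inE eq_sym kl.
by have /Vl[_] : [set` (Q `\ l)%fset] k by rewrite /= !inE kl.
Qed.

(** * Interpolation on a fibre and kernels of gradings *)

Section etale_convolution.
Context (R : realType) (G : groupoid) (Get : etale R G).
Local Notation C := (R[i]^o).
Local Notation normc := (@ComplexField.Normc.normc R).
Implicit Types (f xi eta : arr G -> C) (x : obj G) (A F Q : {fset arr G}).

(** Bumps around the points of [Q] are supported in disjoint sets on each of which [src] is
    injective. A source fibre therefore meets each bump at most once, so on every fibre the squared
    norm is at most that of the prescribed vector. *)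
Lemma Cc_interpolate (y : obj G) Q (v : arr G -> C) (U : set (arr G)) :
  [set` Q] `<=` fibre y -> {in Q, forall k, nbhs k U} ->
  exists xi, [/\ Cc xi, {in Q, xi =1 v},
    forall k, src k = y -> k \notin Q -> xi k = 0,
    forall g, xi g != 0 -> U g &
    (norm2 xi <= (\sum_(k <- Q) normc (v k) ^+ 2)%:E)%E].
Proof.
move=> Qy QU.
have [V0 [V0n V0d]] := hausdorff_separate Q (et_hausdorff Get).
have /choice[I HI] (k : arr G) : exists I : set (arr G), nbhs k I /\
    forall b c, I b -> I c -> src b = src c -> b = c.
  by have [I kI HI] := et_inj_src Get k; exists I.
pose V k := U `&` I k `&` V0 k.
have nV k : k \in Q -> nbhs k (V k).
  move=> kQ; apply: filterI; last exact: V0n.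
  by apply: filterI; [exact: QU|exact: (HI k).1].
have V1 k l g : k \in Q -> l \in Q -> V k g -> V l g -> k = l.
  by move=> kQ lQ [_ Vk] [_ Vl]; exact: V0d Vk Vl.
have /choice[chi Hchi] (k : arr G) : exists chi : arr G -> C, k \in Q ->
    [/\ Cc chi, chi k = 1, forall b, chi b != 0 -> V k b &
      forall b, normc (chi b) <= 1].
  have [kQ|kQ] := boolP (k \in Q); last by exists 0.
  by have [chi H] := et_bump Get (nV k kQ); exists chi.
pose xi (g : arr G) : C := \sum_(k <- Q) v k * chi k g.
have chiV k g : k \in Q -> chi k g != 0 -> V k g.
  by move=> kQ; have [_ _ H _] := Hchi k kQ; exact: H.
have xi1 k g : k \in Q -> V k g -> xi g = v k * chi k g.
  move=> kQ kg; apply: sum_single; rewrite ?fset_uniq// => l lQ lk.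
  have [->|/(chiV _ _ lQ) lg] := eqVneq (chi l g) 0; first exact: mulr0.
  by rewrite (V1 l k g)// eqxx in lk.
have xi0 g : xi g != 0 -> exists2 k, k \in Q & V k g.
  move=> xig; apply: contrapT => nk; move/eqP: xig; apply.
  rewrite /xi big_seq big1// => k kQ.
  have [->|/(chiV _ _ kQ) kg] := eqVneq (chi k g) 0; first exact: mulr0.
  by case: nk; exists k.
exists xi; split.
- have : {in enum_fset Q, forall k, Cc (chi k)} by move=> k /Hchi[].
  rewrite /xi; elim: (enum_fset Q) => [|k r IH] Hr.
    have -> : (fun g => \sum_(k <- [::]) v k * chi k g) = 0 :> (arr G -> C).
      by apply/funext => g; rewrite big_nil.
    exact: Cc0.
  have -> : (fun g => \sum_(l <- k :: r) v l * chi l g) =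
      v k *: chi k + (fun g => \sum_(l <- r) v l * chi l g) :> (arr G -> C).
    by apply/funext => g; rewrite big_cons.
  apply: Cc_lin; first by apply: Hr; rewrite mem_head.
  by apply: IH => l lr; apply: Hr; rewrite inE lr orbT.
- move=> k kQ; have kk := nbhs_singleton (nV k kQ).
  rewrite (xi1 k k kQ kk); by have [_ -> _ _] := Hchi k kQ; rewrite mulr1.
- move=> k ky kQ; apply/eqP/negPn/negP => /xi0[l lQ [[_ lk] _]].
  move: kQ; rewrite ((HI l).2 k l)// ?lQ//.
    by have [[_ ?] _] := nbhs_singleton (nV l lQ).
  by rewrite ky; exact/esym/Qy.
- by move=> g /xi0[k _ [[]]].
apply/norm2_leP => x A Ax.
apply: (@le_trans _ _ (\sum_(g <- A) \sum_(k <- Q)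
    normc (v k) ^+ 2 * normc (chi k g) ^+ 2)).
  apply: ler_sum => g _.
  have [->|/xi0[k kQ kg]] := eqVneq (xi g) 0.
    rewrite normc0 expr0n; apply: sumr_ge0 => k _.
    by rewrite mulr_ge0 ?sqr_ge0.
  rewrite (xi1 k)// normcM exprMn [leRHS](bigD1_seq k)//=.
  by rewrite lerDl sumr_ge0// => l _; rewrite mulr_ge0 ?sqr_ge0.
rewrite exchange_big /= big_seq [leRHS]big_seq; apply: ler_sum => k kQ.
rewrite -mulr_sumr -[leRHS]mulr1 ler_wpM2l ?sqr_ge0//.
have [_ _ _ chi1] := Hchi k kQ.
apply: sum_at_most_one_le.
- exact: fset_uniq.
- exact: ler01.
- by move=> g _; rewrite expr_le1// normc_ge0.
have nz z : normc z ^+ 2 != 0 -> z != 0.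
  by apply: contraNneq => ->; rewrite normc0 expr0n.
move=> g h gA hA.
move=> /nz/(chiV _ _ kQ)[[_ gI] _] /nz/(chiV _ _ kQ)[[_ hI] _].
by apply: (HI k).2 => //; rewrite (Ax _ gA : src g = x); exact/esym/Ax.
Qed.

Section graded.
Variable deg : arr G -> int.
Hypothesis degM : forall a b, src a = rng b -> deg (mul a b) = deg a + deg b.
Hypothesis deg_near : forall a, \forall b \near a, deg b = deg a.

Lemma deg_mulV a b : src a = src b -> deg (mul a (inv b)) = deg a - deg b.
Proof.
by move=> ab; apply/eqP; rewrite eq_sym subr_eq -degM ?src_mulV// mulgKV.
Qed.

(* The source fibre at [x] is the disjoint union over degrees of orbits of the
   kernel of [deg], and right translation by a member of an orbit identifies it
   with a source fibre of the kernel. *)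
Lemma conv_bounded_kernel c f : 0 <= c -> row_finite f ->
  (forall h, f h != 0 -> deg h = 0) ->
  (forall xi, Cc xi -> (forall g, xi g != 0 -> deg g = 0) ->
   forall y F s, (norm2 xi <= s%:E)%E -> [set` F] `<=` fibre y ->
   {in F, forall g, deg g = 0} ->
   \sum_(g <- F) normc (conv f xi g) ^+ 2 <= c * s) ->
  conv_bounded c f.
Proof.
move=> c0 fr f0 H x F Q Fx Qx v.
(* As [f] lives in degree 0, an entry vanishes unless row and column have the same degree; the
   matrix is bounded one degree at a time. *)
have key d : \sum_(g <- F | deg g == d)
      normc (\sum_(k <- Q) f (mul g (inv k)) * v k) ^+ 2 <=
    c * \sum_(k <- Q | deg k == d) normc (v k) ^+ 2.
  have [[g0 [g0F /eqP g0d]]|nF] := pselect (exists g0, g0 \in F /\ deg g0 == d);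
    last first.
    rewrite big_seq_cond big_pred0 ?mulr_ge0 ?sumr_ge0// => [k _|g].
      exact: sqr_ge0.
    by apply/negP => /andP[gF gd]; apply: nF; exists g.
  have g0x : src g0 = x by exact: Fx.
  pose Fd := [fset g in F | deg g == d]%fset.
  pose Qd := [fset k in Q | deg k == d]%fset.
  rewrite big_fset_condE [X in c * X]big_fset_condE -/Fd -/Qd.
  have FdF g : g \in Fd -> g \in F /\ deg g = d.
    by rewrite !inE => /andP[-> /eqP].
  have QdQ k : k \in Qd -> k \in Q /\ deg k = d.
    by rewrite !inE => /andP[-> /eqP].
  pose tr k := mul k (inv g0).
  have Fds : {in Fd, forall g, src g = src g0}.
    by move=> g /FdF[gF _]; rewrite g0x; exact: Fx.
  have Qds : {in Qd, forall g, src g = src g0}.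
    by move=> g /QdQ[gF _]; rewrite g0x; exact: Qx.
  have Finj : {in Fd &, injective tr}.
    by move=> g h gF hF; apply: mulgV_inj; exact: Fds.
  have Qinj : {in Qd &, injective tr}.
    by move=> g h gF hF; apply: mulgV_inj; exact: Qds.
  (* Translation by [g0] moves degree [d] on the fibre over [x] to degree 0 on the fibre over
     [rng g0]. *)
  pose F' := [fset tr g | g in Fd]%fset; pose Q' := [fset tr g | g in Qd]%fset.
  have F'y : [set` F'] `<=` fibre (rng g0).
    by move=> _ /imfsetP[g /= gF ->]; rewrite /fibre /= src_mulV ?Fds.
  have Q'y : [set` Q'] `<=` fibre (rng g0).
    by move=> _ /imfsetP[g /= gF ->]; rewrite /fibre /= src_mulV ?Qds.
  have F'0 : {in F', forall g, deg g = 0}.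
    move=> _ /imfsetP[g /= gF ->]; rewrite deg_mulV ?Fds// g0d.
    by have [_ ->] := FdF g gF; rewrite subrr.
  have Q'0 : {in Q', forall k, nbhs k [set h | deg h = 0]}.
    move=> _ /imfsetP[g /= gF ->].
    have <- : deg (tr g) = 0.
      by rewrite deg_mulV ?Qds// g0d; have [_ ->] := QdQ g gF; rewrite subrr.
    exact: deg_near.
  have [xi [xiC xiv xi0 xiU xin]] :=
    Cc_interpolate (fun h => v (mul h g0)) Q'y Q'0.
  have := H xi xiC xiU (rng g0) F' _ xin F'y F'0.
  rewrite !sum_imfset// [X in _ <= c * X -> _](_ : _ =
      \sum_(k <- Qd) normc (v k) ^+ 2); last first.
    by apply: eq_fbigr => k kQ _; rewrite mulgKV ?Qds.
  apply: le_trans; rewrite le_eqVlt; apply/orP; left; apply/eqP.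
  apply: eq_fbigr => g gF _; congr (normc _ ^+ 2).
  have trg : [set` [fset tr g]%fset] `<=` fibre (rng g0).
    by move=> h /=; rewrite inE => /eqP ->; rewrite /fibre /= src_mulV ?Fds.
  have [Q2 Q2y HQ2] := row_finite_fset fr trg.
  (* [Q2] holds the columns that [f] reaches, [Q'] those where [xi] is prescribed. On this fibre
     [xi] vanishes off [Q'], so only [Q'] contributes. *)
  rewrite (@conv_mx _ _ _ _ _ (Q2 `|` Q')%fset); first last.
  - by move=> h hr fh; rewrite inE (HQ2 (tr g))// inE.
  - rewrite src_mulV ?Fds// => h /=; rewrite inE => /orP[/Q2y//|/Q'y//].
  rewrite -(big_fset_incl _ (fsubsetUr Q2 Q')); last first.
    move=> h hQ hQ'; rewrite (xi0 h) ?mulr0//.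
    by move: hQ; rewrite inE (negPf hQ') orbF => /Q2y.
  rewrite sum_imfset//.
  rewrite -(big_fset_incl _ (_ : Qd `<=` Q)%fset); first last.
  - move=> k kQ kQd; have gk : src g = src k.
      by rewrite Fds// g0x; exact/esym/Qx.
    have [->|/f0] := eqVneq (f (mul g (inv k))) 0; first exact: mul0r.
    rewrite deg_mulV// => /eqP; rewrite subr_eq0 => /eqP gdk.
    by move: kQd; rewrite !inE kQ -gdk; have [_ ->] := FdF g gF; rewrite eqxx.
  - by apply/fsubsetP => k /QdQ[].
  apply: eq_fbigr => k kQ _; rewrite mulV_translate; last 2 first.
  - exact: Fds.
  - exact: Qds.
  rewrite xiv ?mulgKV ?Qds//; exact: in_imfset.
rewrite (partition_big_imfset _ deg).
apply: le_trans (ler_sum _ (fun d _ => key d)) _.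
rewrite -mulr_sumr ler_wpM2l//.
(* The outer sum runs over the degrees present in [F], so each column is counted at most once. *)
rewrite (exchange_big_dep xpredT) //=; apply: ler_sum => k _.
rewrite -big_filter; set D := [fset _ | _ in _]%fset.
have [kD|kD] := boolP (deg k \in D).
  rewrite (eq_filter (a2 := pred1 (deg k))); last by move=> d; rewrite /= eq_sym.
  by rewrite filter_pred1_uniq ?fset_uniq// big_seq1.
rewrite big_filter big_seq_cond big_pred0 ?sqr_ge0// => d.
by apply: contraNF kD => /andP[dD /eqP ->].
Qed.

End graded.

End etale_convolution.

(** * Convolution of compactly supported continuous functions *)

Section convolution_continuity.
Context (R : realType) (G : groupoid) (Get : etale R G).
Local Notation C := (R[i]^o).
Local Notation normc := (@ComplexField.Normc.normc R).
Implicit Types (f xi eta : arr G -> C).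

Lemma conv_neq0 f xi g : conv f xi g != 0 ->
  exists h, [/\ rng h = rng g, f h != 0 & xi (mul (inv h) g) != 0].
Proof.
move=> fg; apply: contrapT => nh; move/eqP: fg; apply.
apply: fsbig1 => h hg.
have [->|fh] := eqVneq (f h) 0; first exact: mul0r.
have [->|xh] := eqVneq (xi (mul (inv h) g)) 0; first exact: mulr0.
by case: nh; exists h.
Qed.

(** The support lies in the image under [mul] of the composable pairs in the product of the
    supports, and composability is a closed condition. *)
Lemma conv_compact f xi : Cc f -> Cc xi ->
  compact (closure [set g | conv f xi g != 0]).
Proof.
move=> [_ fK] [_ xK].
pose D := [set w : arr G * arr G | src w.1 = rng w.2].
have cD : closed D.
  rewrite -openC openE => -[a b] /= ab; exact: (et_sep_src_rng Get ab).
have cE : compact ((csupp f `*` csupp xi) `&` D).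
  by apply: compact_closedI => //; exact: compact_setX.
have cM : compact ((fun w => mul w.1 w.2) @` ((csupp f `*` csupp xi) `&` D)).
  apply: continuous_compact => //; apply/subspace_continuousP.
  move=> [a b] [_ /= ab] V /(et_mul Get ab) mV.
  by apply: filterS mV => w Hw [_ /Hw].
apply: (subclosed_compact _ cM); first exact: closed_closure.
rewrite [X in _ `<=` X](closure_id _).1; last first.
  exact: (compact_closed (et_hausdorff Get)).
apply: closureS => g /= /conv_neq0[h [hg fh xh]].
exists (h, mul (inv h) g); last exact: mulgVK.
split; last by rewrite /D /= rng_Vmul.
by split; exact: csuppP.
Qed.

(* Near [g0] the arrows of the support of [f] with the same range as [g] are
   the values at [g] of finitely many local sections of [rng]. *)
Lemma local_sections f (g0 : arr G) : Cc f ->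
  exists (hs : {fset arr G}) (s : arr G -> arr G -> arr G),
  [/\ {in hs, forall h, s h g0 = h}, {in hs, forall h, s h @ g0 --> h},
      {in hs, forall h, \forall g \near g0, rng (s h g) = rng g},
      \forall g \near g0, {in hs &, injective (s ^~ g)} &
      \forall g \near g0, forall h, rng h = rng g -> f h != 0 ->
        exists2 k, k \in hs & h = s k g].
Proof.
move=> fCc; have [_ fK] := fCc.
have hfin : finite_set (csupp f `&` [set h | rng h = rng g0]).
  apply: (@compact_ind _ (fun W => finite_set (W `&` [set h | rng h = rng g0])))
      fK _.
  - by rewrite set0I.
  - by move=> A B Af Bf; rewrite setIUl finite_setU.
  - by move=> A B AB; apply: sub_finite_set; exact: setSI.
  move=> a _; have [V aV HV] := et_inj Get a; exists V => //.
  have [[b [bV bx]]|nb] := pselect (exists b, V b /\ rng b = rng g0).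
    apply: (@sub_finite_set _ _ [set b]) => // c [cV cx].
    by apply: HV => //; rewrite cx.
  apply: (@sub_finite_set _ _ set0) => // c [cV cx].
  by apply: nb; exists c.
pose hs := fset_set (csupp f `&` [set h | rng h = rng g0]).
have hsP h : h \in hs -> csupp f h /\ rng h = rng g0.
  by rewrite in_fset_set// => /set_mem.
have [V0 [V0n V0d]] := hausdorff_separate hs (et_hausdorff Get).
have /choice[I HI] (k : arr G) : exists I : set (arr G), nbhs k I /\
    forall b c, I b -> I c -> rng b = rng c -> b = c.
  by have [I kI HI] := et_inj Get k; exists I.
pose V k := I k `&` V0 k.
have nV k : k \in hs -> nbhs k (V k).
  by move=> kQ; apply: filterI; [exact: (HI k).1|exact: V0n].
have VI k b c : V k b -> V k c -> rng b = rng c -> b = c.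
  by move=> [bI _] [cI _]; exact: (HI k).2.
(* The section through h sends g to the arrow of [V h] over [rng g], unique by injectivity; where
   none exists the value h is junk. *)
have /choice[s0 Hs0] (hg : arr G * arr G) : exists a,
    (exists2 b, V hg.1 b & rng b = rng hg.2) -> V hg.1 a /\ rng a = rng hg.2.
  have [[b bV bg]|nb] := pselect (exists2 b, V hg.1 b & rng b = rng hg.2).
    by exists b.
  by exists hg.1 => /nb.
pose s h g := s0 (h, g).
have near_s h W : h \in hs -> nbhs h W ->
    \forall g \near g0, [/\ V h (s h g), rng (s h g) = rng g & W (s h g)].
  move=> hhs hW.
  have hg0 : rng g0 = rng h by have [_ ->] := hsP h hhs.
  have hVW : nbhs h (V h `&` W) by apply: filterI => //; exact: nV.
  have := et_open Get hVW hg0.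
  apply: filterS => g [a [aV aW] ag].
  have [sV sg] := Hs0 (h, g) (ex_intro2 _ _ a aV ag).
  by rewrite /s; split=> //; rewrite (VI h _ a sV aV)// sg ag.
exists hs, s; split.
- move=> h hhs; have hV := nV h hhs.
  have [sV sg _] := nbhs_singleton (near_s h _ hhs hV).
  apply: (VI h) => //; first exact: nbhs_singleton hV.
  by rewrite sg; have [_ ->] := hsP h hhs.
- by move=> h hhs W /(near_s h _ hhs); apply: filterS => g [].
- by move=> h hhs; apply: filterS (near_s h _ hhs (nV h hhs)) => g [].
- have : \forall g \near g0, [set` hs] `<=` [set h | V h (s h g)].
    apply: filterS (@filter_bigI _ _ hs (fun h => [set g | V h (s h g)])
      (nbhs g0) _ _); first by move=> g Hg h; exact: Hg.
    by move=> h hhs; apply: filterS (near_s h _ hhs (nV h hhs)) => g [].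
  apply: filterS => g Hg h k hhs khs e.
  have [_ hV] := Hg h hhs; have [_ kV] := Hg k khs.
  by apply: (V0d h k hhs khs (s h g)) => //; rewrite e.
have /compact_near_coveringP cov := fK.
pose P g h := rng h = rng g -> exists2 k, k \in hs & h = s k g.
(* Tube argument over the compact support: near an arrow over another object the ranges of [h'] and
   g stay distinct, and near one over [rng g0] the section through it is the only candidate. *)
have H h : csupp f h -> \forall h' \near h & g \near nbhs g0, P g h'.
  move=> fh; have [hg|hg] := pselect (rng h = rng g0); last first.
    have [[U W]/= [hU gW] UW] := et_sep Get hg.
    exists (U, W) => //= -[a b] /= [Ua Wb] ab.
    by case: (UW (a, b)).
  have hhs : h \in hs by rewrite in_fset_set//; apply/mem_set.
  exists (V h, [set g | [/\ V h (s h g), rng (s h g) = rng g & True]]) => /=.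
    by split; [exact: nV|apply: (near_s h setT) => //; exact: filterT].
  move=> [a g] /= [aV [sV sg _]] ag; exists h => //.
  by apply: (VI h) => //; rewrite sg.
have := cov _ (nbhs g0) P (nbhs_filter g0) H; apply: filterS => g Hg h hg fh.
by apply: Hg => //; exact: csuppP.
Qed.

(** Near [g0] the local sections rewrite the convolution as a finite sum with a fixed index set,
    each term being continuous at [g0]. *)
Lemma Cc_conv f xi : Cc f -> Cc xi -> Cc (conv f xi).
Proof.
move=> fCc xCc; split; last exact: conv_compact.
have [fc _] := fCc; have [xc _] := xCc.
move=> g0; have [hs [s [s0 sc sr si sf]]] := local_sections g0 fCc.
have srA : \forall g \near g0, [set` hs] `<=` [set h | rng (s h g) = rng g].
  apply: filterS (@filter_bigI _ _ hs (fun h => [set g | rng (s h g) = rng g])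
      (nbhs g0) _ _); first by move=> g Hg h; exact: Hg.
  exact: sr.
have E : \forall g \near g0, conv f xi g =
    \sum_(h <- hs) f (s h g) * xi (mul (inv (s h g)) g).
  apply: filterS (filterI si (filterI sf srA)) => g [gi [gf gr]].
  rewrite /Defs.conv (fsbigE [seq s h g | h <- hs]).
  - rewrite big_map big_seq_cond [RHS]big_seq.
    apply: eq_bigl => h; rewrite andb_idr// => hhs.
    by apply/mem_set; exact: gr.
  - by rewrite map_inj_in_uniq ?fset_uniq.
  - by move=> h /= /mapP[k khs ->]; exact: gr.
  - move=> h /= hg hn; have [->|fh] := eqVneq (f h) 0; first exact: mul0r.
    have [k khs hk] := gf h hg fh.
    by move: hn; rewrite hk map_f.
rewrite /continuous_at (nbhs_singleton E) /=.
have E' : \forall g \near g0,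
    \sum_(h <- hs) f (s h g) * xi (mul (inv (s h g)) g) = conv f xi g.
  by apply: filterS E => g ->.
apply: (cvg_trans (near_eq_cvg E')).
have : {subset enum_fset hs <= hs} by [].
elim: (enum_fset hs) => [|h r IH] hr.
  under eq_fun do rewrite big_nil.
  rewrite big_nil; exact: cvg_cst.
under eq_fun do rewrite big_cons.
rewrite big_cons; apply: (@cvgD _ C); last first.
  by apply: IH => k kr; apply: hr; rewrite inE kr orbT.
have hhs : h \in hs by apply: hr; rewrite mem_head.
rewrite (s0 h hhs); apply: (@cvgM R[i]).
  by apply: cvg_comp (sc h hhs) _; exact: fc.
move=> W /(xc (mul (inv h) g0)) xW.
have hg : rng h = rng g0 by have := nbhs_singleton (sr h hhs); rewrite s0.
have [[A B]/= [hA gB] AB] := et_mul Get (etrans (src_inv h) hg) xW.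
have near1 : \forall g \near g0, A (inv (s h g)) := sc h hhs _ (et_inv Get hA).
change (\forall g \near g0, W (xi (mul (inv (s h g)) g))).
apply: filterS (filterI near1 (filterI gB (sr h hhs))) => g [/= iA [Bg rg]].
by apply: (AB (inv (s h g), g)) => //=; rewrite src_inv.
Qed.

End convolution_continuity.

(** * Boundedness and completeness in the Hilbert module *)

Section l2_theory.
Context (R : realType) (G : groupoid) (Get : etale R G).
Local Notation C := (R[i]^o).
Local Notation normc := (@ComplexField.Normc.normc R).
Implicit Types (f xi eta : arr G -> C) (x : obj G) (A F Q : {fset arr G}).

Lemma norm2_sub xi eta (r s : R) : (norm2 xi <= r%:E -> norm2 eta <= s%:E ->
  norm2 (xi - eta)%R <= (2 * (r + s))%R%:E)%E.
Proof.
move=> xr es; have := norm2_lin (-1) es xr.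
by rewrite scaleN1r addrC normcN ComplexField.Normc.normc1 expr1n mul1r
  (addrC s).
Qed.

Lemma in_l2_bounded xi : xi \in @in_l2 R G ->
  exists2 s : R, 0 <= s & (norm2 xi <= s%:E)%E.
Proof.
move=> /asboolP/(_ 1 ltr01)[f /(Cc_norm2 Get)[s s0 fs] xf].
exists (2 * (1 + s)); first by rewrite mulr_ge0// addr_ge0.
have fs' : (norm2 (- f)%R <= s%:E)%E.
  move/norm2_leP : fs => fs; apply/norm2_leP => x A Ax.
  have := fs x A Ax; rewrite (eq_bigr (fun g => normc ((- f) g) ^+ 2))// => g _.
  by rewrite -normcN.
by have := norm2_sub xf fs'; rewrite opprK subrK.
Qed.

Lemma in_l2_closed xi : (forall e : R, 0 < e ->
    exists2 eta, eta \in @in_l2 R G & (norm2 (xi - eta)%R <= e%:E)%E) ->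
  xi \in @in_l2 R G.
Proof.
move=> H; apply/asboolP => e e0.
have e40 : 0 < e / 4 by rewrite divr_gt0.
have [eta /asboolP/(_ _ e40)[f fC ef] xe] := H _ e40.
exists f => //; have -> : xi - f = 1 *: (xi - eta) + (eta - f).
  by rewrite scale1r addrA subrK.
apply: le_trans (norm2_lin 1 xe ef) _.
rewrite ComplexField.Normc.normc1 expr1n mul1r lee_fin; lra.
Qed.

Lemma in_l2_Cc f : Cc f -> f \in @in_l2 R G.
Proof.
by move=> fC; apply/asboolP => e e0; exists f => //; rewrite subrr; exact: norm20.
Qed.

Lemma in_l2_conv f xi : Cc f -> xi \in @in_l2 R G -> conv f xi \in @in_l2 R G.
Proof.
move=> fC /asboolP xl; apply: in_l2_closed => e e0.
have [c c0 fc] := Cc_conv_bounded Get fC; have fr := Cc_row_finite Get fC.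
have c1 : 0 < c + 1 by rewrite ltr_wpDl.
have [f' fC' xf'] := xl (e / (c + 1)) (divr_gt0 e0 c1).
exists (conv f f'); first exact/in_l2_Cc/Cc_conv.
rewrite -convBr//; apply: le_trans (conv_bounded_norm2 c0 fr fc xf') _.
by rewrite lee_fin mulrA ler_pdivrMr// mulrC ler_wpM2l ?ltW// ltrDl.
Qed.

Lemma normc_geReB (z w : C) :
  `|complex.Re (z : R[i]) - complex.Re (w : R[i])| <= normc (z - w).
Proof. by have := normc_geRe (z - w); case: z w => a b []. Qed.

Lemma normc_geImB (z w : C) :
  `|complex.Im (z : R[i]) - complex.Im (w : R[i])| <= normc (z - w).
Proof. by have := normc_geIm (z - w); case: z w => a b []. Qed.

(** The hypothesis on squares is the form in which [conv_bounded] controls differences of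
    convolutions at one arrow. *)
Lemma complex_cauchy (c : nat -> C) (e : nat -> R) :
  (forall n m, normc (c n - c m) ^+ 2 <= e n + e m) -> e @ \oo --> (0 : R) ->
  exists z : C, forall d : R, 0 < d ->
    exists n0, forall n, (n0 <= n)%N -> normc (z - c n) <= d.
Proof.
move=> ce e0.
have H (p : R[i] -> R) : (forall z w : C, `|p z - p w| <= normc (z - w)) ->
    exists l : R, (fun n => p (c n)) @ \oo --> l.
  move=> pn; suff : cvg ((fun n => p (c n)) @ \oo) by move=> ?; eexists; eauto.
  apply/cauchy_cvgP; apply: cauchy_exP => d d0.
  have d20 : 0 < d ^+ 2 / 2 by rewrite divr_gt0// exprn_gt0.
  have [N _ HN] := cvgr_lt 0 e0 _ d20.
  exists (p (c N)); exists N => // n /= Nn.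
  rewrite /ball /=; apply: le_lt_trans (pn _ _) _.
  rewrite -ltr_sqr ?nnegrE ?normc_ge0 ?ltW//; apply: le_lt_trans (ce _ _) _.
  by rewrite [ltRHS]splitr ltrD//; apply: HN => /=.
have [a Ha] := H _ (fun z w => le_trans (normc_geReB z w) (lexx _)).
have [b Hb] := H _ (fun z w => le_trans (normc_geImB z w) (lexx _)).
exists (a +i* b)%C => d d0; have d20 : 0 < d / 2 by rewrite divr_gt0.
have /cvgrPdist_le/(_ _ d20)[N _ HN] := Ha.
have /cvgrPdist_le/(_ _ d20)[M _ HM] := Hb.
exists (maxn N M) => n; rewrite geq_max => /andP[Nn Mn].
apply: le_trans (normc_ReIm _) _; rewrite [leRHS]splitr.
have := HN n Nn; have := HM n Mn => /=.
by case: (c n) => u v /= h1 h2; exact: lerD h2 h1.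
Qed.

End l2_theory.

(** * Limits of convolution operators *)

Section limit_operators.
Context (R : realType) (G : groupoid) (Get : etale R G).
Local Notation C := (R[i]^o).
Local Notation normc := (@ComplexField.Normc.normc R).
Implicit Types (f xi eta : arr G -> C) (x : obj G) (A B F Q : {fset arr G}).

Lemma fibre_bound_ge0 x xi (s : R) : fibre_bound x xi s -> 0 <= s.
Proof.
move=> /(_ fset0); rewrite big_seq_fset0; apply.
by move=> g /=; rewrite inE.
Qed.

(** The limit is taken arrow by arrow. On a finite set [A] the estimate inserts [conv (f m0) xi]
    with m0 large for [A]; the factor 2 comes from |a + b|^2 <= 2 (|a|^2 + |b|^2). *)
Lemma conv_limit (f : nat -> arr G -> C) (e : nat -> R) xi :
  (forall n, Cc (f n)) -> (forall n, 0 <= e n) -> e @ \oo --> (0 : R) ->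
  (forall n m, conv_bounded (e n + e m) (f n - f m)) ->
  xi \in @in_l2 R G ->
  exists2 eta, eta \in @in_l2 R G &
    forall n x s, fibre_bound x xi s ->
      fibre_bound x (eta - conv (f n) xi) (2 * e n * s).
Proof.
move=> fC e_ge0 e0 fb xil.
have [s s0 /norm2_leP xis] := in_l2_bounded Get xil.
have fr n : row_finite (f n) by exact: Cc_row_finite (fC n).
have cb n m x t : fibre_bound x xi t ->
    fibre_bound x (conv (f n) xi - conv (f m) xi) ((e n + e m) * t).
  move=> xt; rewrite -convBl//; apply: conv_bounded_fibre xt => //.
  - exact: addr_ge0.
  - exact: row_finiteB.
have es0 : (fun n => e n * s) @ \oo --> (0 : R).
  by rewrite -[X in _ --> X](mul0r s); exact: cvgMr_tmp.
have /choice[eta Heta] (g : arr G) : exists z : C, forall d : R, 0 < d ->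
    exists n0, forall n, (n0 <= n)%N -> normc (z - conv (f n) xi g) <= d.
  apply: (complex_cauchy (e := fun n => e n * s)) es0 => n m.
  rewrite -mulrDl.
  exact: (fibre_bound1 (erefl (src g)) (cb n m (src g) s (xis (src g)))).
have bound n x t : fibre_bound x xi t ->
    fibre_bound x (eta - conv (f n) xi) (2 * e n * t).
  move=> xt A Ax; have t0 := fibre_bound_ge0 xt.
  apply/ler_addgt0Pr => d d0.
  pose N : R := (size (enum_fset A))%:R.
  have N0 : 0 <= N by exact: ler0n.
  (* The minimum with 1 gives dd^2 <= dd, so the squares over [A] add up to at most N dd <= d / 4;
     the tail [e m0 * t] takes another d / 4, and doubling both spends d. *)
  pose dd := Num.min 1 (d / (4 * (N + 1))).
  have N1 : 0 < 4 * (N + 1) by rewrite mulr_gt0// ltr_wpDl.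
  have dd0 : 0 < dd by rewrite lt_min ltr01 divr_gt0.
  have near1 : \forall m \near \oo,
      [set` A] `<=` [set g | normc (eta g - conv (f m) xi g) <= dd].
    apply: filterS (@filter_bigI _ _ A
      (fun g => [set m | normc (eta g - conv (f m) xi g) <= dd]) \oo _ _).
      by move=> m Hm g; exact: Hm.
    by move=> g _; have [n0 Hn0] := Heta g dd dd0; exists n0.
  have d4 : 0 < d / (4 * (t + 1)) by rewrite divr_gt0// mulr_gt0// ltr_wpDl.
  have near2 : \forall m \near \oo, e m < d / (4 * (t + 1)).
    by have [n1 _ Hn1] := cvgr_lt 0 e0 _ d4; exists n1.
  have [m0 _ Hm0] := filterI near1 near2.
  have [Am em] := Hm0 m0 (leqnn m0).
  apply: (@le_trans _ _ (\sum_(g <- A) (2 * normc (eta g - conv (f m0) xi g) ^+ 2 +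
      2 * normc ((conv (f m0) xi - conv (f n) xi) g) ^+ 2))).
    apply: ler_sum => g _; rewrite -mulrDr.
    have -> : (eta - conv (f n) xi) g = (eta g - conv (f m0) xi g) +
        (conv (f m0) xi - conv (f n) xi) g by rewrite !fctE addrA subrK.
    exact: normc_sqrD.
  rewrite big_split /= -!mulr_sumr.
  have h1 : \sum_(g <- A) normc (eta g - conv (f m0) xi g) ^+ 2 <= N * dd.
    apply: (@le_trans _ _ (\sum_(g <- A) dd)).
      rewrite big_seq [leRHS]big_seq; apply: ler_sum => g gA.
      apply: (@le_trans _ _ (dd ^+ 2)); first by rewrite ler_sqr ?nnegrE ?normc_ge0//;
        [exact: Am|exact: ltW].
      have dd1 : dd <= 1 by rewrite /dd ge_min lexx.
      by rewrite expr2 ler_piMl//; exact: ltW.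
    by rewrite big_const_seq count_predT iter_addr addr0 -mulr_natl.
  have h2 := cb m0 n x t xt A Ax.
  have h3 : N * dd <= d / 4.
    apply: (@le_trans _ _ ((N + 1) * (d / (4 * (N + 1))))).
      apply: ler_pM => //; first exact: ltW.
        by rewrite lerDl.
      by rewrite /dd ge_min lexx orbT.
    rewrite le_eqVlt; apply/orP; left; apply/eqP; field.
    by rewrite gt_eqF// ltr_wpDl.
  have h4 : e m0 * t <= d / 4.
    apply: (@le_trans _ _ ((d / (4 * (t + 1))) * (t + 1))).
      apply: ler_pM => //; first exact: ltW.
      by rewrite lerDl.
    rewrite le_eqVlt; apply/orP; left; apply/eqP; field.
    by rewrite gt_eqF// ltr_wpDl.
  by rewrite mulrDl in h2; lra.
exists eta => //; apply: in_l2_closed => d d0.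
have d20 : 0 < d / (2 * (s + 1)) by rewrite divr_gt0// mulr_gt0// ltr_wpDl.
have [n _ /(_ n (leqnn n)) en] := cvgr_lt 0 e0 _ d20.
exists (conv (f n) xi); first exact: in_l2_conv.
apply/norm2_leP => x A Ax; apply: le_trans (bound n x s (xis x) A Ax) _.
apply: (@le_trans _ _ (2 * (d / (2 * (s + 1))) * (s + 1))).
  apply: ler_pM => //; first by rewrite mulr_ge0.
    by rewrite ler_wpM2l// ltW.
  by rewrite lerDl.
rewrite le_eqVlt; apply/orP; left; apply/eqP; field.
by rewrite gt_eqF// ltr_wpDl.
Qed.

(** For finite blocks the identity is an exchange of sums. Infinite fibres are reached by
    truncation, with errors from the two approximations of [csum], from replacing [u] and [u'] by
    convolutions, and from cutting [eta] off outside [A]. *)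
Lemma csum_adjoint x (u xi eta u' : arr G -> C) (S : R) :
  fibre_bound x u S -> fibre_bound x xi S ->
  fibre_bound x eta S -> fibre_bound x u' S ->
  (forall d : R, 0 < d -> exists f, [/\ Cc f, fibre_bound x (u - conv f xi) d &
    fibre_bound x (u' - conv (fadj f) eta) d]) ->
  csum (fibre x) (fun g => (u g)^*%C * eta g) =
  csum (fibre x) (fun g => (xi g)^*%C * u' g).
Proof.
move=> uS xS eS u'S H; have S0 := fibre_bound_ge0 uS.
(* Square roots of S are avoided through S <= (1 + S)^2. *)
have sq (z : C) (d : R) : 0 <= d -> normc z ^+ 2 <= d ^+ 2 * S ->
    normc z <= d * (1 + S).
  move=> d0 zd; rewrite -ler_sqr ?nnegrE ?normc_ge0 ?mulr_ge0 ?addr_ge0//.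
  apply: le_trans zd _; rewrite exprMn ler_wpM2l ?sqr_ge0//.
  have : 0 <= S ^+ 2 by exact: sqr_ge0.
  by rewrite sqrrD; lra.
have cs (v w : arr G -> C) r A d : fibre_bound x v r -> fibre_bound x w d ->
    [set` A] `<=` fibre x ->
    normc (\sum_(g <- A) (v g)^*%C * w g) ^+ 2 <= r * d.
  move=> vr wd Ax; apply: le_trans (sqr_normc_sum_le _ _ _) _.
  apply: ler_pM; first by apply: sumr_ge0 => g _; exact: sqr_ge0.
  - by apply: sumr_ge0 => g _; exact: sqr_ge0.
  - by under eq_bigr do rewrite normcJ; exact: vr.
  - exact: wd.
have sm (v w : arr G -> C) : fibre_bound x v S -> fibre_bound x w S ->
    forall A, [set` A] `<=` fibre x ->
    \sum_(g <- A) normc ((v g)^*%C * w g) <= S + S.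
  move=> vS wS A Ax.
  apply: (@le_trans _ _ (\sum_(g <- A) (normc (v g) ^+ 2 + normc (w g) ^+ 2))).
    apply: ler_sum => g _; rewrite normcM normcJ.
    move: (normc_ge0 (v g)) (normc_ge0 (w g)).
    move: (normc (v g)) (normc (w g)) => a b a0 b0.
    have : 0 <= (a - b) ^+ 2 by exact: sqr_ge0.
    by have := mulr_ge0 a0 b0; rewrite sqrrB; lra.
  by rewrite big_split lerD//; [exact: vS|exact: wS].
set P := csum _ _; set P' := csum _ _.
(* Two truncations of [csum] cost d each and three inner products cost d (1 + S) each. *)
suff PP (d : R) : 0 < d -> normc (P - P') <= d * (5 + 3 * S).
  have : normc (P - P') <= 0.
    apply/ler_addgt0Pr => d d0; rewrite add0r.
    have S5 : 0 < 5 + 3 * S by rewrite ltr_wpDr// mulr_ge0.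
    by have := PP _ (divr_gt0 d0 S5); rewrite divfK// gt_eqF.
  rewrite le_eqVlt ltNge normc_ge0 orbF => /eqP/ComplexField.Normc.eq0_normc.
  by move=> /eqP; rewrite subr_eq0 => /eqP.
move=> d0; have [f [fC uf uf']] := H (d ^+ 2) (exprn_gt0 2 d0).
have [c c0 fc] := Cc_conv_bounded Get fC.
have fr := Cc_row_finite Get fC.
have far := Cc_row_finite Get (Cc_fadj Get fC).
have fac := conv_bounded_fadj c0 fc.
have c1 : 0 < c + 1 by rewrite ltr_wpDl.
(* The mass of [eta] outside [A0] is so small that the convolution bound c still leaves at most
   d^2. *)
have tail0 : 0 < d ^+ 2 / (c + 1) by rewrite divr_gt0// exprn_gt0.
have [A0 A0x HA0] := sum_tail (fun g => sqr_ge0 (normc (eta g))) eS tail0.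
have [A1 A1x HA1] := csum_approx (sm u eta uS eS) d0.
have [B1 B1x HB1] := csum_approx (sm xi u' xS u'S) d0.
have fUx A B : [set` A] `<=` fibre x -> [set` B] `<=` fibre x ->
    [set` (A `|` B)%fset] `<=` fibre x.
  by move=> Ax Bx g /=; rewrite inE => /orP[/Ax|/Bx].
(* Order of choices: [A] controls the first sum and the tail of [eta], [B] adds the columns that
   rows of [A] reach, and [D] collects the further columns that the adjoint reaches from [B]. *)
pose A := (A0 `|` A1)%fset; have Ax : [set` A] `<=` fibre x by exact: fUx.
have [QA QAx HQA] := row_finite_fset fr Ax.
pose B := (B1 `|` QA)%fset; have Bx : [set` B] `<=` fibre x by exact: fUx.
have [QB QBx HQB] := row_finite_fset far Bx.
pose D := (QB `\` A)%fset.
have Dx : [set` D] `<=` fibre x by move=> g /=; rewrite inE => /andP[_ /QBx].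
have AD : [disjoint A & D]%fset.
  by apply/fdisjointP => g gA; rewrite inE gA.
have h1 : normc (P - \sum_(g <- A) (u g)^*%C * eta g) <= d.
  by apply: HA1 => //; exact: fsubsetUr.
have h5 : normc (\sum_(k <- B) (xi k)^*%C * u' k - P') <= d.
  by rewrite normcC; apply: HB1 => //; exact: fsubsetUl.
have h2 : normc (\sum_(g <- A) ((u - conv f xi) g)^*%C * eta g) <= d * (1 + S).
  by apply: sq; [exact: ltW|exact: cs].
have h4 : normc (\sum_(k <- B) (xi k)^*%C * (u' - conv (fadj f) eta) k) <=
    d * (1 + S).
  by apply: sq; [exact: ltW|rewrite [leRHS]mulrC; exact: cs].
pose w k : C := \sum_(g <- D) fadj f (mul k (inv g)) * eta g.
have h3 : normc (\sum_(k <- B) (xi k)^*%C * w k) <= d * (1 + S).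
  apply: sq; first exact: ltW.
  apply: le_trans (sqr_normc_sum_le _ _ _) _; rewrite [leRHS]mulrC.
  apply: ler_pM; first by apply: sumr_ge0 => g _; exact: sqr_ge0.
  - by apply: sumr_ge0 => g _; exact: sqr_ge0.
  - by under eq_bigr do rewrite normcJ; exact: xS.
  - apply: le_trans (fac x B D Bx Dx eta) _.
    have A0D : [disjoint A0 & D]%fset.
      apply/fdisjointP => g gA0; have gA : g \in A by rewrite inE gA0.
      exact: (fdisjointP AD).
    apply: le_trans (ler_wpM2l c0 (HA0 D Dx A0D)) _.
    by rewrite mulrA ler_pdivrMr// mulrC ler_wpM2l ?sqr_ge0// lerDl.
have e1 : \sum_(g <- A) (conv f xi g)^*%C * eta g =
    \sum_(k <- B) (xi k)^*%C * \sum_(g <- A) fadj f (mul k (inv g)) * eta g.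
  transitivity (\sum_(g <- A) \sum_(k <- B)
      (xi k)^*%C * (fadj f (mul k (inv g)) * eta g)); last first.
    by rewrite exchange_big /=; apply: eq_bigr => k _; rewrite mulr_sumr.
  apply: eq_fbigr => g gA _; have gx : src g = x by exact: Ax.
  rewrite (@conv_mx _ _ _ _ _ B) ?gx//; last first.
    by move=> h hg fh; rewrite inE (HQA g) ?orbT.
  rewrite rmorph_sum mulr_suml; apply: eq_fbigr => k kB _.
  rewrite rmorphM /fadj inv_mulV; first by rewrite mulrA (mulrC (xi k)^*%C).
  by rewrite gx; exact: Bx.
have e2 : \sum_(k <- B) (xi k)^*%C * conv (fadj f) eta k =
    \sum_(k <- B) (xi k)^*%C * (\sum_(g <- A) fadj f (mul k (inv g)) * eta g) +
    \sum_(k <- B) (xi k)^*%C * w k.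
  rewrite -big_split; apply: eq_fbigr => k kB _ /=; rewrite -mulrDr; congr (_ * _).
  have kx : src k = x by exact: Bx.
  rewrite -sum_fsetU//; apply: conv_mx; first by rewrite kx; exact: fUx.
  move=> h hk fh; have := HQB k h kB hk fh; rewrite !inE => ->.
  by rewrite andbT orbN.
have e3 : \sum_(g <- A) (u g)^*%C * eta g =
    \sum_(g <- A) ((u - conv f xi) g)^*%C * eta g +
    \sum_(g <- A) (conv f xi g)^*%C * eta g.
  by rewrite -big_split; apply: eq_bigr => g _ /=; rewrite -mulrDl -rmorphD subrK.
have e4 : \sum_(k <- B) (xi k)^*%C * u' k =
    \sum_(k <- B) (xi k)^*%C * (u' - conv (fadj f) eta) k +
    \sum_(k <- B) (xi k)^*%C * conv (fadj f) eta k.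
  by rewrite -big_split; apply: eq_bigr => g _ /=; rewrite -mulrDr subrK.
have -> : P - P' = (P - \sum_(g <- A) (u g)^*%C * eta g) +
  (\sum_(k <- B) (xi k)^*%C * u' k - P') +
  \sum_(g <- A) ((u - conv f xi) g)^*%C * eta g -
  \sum_(k <- B) (xi k)^*%C * (u' - conv (fadj f) eta) k -
  \sum_(k <- B) (xi k)^*%C * w k.
  by rewrite e4 e3 e2 e1; ring.
apply: le_trans (normcD _ _) _; rewrite normcN.
apply: (@le_trans _ _ ((d + d + d * (1 + S) + d * (1 + S)) + d * (1 + S))).
  apply: lerD => //; apply: le_trans (normcD _ _) _; rewrite normcN.
  apply: lerD => //; apply: le_trans (normcD _ _) _.
  apply: lerD => //; apply: le_trans (normcD _ _) _.
  exact: lerD.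
by rewrite le_eqVlt; apply/orP; left; apply/eqP; ring.
Qed.

(** The involution keeps block bounds and respects differences, so the convolutions by [fadj (f n)]
    converge too, and their limit is the adjoint. *)
Lemma limit_operator (f : nat -> arr G -> C) (e : nat -> R) :
  (forall n, Cc (f n)) -> (forall n, 0 <= e n) -> e @ \oo --> (0 : R) ->
  (forall n m, conv_bounded (e n + e m) (f n - f m)) ->
  exists T T' : l2 R G -> l2 R G, is_adjoint T T' /\
    forall n (xi : l2 R G) x s, fibre_bound x xi s ->
      fibre_bound x (l2_val (T xi) - conv (f n) xi) (2 * e n * s).
Proof.
move=> fC e_ge0 e0 fb.
have faC n : Cc (fadj (f n)) by exact: Cc_fadj (fC n).
have fab n m : conv_bounded (e n + e m) (fadj (f n) - fadj (f m)).
  have -> : fadj (f n) - fadj (f m) = fadj (f n - f m).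
    apply/funext => g.
    change ((f n (inv g))^*%C - (f m (inv g))^*%C = (f n (inv g) - f m (inv g))^*%C).
    by rewrite rmorphB.
  by apply: conv_bounded_fadj => //; exact: addr_ge0.
have lim h : (forall n, Cc (h n)) ->
    (forall n m, conv_bounded (e n + e m) (h n - h m)) ->
    exists T : l2 R G -> l2 R G, forall n (xi : l2 R G) x s, fibre_bound x xi s ->
      fibre_bound x (l2_val (T xi) - conv (h n) xi) (2 * e n * s).
  move=> hC hb; have /choice[T HT] (xi : l2 R G) : exists eta : l2 R G,
      forall n x s, fibre_bound x xi s ->
        fibre_bound x (l2_val eta - conv (h n) xi) (2 * e n * s).
    have [eta etal Heta] := conv_limit hC e_ge0 e0 hb (l2P xi).
    by exists (L2 etal).
  by exists T => n xi; exact: HT.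
have [T HT] := lim _ fC fb; have [T' HT'] := lim _ faC fab.
exists T, T'; split=> // xi eta x.
have bd (z : l2 R G) : exists2 s : R, 0 <= s & fibre_bound x z s.
  by have [s s0 /norm2_leP zs] := in_l2_bounded Get (l2P z); exists s.
have [s1 s10 b1] := bd (T xi); have [s2 s20 b2] := bd xi.
have [s3 s30 b3] := bd eta; have [s4 s40 b4] := bd (T' eta).
pose S := s1 + s2 + s3 + s4.
have le z r : fibre_bound x z r -> r <= S -> fibre_bound x z S.
  by move=> zr rS A Ax; exact: le_trans (zr A Ax) rS.
apply: (csum_adjoint (S := S)).
- by apply: le b1 _; rewrite /S; lra.
- by apply: le b2 _; rewrite /S; lra.
- by apply: le b3 _; rewrite /S; lra.
- by apply: le b4 _; rewrite /S; lra.
move=> d d0; have S0 : 0 <= S by rewrite !addr_ge0.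
have dS : 0 < d / (2 * (S + 1)) by rewrite divr_gt0// mulr_gt0// ltr_wpDl.
have [n _ /(_ n (leqnn n)) en] := cvgr_lt 0 e0 _ dS.
have nd : 2 * e n * S <= d.
  apply: (@le_trans _ _ (2 * (d / (2 * (S + 1))) * (S + 1))).
    apply: ler_pM => //; first by rewrite mulr_ge0.
      by rewrite ler_wpM2l// ltW.
    by rewrite lerDl.
  rewrite le_eqVlt; apply/orP; left; apply/eqP; field.
  by rewrite gt_eqF// ltr_wpDl.
exists (f n); split => // A Ax; apply: le_trans nd.
  by apply: (HT n xi x S) => //; apply: le b2 _; rewrite /S; lra.
by apply: (HT' n eta x S) => //; apply: le b3 _; rewrite /S; lra.
Qed.

End limit_operators.

(** * Smale spaces *)

Section closeness.
Context (R : realType) (X : metricType R) (f fV : X -> X) (b : X -> X -> X).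
Context (e0 l0 d0 : R).
Hypothesis fK : cancel f fV.
Hypothesis e0_gt0 : 0 < e0.
Hypothesis l0_gt0 : 0 < l0.
Hypothesis l0_lt1 : l0 < 1.
Hypothesis d0e0 : d0 <= e0.
Hypothesis bd : forall x y, mdist x y < d0 -> mdist (b x y) x < e0.
Hypothesis bxx : forall x, b x x = x.
Hypothesis bA : forall x y z, mdist x y < e0 -> mdist y z < e0 ->
  mdist x z < e0 -> mdist (b x y) z < e0 -> mdist x (b y z) < e0 ->
  b x (b y z) = b x z.
Hypothesis bf : forall x y, mdist x y < e0 -> mdist (f x) (f y) < e0 ->
  b (f x) (f y) = f (b x y).
Hypothesis ctrV : forall x y z, b x y = y /\ mdist x y < e0 ->
  b x z = z /\ mdist x z < e0 -> mdist (fV y) (fV z) <= l0 * mdist y z.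

(* The forward orbit of [b c a] stays near that of [c], while [b c a] lies on
   the unstable set of [c], where [fV] contracts. *)
Lemma forward_close a c : (forall k, mdist (iter k f a) (iter k f c) < d0) ->
  b c a = c.
Proof.
move=> H.
have He k : mdist (iter k f c) (iter k f a) < e0.
  by rewrite metric_sym; exact: lt_le_trans (H k) d0e0.
have Hb k : mdist (iter k f c) (b (iter k f c) (iter k f a)) < e0.
  by rewrite metric_sym; apply: bd; rewrite metric_sym.
have it k : iter k f (b c a) = b (iter k f c) (iter k f a).
  by elim: k => //= k ->; rewrite -bf//; exact: (He k.+1).
have U k : b (iter k f c) (iter k f (b c a)) = iter k f (b c a) /\
    mdist (iter k f c) (iter k f (b c a)) < e0.
  rewrite it; split; last exact: Hb.
  by apply: bA; rewrite ?mdistxx// bxx.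
have U0 k : b (iter k f c) (iter k f c) = iter k f c /\
    mdist (iter k f c) (iter k f c) < e0 by rewrite bxx mdistxx.
(* Pulling back from time k to time 0 gains a factor [l0] per step, while the distance at time k
   stays below [e0]. *)
have le k : mdist (b c a) c <= l0 ^+ k * mdist (iter k f (b c a)) (iter k f c).
  elim: k => [|k IH]; first by rewrite expr0 mul1r.
  apply: le_trans IH _; rewrite exprSr -mulrA ler_pM2l ?exprn_gt0//.
  by have := ctrV (U k.+1) (U0 k.+1); rewrite /= !fK.
have c0 : (fun k => l0 ^+ k * e0) @ \oo --> (0 * e0 : R^o).
  by apply: cvgMr_tmp; apply: cvg_expr; rewrite ger0_norm ?ltW.
rewrite mul0r in c0.
apply/eqP; rewrite -[_ == _]negbK -mdist_gt0 -leNgt; apply/ler_addgt0Pr => d dp.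
have [N _ HN] := cvgr_lt _ c0 _ dp.
rewrite add0r; apply: le_trans (le N) _; apply: le_trans (ltW (HN N (leqnn N))).
by rewrite ler_pM2l ?exprn_gt0// metric_sym; exact: ltW (U N).2.
Qed.

End closeness.

Section uniform_contraction.
Context (R : realType) (X : metricType R) (f : X -> X) (b : X -> X -> X).
Context (e0 l0 : R).
Hypothesis e0_gt0 : 0 < e0.
Hypothesis l0_gt0 : 0 < l0.
Hypothesis l0_lt1 : l0 < 1.
Hypothesis bxx : forall x, b x x = x.
Hypothesis bf : forall x y, mdist x y < e0 -> mdist (f x) (f y) < e0 ->
  b (f x) (f y) = f (b x y).
Hypothesis ctr : forall x y z, b y x = y /\ mdist x y < e0 ->
  b z x = z /\ mdist x z < e0 -> mdist (f y) (f z) <= l0 * mdist y z.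

Lemma uniform_contraction r : 0 < r -> exists c, forall x y k, (c <= k)%N ->
  b y x = y -> mdist x y < e0 -> mdist (iter k f x) (iter k f y) < r.
Proof.
move=> r0.
have c0 : (fun k => l0 ^+ k * e0) @ \oo --> (0 * e0 : R^o).
  by apply: cvgMr_tmp; apply: cvg_expr; rewrite ger0_norm ?ltW.
rewrite mul0r in c0; have [c _ Hc] := cvgr_lt _ c0 _ r0.
exists c => x y k ck byx xy; apply: le_lt_trans (Hc k ck).
apply: (@le_trans _ _ (l0 ^+ k * mdist x y)); last first.
  by rewrite ler_pM2l ?exprn_gt0// ltW.
elim: k {ck} => [|k IH]; first by rewrite expr0 mul1r.
have h := loc_iter e0_gt0 l0_lt1 bxx bf ctr k (conj byx xy).
apply: le_trans (loc_dist e0_gt0 bxx ctr h) _.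
by rewrite exprS -mulrA ler_pM2l.
Qed.

End uniform_contraction.

Section smale_constants.
Context (R : realType) (S : smale_space R).
Local Notation phi := (@phi R S).
Local Notation phiV := (@phiV R S).
Local Notation br := (@bracket R S).
Local Notation e0 := (eps0 S).

(** So [x, y] lies on the local stable set of y; [bracket_idr] places it on the local unstable set
    of x. *)
Lemma bracket_idl (x y : S) : mdist x y < e0 -> mdist (br x y) y < e0 ->
  br (br x y) y = br x y.
Proof.
move=> xy bxy; apply: (bracketA _ _ _ _ _).1; rewrite /Delta/= ?mdistxx ?eps0_gt0//.
by rewrite bracketxx.
Qed.

Lemma bracket_idr (x y : S) : mdist x y < e0 -> mdist x (br x y) < e0 ->
  br x (br x y) = br x y.
Proof.
move=> xy bxy; apply: (bracketA _ _ _ _ _).2; rewrite /Delta/= ?mdistxx ?eps0_gt0//.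
by rewrite bracketxx.
Qed.

(** Expansiveness in two halves: closeness of forward orbits puts c on the local stable set of a,
    closeness of backward orbits on the unstable one. The second half is the first for [phiV] and
    the opposite bracket, and d lies below the uniform radii of both brackets. *)
Lemma expansive_const : exists d : R, [/\ 0 < d, d <= e0,
  forall a c : S, (forall k, mdist (iter k phi a) (iter k phi c) < d) ->
    br c a = c &
  forall a c : S, (forall k, mdist (iter k phiV a) (iter k phiV c) < d) ->
    br a c = c].
Proof.
have near' (x : S) : \forall w \near (x, x),
    mdist w.1 w.2 < e0 -> mdist x (br w.2 w.1) < e0 / 2.
  have [[U V]/= [Ux Vx] UV] := bracket_near x.
  exists (V, U) => //= -[y z]/= [Vy Uz]; rewrite metric_sym.
  exact: (UV (z, y)).
have [d1 d10 H1] := loc_unif (@space_compact R S) (eps0_gt0 S) (@bracket_near R S).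
have [d2 d20 H2] := @loc_unif _ _ (@space_compact R S) (fun a b => br b a) _
  (eps0_gt0 S) near'.
pose d := Num.min e0 (Num.min d1 d2).
have dl1 : d <= d1 by rewrite /d !ge_min lexx orbT.
have dl2 : d <= d2 by rewrite /d !ge_min lexx !orbT.
have dl0 : d <= e0 by rewrite /d ge_min lexx.
exists d; split => //; first by rewrite !lt_min eps0_gt0 d10 d20.
- move=> a c; apply: (@forward_close _ _ phi phiV br e0 (lambda0 S) d
    (@phiK R S) (eps0_gt0 S) (lambda0_gt0 S) (lambda0_lt1 S) dl0) => //.
  + by move=> x y xy; apply: H1; exact: lt_le_trans dl1.
  + exact: bracketxx.
  + by move=> x y z *; apply: (bracketA _ _ _ _ _).2.
  + exact: bracket_phi.
  + by move=> x y z; exact: (Xu_contract (eps0_gt0 S)).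
move=> a c; apply: (@forward_close _ _ phiV phi (fun a b => br b a) e0 (lambda0 S) d
    (@phiVK R S) (eps0_gt0 S) (lambda0_gt0 S) (lambda0_lt1 S) dl0) => //.
- by move=> x y xy; apply: H2; exact: lt_le_trans dl2.
- exact: bracketxx.
- by move=> x y z *; apply: (bracketA _ _ _ _ _).1; rewrite /Delta/= metric_sym.
- by move=> x y *; apply: bracket_phiV; rewrite // metric_sym.
- by move=> x y z; exact: (Xs_contract (eps0_gt0 S)).
Qed.

Lemma contraction_const (r : R) : 0 < r -> exists c,
  (forall (x y : S) k, (c <= k)%N -> br y x = y -> mdist x y < e0 ->
     mdist (iter k phi x) (iter k phi y) < r) /\
  (forall (x y : S) k, (c <= k)%N -> br x y = y -> mdist x y < e0 ->
     mdist (iter k phiV x) (iter k phiV y) < r).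
Proof.
move=> r0.
have [c1 H1] := @uniform_contraction _ _ phi br e0 (lambda0 S) (eps0_gt0 S)
  (lambda0_gt0 S) (lambda0_lt1 S) (@bracketxx R S) (@bracket_phi R S)
  (fun x y z => Xs_contract (eps0_gt0 S) (lexx _)) r r0.
have [c2 H2] := @uniform_contraction _ _ phiV (fun a b => br b a) e0 (lambda0 S)
  (eps0_gt0 S) (lambda0_gt0 S) (lambda0_lt1 S) (@bracketxx R S)
  (@bracket_phiV R S)
  (fun x y z => Xu_contract (eps0_gt0 S) (lexx _)) r r0.
exists (maxn c1 c2); split=> x y k; rewrite geq_max => /andP[k1 k2].
  exact: H1.
exact: H2.
Qed.

End smale_constants.

Lemma int_ge_nat (n c : nat) (k : int) : (n + c)%N%:Z <= k ->
  exists2 j : nat, (c <= j)%N & k = (j + n)%N%:Z.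
Proof. by move=> nk; exists (`|k| - n)%N; lia. Qed.

(** Openness tested point by point: the witness is the interior of the set of points that belong to
    V as soon as they belong to the piece. *)
Lemma indlim_open_near (T I : Type) (Y : topologicalType) (A : set T)
    (E : I -> nat -> set Y) (j : I -> Y -> T) (V : set (set_type A)) :
  (forall i n y, E i n y -> (set_val @` V) (j i y) ->
    \forall y' \near y, E i n y' -> (set_val @` V) (j i y')) ->
  indlim_open E j V.
Proof.
move=> H i n.
exists [set y | E i n y -> (set_val @` V) (j i y)]°; first exact: open_interior.
apply/seteqP; split=> y [Ey Vy]; split=> //; first exact: H.
exact: interior_subset Vy Ey.
Qed.

(** * The groupoid of the stable and unstable relations is etale *)

Section su_topology.
Context (R : realType) (S : smale_space R).
Local Notation phi := (@phi R S).
Local Notation phiV := (@phiV R S).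
Local Notation br := (@bracket R S).
Local Notation e0 := (eps0 S).
Implicit Types (pq : int * int) (w : S * S) (g : su_arr S).

Lemma near_mdist_lt (T : Type) (F : set_system T) {FF : Filter F}
    (f h : T -> S) (u v : S) (r : R) : f @ F --> u -> h @ F --> v -> mdist u v < r ->
  \forall t \near F, mdist (f t) (h t) < r.
Proof.
move=> fu hv uvr; pose d := (r - mdist u v) / 2.
have d0 : 0 < d by rewrite divr_gt0// subr_gt0.
have fd : \forall t \near F, mdist u (f t) < d.
  exact: metricType_numDomainType.cvgr_dist_lt fu _ d0.
have hd : \forall t \near F, mdist v (h t) < d.
  exact: metricType_numDomainType.cvgr_dist_lt hv _ d0.
apply: filterS2 fd hd => t ft ht.
apply: le_lt_trans (metric_triangle _ u _) _.
apply: (@lt_le_trans _ _ (d + (mdist u v + d))); last by rewrite /d; lra.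
rewrite metric_sym ltrD//; apply: le_lt_trans (metric_triangle _ v _) _.
by rewrite ltrD2l.
Qed.

Lemma phiz_continuous (n : int) : continuous (phiz n : S -> S).
Proof.
have H (f : S -> S) (k : nat) : continuous f -> continuous (iter k f).
  move=> cf; elim: k => [|k IH] x; first exact: cvg_id.
  by apply: continuous_comp; [exact: IH|exact: cf].
case: n => n; first exact: H (@phi_continuous R S).
exact: H (@phiV_continuous R S).
Qed.

Definition su_deg g : int * int := (su_sdeg g, su_udeg g).

Definition su_ends g : S * S := (su_rng g, su_src g).

(** From time N on, the forward orbits of phi^p x and y, and the backward orbits of phi^q x and y,
    stay within r. Strict inequalities survive perturbation. *)
Definition su_close pq (N : nat) (r : R) : set (S * S) := [set w |
  forall k : int, N%:Z <= k -> mdist (phiz (k + pq.1) w.1) (phiz k w.2) < r /\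
    mdist (phiz (pq.2 - k) w.1) (phiz (- k) w.2) < r].

Lemma su_close_le pq N M r s : (N <= M)%N -> r <= s ->
  su_close pq N r `<=` su_close pq M s.
Proof.
move=> NM rs w H k Mk.
have [|h1 h2] := H k; first by apply: le_trans Mk; rewrite lez_nat.
by split; exact: lt_le_trans rs.
Qed.

(** Contraction brings the orbits within r after c further steps, with c independent of the degrees,
    the level and the pair. *)
Lemma su_piece_close r : 0 < r -> exists c, forall pq n w,
  su_piece pq n w -> su_close pq (n + c) r w.
Proof.
move=> r0; have [c [H1 H2]] := @contraction_const R S r r0; exists c => -[p q] n [x y].
move=> [/GsE[s1 s2] /GuE[u1 u2]] k /= nk.
have [j jc ->] := int_ge_nat nk.
split.
  rewrite phizD -[phiz (j + n)%:Z _]/(iter (j + n) phi _).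
  rewrite -[phiz (j + n)%:Z y]/(iter (j + n) phi y) !iterD.
  exact: H1.
rewrite [q - _]addrC phizD /phiz !iterzN !iterD.
exact: H2.
Qed.

Lemma su_ex_close g (r : R) : 0 < r ->
  exists N, su_close (su_deg g) N r (su_ends g).
Proof.
move=> r0; have [c Hc] := su_piece_close r0.
have [[n _ sn] [m _ um]] := suP g.
exists (maxn n m + c)%N; apply: Hc; split.
  exact: Gs_le (leq_maxl _ _) sn.
exact: Gu_le (leq_maxr _ _) um.
Qed.

(** Within the piece of level n all conditions from time n + c on hold automatically; the finitely
    many remaining ones are open. *)
Lemma near_su_close g N (r : R) : 0 < r ->
  su_close (su_deg g) N r (su_ends g) -> \forall h \near g,
    su_deg h = su_deg g /\ su_close (su_deg g) N r (su_ends h).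
Proof.
move=> r0 gN; have [c Hc] := su_piece_close r0.
pose U := [set h | su_deg h = su_deg g /\ su_close (su_deg g) N r (su_ends h)].
suff oU : su_open U by apply: (@open_nbhs_nbhs (su_arr S) g U); split.
apply: indlim_open_near => pq n w Ew [h [hg hN]] hw.
have pqE : su_deg g = pq.
  by rewrite -hg /su_deg /su_sdeg /su_udeg hw /=; case: (pq).
have wE : su_ends h = w.
  by rewrite /su_ends /su_rng /su_src hw /=; case: (w).
rewrite pqE wE in hN.
have nk (k : int) : N%:Z <= k -> \forall v \near w,
    mdist (phiz (k + pq.1) v.1) (phiz k v.2) < r /\
    mdist (phiz (pq.2 - k) v.1) (phiz (- k) v.2) < r.
  move=> Nk; have [h1 h2] := hN k Nk.
  have c1 m : (fun v : S * S => phiz m v.1) @ w --> phiz m w.1.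
    by apply: cvg_comp cvg_fst _; exact: phiz_continuous.
  have c2 m : (fun v : S * S => phiz m v.2) @ w --> phiz m w.2.
    by apply: cvg_comp cvg_snd _; exact: phiz_continuous.
  by apply: filterI; [exact: near_mdist_lt (c1 _) (c2 _) h1|
    exact: near_mdist_lt (c1 _) (c2 _) h2].
have near1 : \forall v \near w, forall k : 'I_(n + c), (N <= k)%N ->
    mdist (phiz (k%:Z + pq.1) v.1) (phiz k v.2) < r /\
    mdist (phiz (pq.2 - k%:Z) v.1) (phiz (- k%:Z) v.2) < r.
  apply: (@filter_forall _ _ (fun (k : 'I_(n + c)) v => (N <= k)%N ->
    mdist (phiz (k%:Z + pq.1) v.1) (phiz k v.2) < r /\
    mdist (phiz (pq.2 - k%:Z) v.1) (phiz (- k%:Z) v.2) < r)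
    (nbhs w) (nbhs_filter w)) => k; have [Nk|Nk] := boolP (N <= k)%N; last first.
    exact: nearW.
  by apply: filterS (nk k _) => //; rewrite lez_nat.
apply: filterS near1 => v Hv Ev.
exists (exist _ (su_emb pq v) (mem_set (su_embP Ev))) => //; split.
  by rewrite pqE [RHS]surjective_pairing.
rewrite pqE /su_ends /su_rng /su_src /= => k Nk.
have [kc|kc] := leP (n + c)%N%:Z k; first exact: Hc Ev k kc.
case: k Nk kc => k Nk kc; last by exfalso; lia.
have kk : (k < n + c)%N by lia.
by apply: (Hv (Ordinal kk)); rewrite /=; lia.
Qed.

Lemma near_su_deg g : \forall h \near g, su_deg h = su_deg g.
Proof.
have [N gN] := su_ex_close g (@ltr01 R).
by apply: filterS (near_su_close (@ltr01 R) gN) => h [].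
Qed.

Lemma near_su_ends g (r : R) : 0 < r -> \forall h \near g,
  mdist (su_rng g) (su_rng h) < r /\ mdist (su_src g) (su_src h) < r.
Proof.
move=> r0; pose U := [set h | mdist (su_rng g) (su_rng h) < r /\
  mdist (su_src g) (su_src h) < r].
suff oU : su_open U.
  by apply: (@open_nbhs_nbhs (su_arr S) g U); split=> //; split; rewrite mdistxx.
apply: indlim_open_near => pq n w Ew [h [h1 h2]] hw.
have wE : su_ends h = w.
  by rewrite /su_ends /su_rng /su_src hw /=; case: (w).
have : \forall v \near w, mdist (su_rng g) v.1 < r /\ mdist (su_src g) v.2 < r.
  rewrite -wE; apply: filterI.
    exact: near_mdist_lt (cvg_cst _) cvg_fst h1.
  exact: near_mdist_lt (cvg_cst _) cvg_snd h2.
apply: filterS => v Hv Ev.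
by exists (exist _ (su_emb pq v) (mem_set (su_embP Ev))).
Qed.

Section expansive.
Variable d : R.
Hypothesis d_le : d <= e0.
Hypothesis exp_s : forall a c : S,
  (forall k, mdist (iter k phi a) (iter k phi c) < d) -> br c a = c.
Hypothesis exp_u : forall a c : S,
  (forall k, mdist (iter k phiV a) (iter k phiV c) < d) -> br a c = c.

Lemma expansive (a c : S) : (forall k : int, mdist (phiz k a) (phiz k c) < d) ->
  a = c.
Proof.
move=> H; rewrite -(exp_s (a := a) (c := c)); last by move=> k; exact: (H k%:Z).
apply/esym/exp_u => k; have := H (- k%:Z).
by rewrite /phiz !iterzN metric_sym.
Qed.

(** Converse to [su_piece_close] at the same level: by the two halves of expansiveness, staying
    within d from time N on forces the bracket equations at time N. *)
Lemma su_close_piece pq N w : su_close pq N d w -> su_piece pq N w.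
Proof.
case: pq w => p q [x y] H; split; [apply/GsE|apply/GuE] => /=.
  split; last first.
    have [+ _] := H N (lexx _); rewrite /= phizD => h.
    by apply: lt_le_trans d_le.
  apply: exp_s => k; rewrite -!iterD.
  have [|+ _] := H (k + N)%N%:Z; first by rewrite lez_nat leq_addl.
  by rewrite /= phizD.
split; last first.
  have [_] := H N (lexx _); rewrite /= [q - _]addrC phizD /phiz !iterzN => h.
  by apply: lt_le_trans d_le.
apply: exp_u => k; rewrite -!iterD.
have [|_] := H (k + N)%N%:Z; first by rewrite lez_nat leq_addl.
by rewrite /= [q - _]addrC phizD /phiz !iterzN.
Qed.

(** All arrows satisfying [su_close] at N lie in the single piece of level N, where the topology is
    relative to the product, so small displacements of both ends suffice. Continuity proofs reduce
    to fixing such a level. *)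
Lemma nbhs_su_close g N V : nbhs g V -> su_close (su_deg g) N d (su_ends g) ->
  exists2 r : R, 0 < r & forall h, su_deg h = su_deg g ->
    su_close (su_deg g) N d (su_ends h) ->
    mdist (su_rng g) (su_rng h) < r -> mdist (su_src g) (su_src h) < r -> V h.
Proof.
rewrite nbhsE => -[U [oU Ug] UV] gN.
have {oU} : su_open U := oU.
move=> /(_ (su_deg g) N)[P oP EP].
have mem h : su_deg h = su_deg g -> su_close (su_deg g) N d (su_ends h) ->
    P (su_ends h) <-> U h.
  move=> hg hN; have hE := su_close_piece hN.
  have hv : su_emb (su_deg g) (su_ends h) = set_val h.
    rewrite -hg /su_emb /su_deg /su_ends /su_rng /su_src /su_sdeg /su_udeg /=.
    by case: (set_val h) => [[[? ?] ?] ?].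
  split=> [Ph|Uh].
    have : (su_piece (su_deg g) N `&` P) (su_ends h) by [].
    by rewrite -EP => -[_ [h' Uh' /= ]]; rewrite hv => /val_inj <-.
  suff : (su_piece (su_deg g) N `&` P) (su_ends h) by case.
  by rewrite -EP; split => //; exists h.
have Pg : P (su_ends g) by apply/mem.
have [[A B]/= [gA gB] AB] := open_nbhs_nbhs (conj oP Pg).
have /nbhs_ballP[r1 /= r10 Ar] := gA; have /nbhs_ballP[r2 /= r20 Br] := gB.
exists (Num.min r1 r2); first by rewrite lt_min r10.
move=> h hg hN; rewrite !lt_min => /andP[h1 _] /andP[_ h2].
apply: UV; apply/mem => //; apply: AB; split => /=.
  by apply: Ar; rewrite ballEmdist.
by apply: Br; rewrite ballEmdist.
Qed.

End expansive.

End su_topology.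

(** * Continuity, local sections and bump functions *)

Section su_etale.
Context (R : realType) (S : smale_space R).
Local Notation phi := (@phi R S).
Local Notation phiV := (@phiV R S).
Local Notation br := (@bracket R S).
Local Notation e0 := (eps0 S).
Local Notation su := (su_groupoid S).
Implicit Types (pq : int * int) (w : S * S) (g a b : su_arr S).
Variable d : R.
Hypothesis d_gt0 : 0 < d.
Hypothesis d_le : d <= e0.
Hypothesis exp_s : forall a c : S,
  (forall k, mdist (iter k phi a) (iter k phi c) < d) -> br c a = c.
Hypothesis exp_u : forall a c : S,
  (forall k, mdist (iter k phiV a) (iter k phiV c) < d) -> br a c = c.

Let nbhs_close := nbhs_su_close d_le exp_s exp_u.
Let d2_gt0 : 0 < d / 2. Proof. by rewrite divr_gt0. Qed.
Let d2_lt : d / 2 < d. Proof. by rewrite ltr_pdivrMr// ltr_pMr// ltr1n. Qed.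

Lemma near_su g N (r s : R) : 0 < s -> 0 < r ->
  su_close (su_deg g) N s (su_ends g) -> \forall h \near g,
  [/\ su_deg h = su_deg g, su_close (su_deg g) N s (su_ends h),
    mdist (su_rng g) (su_rng h) < r & mdist (su_src g) (su_src h) < r].
Proof.
move=> s0 r0 gN.
by apply: filterS2 (near_su_close s0 gN) (near_su_ends g r0) => h [? ?] [].
Qed.

Lemma su_eqP g h : su_deg g = su_deg h -> su_ends g = su_ends h -> g = h.
Proof. by move=> [p q] [x y]; exact: su_eq. Qed.

Lemma mdist_small_eq (x y : S) : (forall r : R, 0 < r -> mdist x y < r) -> x = y.
Proof.
move=> H; apply/eqP; rewrite -[_ == _]negbK -mdist_gt0; apply/negP => xy.
by have := H _ xy; rewrite ltxx.
Qed.

Lemma su_hausdorff : hausdorff_space (su_arr S).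
Proof.
move=> g h gh.
have ends (r : R) : 0 < r -> mdist (su_rng g) (su_rng h) < r /\
    mdist (su_src g) (su_src h) < r.
  move=> r0; have r20 : 0 < r / 2 by rewrite divr_gt0.
  have [k [[g1 g2] [h1 h2]]] := gh _ _ (near_su_ends g r20) (near_su_ends h r20).
  split.
    apply: le_lt_trans (metric_triangle _ (su_rng k) _) _.
    by rewrite [ltRHS]splitr (metric_sym (su_rng k)) ltrD.
  apply: le_lt_trans (metric_triangle _ (su_src k) _) _.
  by rewrite [ltRHS]splitr (metric_sym (su_src k)) ltrD.
apply: su_eqP.
  by have [k [-> ->]] := gh _ _ (near_su_deg g) (near_su_deg h).
by congr pair; apply: mdist_small_eq => r /ends[].
Qed.

Lemma su_inv_continuous : continuous (fun g : arr su => inv g).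
Proof.
move=> g V gV; change (\forall h \near g, V (su_inv h)).
have [N gN] := su_ex_close g d_gt0.
(* Inversion evaluates the old inequalities at the times k - p and k + q, both at least N once k is
   at least M. *)
pose M := (N + `|su_sdeg g| + `|su_udeg g|)%N.
have NM (h : su_arr S) : su_deg h = su_deg g -> su_close (su_deg g) N d (su_ends h) ->
    su_close (su_deg (su_inv g)) M d (su_ends (su_inv h)).
  move=> [hp hq] hN k Mk /=.
  have p0 := leq0n `|su_sdeg g|; have q0 := leq0n `|su_udeg g|.
  have [|h1 _] := hN (k - su_sdeg g); first by rewrite /M in Mk; lia.
  have [|_ h2] := hN (k + su_udeg g); first by rewrite /M in Mk; lia.
  rewrite /= in h1 h2; split.
    by move: h1; rewrite subrK metric_sym.
  by move: h2; rewrite opprD addrCA subrr addr0 metric_sym [- k - _]addrC.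
have [r r0 Hr] := nbhs_close gV (NM g erefl gN).
apply: filterS (near_su d_gt0 r0 gN) => h [hg hN h1 h2]; apply: Hr => //.
  by case: hg => hp hq; rewrite /su_deg /su_inv /su_sdeg /su_udeg /=; congr (- _, - _).
exact: NM.
Qed.

Lemma su_mul_near a b : su_src a = su_rng b -> forall V, nbhs (su_mul a b) V ->
  \forall w \near (a, b), su_src w.1 = su_rng w.2 -> V (su_mul w.1 w.2).
Proof.
move=> ab V abV.
have [N aN] := su_ex_close a d2_gt0; have [M bM] := su_ex_close b d2_gt0.
(* The first factor is used at the times k + p and k - q, for p and q the degrees of [b]; each
   factor accounts for d / 2 in the triangle inequality. *)
pose K := (maxn N M + `|su_sdeg b| + `|su_udeg b|)%N.
have NM a' b' : su_src a' = su_rng b' ->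
    su_deg a' = su_deg a -> su_close (su_deg a) N (d / 2) (su_ends a') ->
    su_deg b' = su_deg b -> su_close (su_deg b) M (d / 2) (su_ends b') ->
    su_deg (su_mul a' b') = su_deg (su_mul a b) /\
    su_close (su_deg (su_mul a b)) K d (su_ends (su_mul a' b')).
  move=> ab' [ap aq] aN' [bp bq] bM'; split.
    by rewrite /su_deg !su_sdegM ?su_udegM// ap aq bp bq.
  rewrite /su_deg su_sdegM// su_udegM// /su_ends su_rngM// su_srcM//.
  move=> k Kk /=; rewrite /K in Kk.
  have [|_ h2'] := bM' k; first by lia.
  have [|h1' _] := bM' k; first by lia.
  have [|h1 _] := aN' (k + su_sdeg b); first by lia.
  have [|_ h2] := aN' (k - su_udeg b); first by lia.
  rewrite /= in h1 h2 h1' h2'; split.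
    apply: le_lt_trans (metric_triangle _ (phiz (k + su_sdeg b) (su_src a')) _) _.
    rewrite [ltRHS]splitr ltrD//; last by rewrite ab'.
    by rewrite [su_sdeg a + _]addrC addrA.
  apply: le_lt_trans (metric_triangle _ (phiz (su_udeg b - k) (su_src a')) _) _.
  rewrite [ltRHS]splitr ltrD//; last by rewrite ab'.
  by move: h2; rewrite opprB addrA addrAC -addrA.
have [abd abN] := NM a b ab erefl aN erefl bM.
have [r r0 Hr] := nbhs_close abV abN.
eexists (_, _); first by split;
  [exact: near_su d2_gt0 r0 aN|exact: near_su d2_gt0 r0 bM].
move=> [a' b'] /= [[ad aN' a1 _] [bd bM' _ b2]] ab'.
have [h1 h2] := NM a' b' ab' ad aN' bd bM'.
by apply: Hr => //; rewrite ?su_rngM ?su_srcM.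
Qed.

Lemma su_sep a b : su_rng a <> su_rng b ->
  \forall w \near (a, b), su_rng w.1 <> su_rng w.2.
Proof.
move=> /eqP; rewrite -mdist_gt0 => ab; pose r := mdist (su_rng a) (su_rng b) / 2.
have r0 : 0 < r by rewrite divr_gt0.
eexists (_, _); first by split; [exact: near_su_ends r0|exact: near_su_ends r0].
move=> [a' b'] /= [[ha _] [hb _]] ab'.
have := metric_triangle (su_rng a) (su_rng a') (su_rng b).
rewrite {2}ab' (metric_sym (su_rng b')) => h.
by have := le_lt_trans h (ltrD ha hb); rewrite -splitr ltxx.
Qed.

(** Two arrows near [a] with the same range have sources whose orbits stay within d: through the
    common range at large times, through [su_src a] by continuity at the others. Expansiveness
    identifies them. *)
Lemma su_inj a : exists2 V, nbhs a V &
  forall b c, V b -> V c -> su_rng b = su_rng c -> b = c.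
Proof.
have [N aN] := su_ex_close a d2_gt0.
(* The ordinals below N + N index the times from -N to N - 1. *)
have near1 : \forall y \near su_src a, forall k : 'I_(N + N),
    mdist (phiz (k%:Z - N%:Z) (su_src a)) (phiz (k%:Z - N%:Z) y) < d / 2.
  apply: (@filter_forall _ _ (fun (k : 'I_(N + N)) y =>
    mdist (phiz (k%:Z - N%:Z) (su_src a)) (phiz (k%:Z - N%:Z) y) < d / 2)
    (nbhs (su_src a)) (nbhs_filter _)) => k.
  exact: metricType_numDomainType.cvgr_dist_lt (@phiz_continuous R S _ _) _ d2_gt0.
have /nbhs_ballP[r /= r0 Hr] := near1.
eexists; first exact: near_su d2_gt0 r0 aN.
move=> b c [bd bN _ ab] [cd cN _ ac] bc.
apply: su_eqP; first by rewrite bd cd.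
congr pair; first exact: bc.
apply: (expansive exp_s exp_u) => k.
have tri (u v z : S) : mdist u v < d / 2 -> mdist u z < d / 2 -> mdist v z < d.
  move=> uv uz; apply: le_lt_trans (metric_triangle _ u _) _.
  by rewrite [ltRHS]splitr (metric_sym v) ltrD.
have [Nk|kN] := leP N%:Z k.
  have [h1 _] := bN k Nk; have [h2 _] := cN k Nk.
  by move: h1 h2; rewrite /= bc; exact: tri.
have [Nk|Nk] := leP N%:Z (- k).
  have [_ h1] := bN (- k) Nk; have [_ h2] := cN (- k) Nk.
  by move: h1 h2; rewrite /= bc opprK; exact: tri.
have kk : (absz (k + N%:Z)%R < N + N)%N by move: kN Nk; clear; lia.
have kE : (absz (k + N%:Z))%:Z - N%:Z = k by move: Nk; clear; lia.
have ball_r z : mdist (su_src a) z < r -> ball (su_src a) r z.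
  by rewrite ballEmdist.
have := Hr _ (ball_r _ ac) (Ordinal kk); have := Hr _ (ball_r _ ab) (Ordinal kk).
rewrite /= kE; exact: tri.
Qed.

Lemma bracket_cvg (T : Type) (F : set_system T) {FF : Filter F}
    (f h : T -> S) (u v : S) : f @ F --> u -> h @ F --> v -> mdist u v < e0 ->
  (fun t => br (f t) (h t)) @ F --> br u v.
Proof.
move=> fu hv uv V uvV.
have : nbhs_subspace ((u, v) : subspace (Delta e0))
    ((fun w => br w.1 w.2) @^-1` V).
  exact: (@bracket_continuous R S (u, v) _ uvV).
rewrite -nbhs_subspace_in// => -[[A B]/= [uA vB] AB].
have n1 : \forall t \near F, A (f t) := fu _ uA.
have n2 : \forall t \near F, B (h t) := hv _ vB.
have n3 : \forall t \near F, mdist (f t) (h t) < e0.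
  exact: near_mdist_lt fu hv uv.
change (\forall t \near F, V (br (f t) (h t))).
apply: filterS2 n3 (filterI n1 n2) => t t3 [t1 t2].
exact: (AB (f t, h t)).
Qed.

(* The arrow over [x'] near [a = (x, p, q, y)] ends at [[y2, y1]], where
   [y1 = phi^-n [phi^n y, phi^(n+p) x']] is stably equivalent to [phi^p x'] and
   [y2 = phi^n [phi^(q-n) x', phi^-n y]] is unstably equivalent to [phi^q x']. *)
Lemma su_open_rng a V : nbhs a V -> \forall x' \near su_rng a,
  exists2 a' : su_arr S, V a' & su_rng a' = x'.
Proof.
move=> aV; have [c [C1 C2]] := @contraction_const R S _ d2_gt0.
(* The brackets below are formed at a level n where the ends of [a] already lie on common local
   stable and unstable sets. *)
have [n aE] : exists n, su_piece (su_deg a) n (su_ends a).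
  have [N aN] := su_ex_close a d_gt0.
  by exists N; exact: su_close_piece d_le exp_s exp_u _ _ _ aN.
pose x := su_rng a; pose y := su_src a; pose p := su_sdeg a; pose q := su_udeg a.
have [/GsE[s1 s2] /GuE[u1 u2]] := aE.
rewrite -/x -/y /= -/p -/q in s1 s2 u1 u2.
pose N := (n + c)%N.
have aN : su_close (su_deg a) N d (su_ends a).
  move=> k Nk; rewrite /= -/x -/y -/p -/q.
  have [j jc ->] := int_ge_nat Nk.
  split.
    rewrite phizD -[phiz (j + n)%:Z _]/(iter (j + n) phi _).
    rewrite -[phiz (j + n)%:Z y]/(iter (j + n) phi y) !iterD.
    by apply: lt_trans d2_lt; exact: C1.
  rewrite [q - _]addrC phizD /phiz !iterzN !iterD.
  by apply: lt_trans d2_lt; exact: C2.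
have [r r0 Hr] := nbhs_close aV aN.
pose X (x' : S) := iter n phi (phiz p x').
pose Z (x' : S) := iter n phiV (phiz q x').
pose v1 (x' : S) := br (iter n phi y) (X x').
pose v2 (x' : S) := br (Z x') (iter n phiV y).
pose y1 x' := iter n phiV (v1 x'); pose y2 x' := iter n phi (v2 x').
pose y' x' := br (y2 x') (y1 x').
have iterK m : cancel (iter m phi) (iter m phiV).
  by move=> z; elim: m => //= m IH; rewrite -iterS iterSr phiK.
have iterVK m : cancel (iter m phiV) (iter m phi).
  by move=> z; elim: m => //= m IH; rewrite -iterS iterSr phiVK.
have ci m : continuous (iter m phi : S -> S) := @phiz_continuous R S m%:Z.
have ciV m : continuous (iter m phiV : S -> S).
  move=> z; have := @phiz_continuous R S (- m%:Z) z; rewrite /phiz.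
  by have -> : iterz phi phiV (- m%:Z) = iter m phiV
    by apply/funext => t; exact: iterzN.
have cX : X @ x --> X x.
  by apply: cvg_comp (@phiz_continuous R S p x) _; exact: ci.
have cZ : Z @ x --> Z x.
  by apply: cvg_comp (@phiz_continuous R S q x) _; exact: ciV.
have cv1 : v1 @ x --> iter n phi y.
  rewrite -[X in _ --> X]s1; apply: bracket_cvg => //; first exact: cvg_cst.
  by rewrite metric_sym.
have cv2 : v2 @ x --> iter n phiV y.
  by rewrite -[X in _ --> X]u1; apply: bracket_cvg => //; exact: cvg_cst.
have cy1 : y1 @ x --> y.
  by rewrite -[X in _ --> X](iterK n); apply: cvg_comp cv1 _; exact: ciV.
have cy2 : y2 @ x --> y.
  by rewrite -[X in _ --> X](iterVK n); apply: cvg_comp cv2 _; exact: ci.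
have cy' : y' @ x --> y.
  rewrite -[X in _ --> X](@bracketxx R S); apply: bracket_cvg => //.
  by rewrite mdistxx eps0_gt0.
have yy : mdist y y < e0 by rewrite mdistxx eps0_gt0.
have n1 : \forall x' \near x, mdist (iter n phi y) (X x') < e0.
  by apply: near_mdist_lt (cvg_cst _) cX _; rewrite metric_sym.
have n2 : \forall x' \near x, mdist (v1 x') (X x') < e0.
  by apply: near_mdist_lt cv1 cX _; rewrite metric_sym.
have n3 : \forall x' \near x, mdist (Z x') (iter n phiV y) < e0.
  by apply: near_mdist_lt cZ (cvg_cst _) _.
have n4 : \forall x' \near x, mdist (Z x') (v2 x') < e0.
  by apply: near_mdist_lt cZ cv2 _.
have n5 : \forall x' \near x, mdist (y2 x') (y1 x') < e0.
  exact: near_mdist_lt cy2 cy1 yy.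
have n6 : \forall x' \near x, mdist (y' x') (y1 x') < e0.
  exact: near_mdist_lt cy' cy1 yy.
have n7 : \forall x' \near x, mdist (y2 x') (y' x') < e0.
  exact: near_mdist_lt cy2 cy' yy.
have n8 : \forall x' \near x, mdist y (y' x') < r.
  exact: metricType_numDomainType.cvgr_dist_lt cy' _ r0.
have n9 : \forall x' \near x, mdist x x' < r.
  by apply/nbhs_ballP; exists r => // t; rewrite ballEmdist.
apply: filterS2 (filterI (filterI n1 n2) (filterI n3 n4))
  (filterI (filterI n5 n6) (filterI n7 (filterI n8 n9))) => x' [[h1 h2] [h3 h4]] [[h5 h6] [h7 [h8 h9]]].
have i1 : br (v1 x') (X x') = v1 x' by exact: bracket_idl.
have i2 : br (Z x') (v2 x') = v2 x' by exact: bracket_idr.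
have i3 : br (y' x') (y1 x') = y' x' by exact: bracket_idl.
have i4 : br (y2 x') (y' x') = y' x' by exact: bracket_idr.
(* Forward distances are compared through [y1 x'], on whose stable set [y' x'] lies, and backward
   ones through [y2 x'], on whose unstable set it lies. *)
have cl : su_close (su_deg a) N d (x', y' x').
  move=> k Nk /=; rewrite -/p -/q.
  have [j jc ->] := int_ge_nat Nk.
  have jnc : (c <= j + n)%N by exact: leq_trans (leq_addr _ _).
  split.
    rewrite phizD -[phiz (j + n)%:Z _]/(iter (j + n) phi _).
    rewrite -[phiz (j + n)%:Z (y' x')]/(iter (j + n) phi (y' x')).
    apply: le_lt_trans (metric_triangle _ (iter (j + n) phi (y1 x')) _) _.
    rewrite [ltRHS]splitr ltrD//; last first.
      by apply: C1 => //; rewrite metric_sym.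
    rewrite !iterD iterVK; apply: C1 => //; by rewrite metric_sym.
  rewrite [q - _]addrC phizD /phiz !iterzN.
  apply: le_lt_trans (metric_triangle _ (iter (j + n) phiV (y2 x')) _) _.
  rewrite [ltRHS]splitr ltrD//; last exact: C2.
  by rewrite !iterD iterK; exact: C2.
have := su_embP (su_close_piece d_le exp_s exp_u cl) => mem.
exists (exist _ (su_emb (su_deg a) (x', y' x')) (mem_set mem)) => //.
exact: Hr.
Qed.

Lemma near_mdist_gt (T : Type) (F : set_system T) {FF : Filter F}
    (f h : T -> S) (u v : S) (r : R) : f @ F --> u -> h @ F --> v ->
  r < mdist u v -> \forall t \near F, r < mdist (f t) (h t).
Proof.
move=> fu hv uvr; pose s := (mdist u v - r) / 2.
have s0 : 0 < s by rewrite divr_gt0// subr_gt0.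
have fs : \forall t \near F, mdist u (f t) < s.
  exact: metricType_numDomainType.cvgr_dist_lt fu _ s0.
have hs : \forall t \near F, mdist v (h t) < s.
  exact: metricType_numDomainType.cvgr_dist_lt hv _ s0.
apply: filterS2 fs hs => t ft ht.
have h1 := metric_triangle u (f t) v; have h2 := metric_triangle (f t) (h t) v.
by rewrite (metric_sym (h t)) in h2; rewrite /s in ft ht; lra.
Qed.

Lemma closed_mdist_le (f h : S * S -> S) (r : R) : continuous f ->
  continuous h -> closed [set w | mdist (f w) (h w) <= r].
Proof.
move=> cf ch; rewrite -openC openE => w /= /negP; rewrite -ltNge => rw.
apply: filterS (near_mdist_gt (cf w) (ch w) rw) => v rv.
by apply/negP; rewrite -ltNge.
Qed.

(** A closed version of [su_close]: the bound d / 2 leaves room to stay inside the open conditions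
    with d, hence in the piece of level N. *)
Definition su_box a N (r : R) : set (su_arr S) := [set g | [/\
  su_deg g = su_deg a,
  forall k : int, N%:Z <= k ->
    mdist (phiz (k + su_sdeg a) (su_rng g)) (phiz k (su_src g)) <= d / 2 /\
    mdist (phiz (su_udeg a - k) (su_rng g)) (phiz (- k) (su_src g)) <= d / 2,
  mdist (su_rng a) (su_rng g) <= r & mdist (su_src a) (su_src g) <= r]].

(** The box is the image of a closed subset of the compact product under the chart of one piece,
    which is continuous there by [nbhs_su_close]. *)
Lemma su_compact a N (r : R) : compact (su_box a N r).
Proof.
pose p := su_sdeg a; pose q := su_udeg a.
pose Kc : set (S * S) := \bigcap_(k in [set k : int | N%:Z <= k])
    ([set w | mdist (phiz (k + p) w.1) (phiz k w.2) <= d / 2] `&`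
     [set w | mdist (phiz (q - k) w.1) (phiz (- k) w.2) <= d / 2]) `&`
  ([set w | mdist (su_rng a) w.1 <= r] `&` [set w | mdist (su_src a) w.2 <= r]).
have c1 m : continuous (fun w : S * S => phiz m w.1).
  by move=> w; apply: continuous_comp; [exact: cvg_fst|exact: phiz_continuous].
have c2 m : continuous (fun w : S * S => phiz m w.2).
  by move=> w; apply: continuous_comp; [exact: cvg_snd|exact: phiz_continuous].
have clKc : closed Kc.
  apply: closedI.
    by apply: closed_bigI => k _; apply: closedI; exact: closed_mdist_le.
  apply: closedI; apply: closed_mdist_le; try (by move=> w; exact: cvg_cst).
    by move=> w; exact: cvg_fst.
  by move=> w; exact: cvg_snd.
have cKc : compact Kc.
  have -> : Kc = ([set: S] `*` [set: S]) `&` Kc.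
    by apply/seteqP; split=> w //= [].
  by apply: compact_closedI => //; apply: compact_setX; exact: space_compact.
have Kcl w : Kc w -> su_close (su_deg a) N d w.
  move=> [Kw _] k Nk; have [h1 h2] := Kw k Nk.
  by split; [exact: le_lt_trans h1 d2_lt|exact: le_lt_trans h2 d2_lt].
pose e w : su_arr S := insubd (a : set_type (su_set (S := S)))
  (su_emb (su_deg a) w).
have eE w : Kc w -> set_val (e w) = su_emb (su_deg a) w.
  move=> /Kcl /(su_close_piece d_le exp_s exp_u)/su_embP mem.
  by apply: insubdK; exact: mem_set.
have edeg w : Kc w -> su_deg (e w) = su_deg a.
  by move=> /eE E; rewrite /su_deg /su_sdeg /su_udeg E.
have eends w : Kc w -> su_ends (e w) = w.
  by move=> /eE E; rewrite /su_ends /su_rng /su_src E /= -surjective_pairing.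
have -> : su_box a N r = e @` Kc.
  apply/seteqP; split=> [g [gd gN g1 g2]|_ [w Kw <-]].
    have Kg : Kc (su_ends g) by split; [move=> k; exact: gN|split].
    by exists (su_ends g) => //; apply: su_eqP; rewrite ?edeg ?eends.
  have [w1 w2] : su_rng (e w) = w.1 /\ su_src (e w) = w.2.
    by have := eends w Kw; rewrite /su_ends; case: (w) => ? ? [].
  have [Kw1 [Kw2 Kw3]] := Kw.
  split; [exact: edeg|move=> k Nk; rewrite w1 w2; exact: Kw1 k Nk|
    by rewrite w1|by rewrite w2].
apply: continuous_compact => //; apply/subspace_continuousP => w Kw V wV.
have wN : su_close (su_deg (e w)) N d (su_ends (e w)).
  by rewrite edeg// eends//; exact: Kcl.
have [s s0 Hs] := nbhs_close wV wN.
have [w1 w2] : su_rng (e w) = w.1 /\ su_src (e w) = w.2.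
  by have := eends w Kw; rewrite /su_ends; case: (w) => ? ? [].
have n1 : \forall v \near w, mdist w.1 v.1 < s.
  exact: metricType_numDomainType.cvgr_dist_lt cvg_fst _ s0.
have n2 : \forall v \near w, mdist w.2 v.2 < s.
  exact: metricType_numDomainType.cvgr_dist_lt cvg_snd _ s0.
apply: filterS2 n1 n2 => v v1 v2 Kv.
have [z1 z2] : su_rng (e v) = v.1 /\ su_src (e v) = v.2.
  by have := eends v Kv; rewrite /su_ends; case: (v) => ? ? [].
apply: Hs; rewrite ?edeg ?eends ?w1 ?w2 ?z1 ?z2//.
exact: Kcl.
Qed.

Lemma cvg_normc (T : topologicalType) (f : T -> R[i]^o) (t : T) :
  (forall e : R, 0 < e -> \forall s \near t,
     ComplexField.Normc.normc (f t - f s) < e) -> f @ t --> f t.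
Proof.
move=> H; apply/cvgrPdist_lt => eps; rewrite ltcE /= => /andP[/eqP eI eR].
apply: filterS (H _ eR) => s hs.
suff : (ComplexField.Normc.normc (f t - f s))%:C%C < eps.
  by case: (f t - f s).
by rewrite ltcE /= eI eqxx.
Qed.

(** A tent function of the distance between ranges, cut off outside a compact box [K] on which [rng]
    is injective. Where the tent is positive, an arrow of [K] is interior to [K], so the cut-off
    creates no jump. *)
Lemma su_bump a V : nbhs a V -> exists chi : su_arr S -> R[i]^o,
  [/\ @Cc R su chi, chi a = 1, forall b, chi b != 0 -> V b &
    forall b, ComplexField.Normc.normc (chi b) <= 1].
Proof.
move=> aV; have [I aI HI] := su_inj a.
have [N aN] := su_ex_close a d2_gt0.
have [r r0 Hr] := nbhs_close (filterI aV aI) (su_close_le (leqnn N) (ltW d2_lt) aN).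
have r20 : 0 < r / 2 by rewrite divr_gt0.
have r2r : r / 2 < r by rewrite ltr_pdivrMr// ltr_pMr// ltr1n.
pose K := su_box a N (r / 2); have Kc : compact K by exact: su_compact.
have Kcl : closed K by exact: compact_closed su_hausdorff Kc.
have KVI g : K g -> V g /\ I g.
  move=> [gd gN g1 g2]; apply: Hr => //; first last.
  - exact: le_lt_trans r2r.
  - exact: le_lt_trans r2r.
  move=> k Nk; have [h1 h2] := gN k Nk.
  by split; [exact: le_lt_trans h1 d2_lt|exact: le_lt_trans h2 d2_lt].
have aK : nbhs a K.
  apply: filterS (near_su d2_gt0 r20 aN) => g [gd gN g1 g2].
  split; rewrite ?ltW// => k Nk; have [h1 h2] := gN k Nk.
  by split; exact: ltW.
(* Openness of the range map: every object within [rho] of the range of [a] is the range of an arrow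
   in the interior of [K]. *)
have /su_open_rng/nbhs_ballP[rho /= rho0 Hrho] : nbhs a K° by exact: nbhs_interior.
pose F g := Num.max 0 (1 - mdist (su_rng a) (su_rng g) / rho).
have F0 g : 0 <= F g by rewrite le_max lexx.
have F1 g : F g <= 1.
  by rewrite ge_max ler01 lerBlDr lerDl divr_ge0 ?mdist_ge0 ?ltW.
have Flip g h : F h <= F g + mdist (su_rng g) (su_rng h) / rho.
  have t0 : 0 <= mdist (su_rng g) (su_rng h) / rho.
    by rewrite divr_ge0 ?mdist_ge0 ?ltW.
  rewrite {1}/F ge_max addr_ge0//=.
  apply: (@le_trans _ _ (1 - mdist (su_rng a) (su_rng g) / rho +
      mdist (su_rng g) (su_rng h) / rho)).
    have := metric_triangle (su_rng a) (su_rng h) (su_rng g).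
    rewrite (metric_sym (su_rng h)) -(ler_pM2r (_ : 0 < rho^-1)) ?invr_gt0//.
    by rewrite mulrDl; lra.
  by rewrite lerD2r /F le_max lexx orbT.
have nF g (e : R) : 0 < e -> \forall h \near g, `|F g - F h| < e.
  move=> e0; have er : 0 < e * rho by rewrite mulr_gt0.
  apply: filterS (near_su_ends g er) => h [gh _].
  rewrite -ltr_pdivrMr// in gh; apply: le_lt_trans gh.
  have := Flip g h; have := Flip h g; rewrite (metric_sym (su_rng h)).
  by rewrite ler_norml; lra.
pose chi g : R[i]^o := if `[< K g >] then (F g)%:C%C else 0.
have chiK g : K g -> chi g = (F g)%:C%C by rewrite /chi => /asboolT ->.
have chiN g : ~ K g -> chi g = 0 by rewrite /chi => /asboolF ->.
have chi_neq0 g : chi g != 0 -> K g.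
  by move=> cg; apply: contrapT => /chiN c0; rewrite c0 eqxx in cg.
exists chi; split.
- split; last first.
    apply: subclosed_compact Kc _; first exact: closed_closure.
    rewrite [X in _ `<=` X](closure_id K).1//; apply: closureS.
    exact: chi_neq0.
  move=> g; apply: cvg_normc => e e0.
  have [Kg|nK] := pselect (K g); last first.
    have oK : open (~` K) by exact: closed_openC.
    apply: filterS (open_nbhs_nbhs (conj oK nK)) => h nKh.
    by rewrite !chiN// subr0 normc0.
  have Fn h : ComplexField.Normc.normc ((F g)%:C%C - (F h)%:C%C : R[i]^o) =
      `|F g - F h|.
    by rewrite -normc_real rmorphB.
  have [Fg0|Fg0] := eqVneq (F g) 0.
    apply: filterS (nF g e e0) => h; rewrite (chiK g)// -Fn.
    have [Kh|nKh] := pselect (K h); first by rewrite chiK.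
    by rewrite chiN// Fg0 subrr normc0.
  have gr : mdist (su_rng a) (su_rng g) < rho.
    rewrite ltNge; apply: contraNN Fg0 => rg.
    by rewrite /F eq_le F0 andbT ge_max lexx subr_le0 ler_pdivlMr// mul1r.
  have [u uK ug] : exists2 u, K° u & su_rng u = su_rng g.
    by apply: Hrho; rewrite ballEmdist.
  have gu : g = u.
    have [_ gI] := KVI g Kg; have [_ uI] := KVI u (interior_subset uK).
    exact: HI gI uI (esym ug).
  have gK : nbhs g K by rewrite gu.
  apply: filterS2 (nF g e e0) gK => h; rewrite -Fn => hF Kh.
  by rewrite !chiK.
- rewrite chiK; last exact: nbhs_singleton.
  by rewrite /F mdistxx mul0r subr0 max_r.
- by move=> b /chi_neq0/KVI[].
- move=> b; have [Kb|nK] := pselect (K b); last by rewrite chiN// normc0.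
  by rewrite chiK// normc_real ger0_norm.
Qed.

End su_etale.

Lemma su_groupoid_etale (R : realType) (S : smale_space R) :
  etale R (su_groupoid S).
Proof.
have [d [d0 de exp_s exp_u]] := expansive_const S; split.
- exact: su_hausdorff.
- exact: su_inv_continuous d0 de exp_s exp_u.
- exact: su_mul_near d0 de exp_s exp_u.
- move=> a V aV b /= ba.
  have := su_open_rng d0 de exp_s exp_u aV; rewrite -ba => /nbhs_ballP[r /= r0 Hr].
  apply: filterS (near_su_ends b r0) => b' [h _].
  by have [|a' Va ab] := Hr (su_rng b'); [rewrite ballEmdist|exists a'].
- exact: su_sep.
- exact: su_inj d0 exp_s exp_u.
- exact: su_bump d0 de exp_s exp_u.
Qed.

(** * The asymptotic groupoid inside the stable and unstable one *)

Section asym_embedding.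
Context (R : realType) (S : smale_space R).
Local Notation asym := (asym_groupoid S).
Local Notation su := (su_groupoid S).

Definition su_of_asym (h : asym_arr S) : su_arr S :=
  su_mk ((Ga_allE _).1 (asymP h)).

Definition su_ddeg (g : su_arr S) : int := su_sdeg g - su_udeg g.

(* Junk value [asym_unit] unless [su_ddeg g = 0]. *)
Definition asym_of_su (g : su_arr S) : asym_arr S :=
  insubd (asym_unit (su_rng g) : set_type (asym_set (S := S)))
    (su_rng g, su_sdeg g, su_src g).

Lemma su_ddegM (a b : su_arr S) : su_src a = su_rng b ->
  su_ddeg (su_mul a b) = su_ddeg a + su_ddeg b.
Proof. by move=> ab; rewrite /su_ddeg su_sdegM// su_udegM//; ring. Qed.

Lemma near_su_ddeg (a : su_arr S) : \forall b \near a, su_ddeg b = su_ddeg a.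
Proof. by apply: filterS (near_su_deg a) => b [p q]; rewrite /su_ddeg p q. Qed.

Lemma su_ddeg_asym h : su_ddeg (su_of_asym h) = 0.
Proof. exact: subrr. Qed.

Lemma asym_valE (h : asym_arr S) :
  set_val h = (asym_rng h, asym_deg h, asym_src h).
Proof. by rewrite /asym_rng /asym_deg /asym_src; case: (set_val h) => [[]]. Qed.

Lemma su_of_asymK : cancel su_of_asym asym_of_su.
Proof.
move=> h; have hE : set_val (asym_of_su (su_of_asym h)) =
    (asym_rng h, asym_deg h, asym_src h).
  by apply: insubdK; exact/mem_set/asymP.
by apply: val_inj; rewrite [RHS]asym_valE -hE.
Qed.

Lemma asym_of_suK g : su_ddeg g = 0 -> su_of_asym (asym_of_su g) = g.
Proof.
move=> /eqP; rewrite subr_eq0 => /eqP pq.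
have gE : set_val (asym_of_su g) = (su_rng g, su_sdeg g, su_src g).
  apply: insubdK; apply/mem_set/Ga_allE.
  by have [sg ug] := suP g; rewrite -pq in ug.
apply: su_eq; rewrite /su_rng /su_sdeg /su_udeg /su_src /=;
  by rewrite /asym_rng /asym_deg /asym_src gE -?pq.
Qed.

Lemma su_of_asym_inj : injective su_of_asym.
Proof. exact: can_inj su_of_asymK. Qed.

Lemma su_of_asymM a b : asym_src a = asym_rng b ->
  su_of_asym (asym_mul a b) = su_mul (su_of_asym a) (su_of_asym b).
Proof.
move=> ab; apply: su_eq.
- by rewrite su_rngM//; exact: asym_rngM.
- by rewrite su_sdegM//; exact: asym_degM.
- by rewrite su_udegM//; exact: asym_degM.
- by rewrite su_srcM//; exact: asym_srcM.
Qed.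

Lemma su_of_asymV a : su_of_asym (asym_inv a) = su_inv (su_of_asym a).
Proof. exact: su_eq. Qed.

(** Shifting by n costs at most |n| levels, because m + |n| + n is at least m and the levels
    increase. *)
Lemma Gs_shift (m : nat) (n : int) (x y : S) :
  Gs S m (x, y) -> Gs S (m + `|n|) (phiz n x, phiz n y).
Proof.
have [k kE] : exists k : nat, (m + `|n|)%N%:Z + n = (m + k)%N%:Z.
  by exists (absz (n + (absz n)%:Z)%R); lia.
move=> /(Gs_le (leq_addr k m))/GsE H; apply/GsE.
have E z : iter (m + `|n|) (@phi R S) (phiz n z) = iter (m + k) (@phi R S) z.
  by rewrite -[LHS]/(phiz (m + `|n|)%N%:Z (phiz n z)) -phizD kE.
by rewrite !E.
Qed.

Lemma Gu_shift (m : nat) (n : int) (x y : S) :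
  Gu S m (x, y) -> Gu S (m + `|n|) (phiz n x, phiz n y).
Proof.
have [k kE] : exists k : nat, - (m + `|n|)%N%:Z + n = - (m + k)%N%:Z.
  by exists (absz ((absz n)%:Z - n)%R); lia.
move=> /(Gu_le (leq_addr k m))/GuE H; apply/GuE.
have E z : iter (m + `|n|) (@phiV R S) (phiz n z) = iter (m + k) (@phiV R S) z.
  by rewrite -!(iterzN (@phi R S)) -/(phiz _ _) -phizD kE.
by rewrite !E.
Qed.

(** The charts differ: the pair (x, w) of the asymptotic piece of degree n becomes (x, phi^n w).
    This change is continuous and raises the level by at most |n|. *)
Lemma su_of_asym_preimage_open (W : set (su_arr S)) : su_open W ->
  asym_open (su_of_asym @^-1` W).
Proof.
move=> oW; apply: indlim_open_near => n m w Ew [h Wh hw].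
have shift v : Ga S m v -> su_piece (n, n) (m + `|n|) (v.1, phiz n v.2).
  by case: v => x y [sv uv]; split; [exact: Gs_shift|exact: Gu_shift].
have [P oP EP] := oW (n, n) (m + `|n|)%N.
have Pw : P (w.1, phiz n w.2).
  suff : (su_piece (n, n) (m + `|n|) `&` P) (w.1, phiz n w.2) by case.
  rewrite -EP; split; first exact: shift.
  exists (su_of_asym h) => //.
  rewrite -[LHS]/(asym_rng h, asym_deg h, asym_deg h, asym_src h).
  by move: hw; rewrite asym_valE => -[-> -> ->].
have cpsi : (fun v : S * S => (v.1, phiz n v.2)) @ w --> (w.1, phiz n w.2).
  apply: cvg_pair; first exact: cvg_fst.
  by apply: cvg_comp cvg_snd _; exact: phiz_continuous.
have nP : \forall v \near w, P (v.1, phiz n v.2).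
  by apply: cpsi; exact: open_nbhs_nbhs.
apply: filterS nP => v Pv Ev.
have : (su_piece (n, n) (m + `|n|) `&` P) (v.1, phiz n v.2).
  by split => //; exact: shift.
rewrite -EP => -[_ [g Wg gv]].
exists (exist _ (asym_emb n v) (mem_set (asym_embP n Ev))) => //.
set h' := exist _ _ _; change (W (su_of_asym h')).
by have <- : g = su_of_asym h' by apply: val_inj; exact: gv.
Qed.

Lemma su_of_asym_image_open (V : set (asym_arr S)) : asym_open V ->
  su_open (su_of_asym @` V).
Proof.
move=> oV; apply: indlim_open_near => -[p q] n w Ew [g [h Vh hg] gw].
(* Only the pieces of equal degrees meet the image. *)
have pq : p = q.
  have := su_ddeg_asym h; rewrite hg /su_ddeg /su_sdeg /su_udeg gw /= => /eqP.
  by rewrite subr_eq0 => /eqP.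
rewrite -pq in Ew gw *.
have shift v : su_piece (p, p) n v -> Ga S (n + `|- p|) (v.1, phiz (- p) v.2).
  case: v => x y [/= sv uv]; rewrite -{1}(phizK p x).
  by split; [exact: Gs_shift|exact: Gu_shift].
have [P oP EP] := oV p (n + `|- p|)%N.
have embE v : asym_emb p (v.1, phiz (- p) v.2) = (v.1, p, v.2).
  by rewrite /asym_emb /= phizNK.
have Pw : P (w.1, phiz (- p) w.2).
  suff : (Ga S (n + `|- p|) `&` P) (w.1, phiz (- p) w.2) by case.
  rewrite -EP; split; first exact: shift.
  exists h => //; rewrite embE.
  move: gw; rewrite -hg /su_of_asym /= /su_emb /= => -[<- <- _ <-].
  by rewrite /asym_rng /asym_deg /asym_src; case: (set_val h) => [[]].
have cpsi : (fun v : S * S => (v.1, phiz (- p) v.2)) @ w -->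
    (w.1, phiz (- p) w.2).
  apply: cvg_pair; first exact: cvg_fst.
  by apply: cvg_comp cvg_snd _; exact: phiz_continuous.
have nP : \forall v \near w, P (v.1, phiz (- p) v.2).
  by apply: cpsi; exact: open_nbhs_nbhs.
apply: filterS nP => v Pv Ev.
have : (Ga S (n + `|- p|) `&` P) (v.1, phiz (- p) v.2).
  by split => //; exact: shift.
rewrite -EP => -[_ [h' Vh' hv]].
exists (su_of_asym h'); first by exists h'.
rewrite -[LHS]/(asym_rng h', asym_deg h', asym_deg h', asym_src h').
by move: hv; rewrite embE asym_valE => -[-> -> ->].
Qed.

Lemma su_of_asym_continuous : continuous (su_of_asym : arr asym -> arr su).
Proof. by apply/continuousP => W oW; exact: su_of_asym_preimage_open. Qed.

Lemma su_of_asym_nbhs (h : arr asym) V : nbhs h V ->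
  nbhs (su_of_asym h : arr su) (su_of_asym @` V).
Proof.
rewrite nbhsE => -[U [oU Uh] UV].
apply: (@filterS _ _ _ (su_of_asym @` U)); first exact: image_subset.
apply: open_nbhs_nbhs; split; first exact: su_of_asym_image_open.
by exists h.
Qed.

Lemma asym_hausdorff : hausdorff_space (arr asym).
Proof.
move=> a b ab; apply: su_of_asym_inj.
apply: (et_hausdorff (su_groupoid_etale S)) => A B aA bB.
have [h [hA hB]] := ab _ _ (su_of_asym_continuous aA) (su_of_asym_continuous bB).
by exists (su_of_asym h).
Qed.

Lemma asym_of_su_continuous :
  {within [set g : arr su | su_ddeg g = 0], continuous (asym_of_su : arr su -> arr asym)}.
Proof.
apply/subspace_continuousP => g g0 V gV.
have := su_of_asym_nbhs gV; rewrite asym_of_suK//.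
apply: filterS => _ [h Vh <-] _.
by change (V (asym_of_su (su_of_asym h))); rewrite su_of_asymK.
Qed.

Lemma closed_su_ddeg0 : closed [set g : arr su | su_ddeg g = 0].
Proof.
rewrite -openC openE => g /= g0.
by apply: filterS (near_su_ddeg g) => h hg; rewrite /setC /= hg.
Qed.

End asym_embedding.

(** * Extension by zero and restriction to the subgroupoid *)

Section extension_restriction.
Context (R : realType) (S : smale_space R).
Local Notation asym := (asym_groupoid S).
Local Notation su := (su_groupoid S).
Local Notation C := (R[i]^o).
Local Notation normc := (@ComplexField.Normc.normc R).
Let Get := su_groupoid_etale S.
Implicit Types (f xi : arr asym -> C) (F eta : arr su -> C).

Definition ext f : arr su -> C :=
  fun g => if su_ddeg g == 0 then f (asym_of_su g) else 0.

Definition res F : arr asym -> C := fun h => F (su_of_asym h).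

Lemma ext_asym f h : ext f (su_of_asym h) = f h.
Proof. by rewrite /ext su_ddeg_asym eqxx su_of_asymK. Qed.

Lemma ext_ddeg f g : su_ddeg g != 0 -> ext f g = 0.
Proof. by rewrite /ext => /negPf ->. Qed.

Lemma ext_neq0 f g : ext f g != 0 -> su_ddeg g = 0.
Proof.
move=> fg; apply/eqP; apply: contraNT fg => /(ext_ddeg f) ->; exact: eqxx.
Qed.

Lemma res_ext f : res (ext f) = f.
Proof. by apply/funext => h; exact: ext_asym. Qed.

Lemma ext_res F : (forall g, F g != 0 -> su_ddeg g = 0) -> ext (res F) = F.
Proof.
move=> F0; apply/funext => g; have [/eqP g0|g0] := boolP (su_ddeg g == 0).
  by rewrite /ext g0 eqxx /res asym_of_suK.
by rewrite ext_ddeg//; apply/esym/eqP; apply: contraNT g0 => /F0 ->.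
Qed.

Lemma extB f f' : ext (f - f') = ext f - ext f'.
Proof.
by apply/funext => g; rewrite /ext !fctE; case: ifP => // _; rewrite subr0.
Qed.

Lemma fibre_bound_res (x : S) F (s : R) :
  @fibre_bound R su x F s -> @fibre_bound R asym x (res F) s.
Proof.
move=> Fs A Ax; have inj : {in A &, injective (@su_of_asym R S)}.
  by move=> a b _ _; exact: su_of_asym_inj.
rewrite /res -(sum_imfset (fun g => normc (F g) ^+ 2) inj).
by apply: Fs => g /imfsetP[h /= hA ->]; exact: Ax.
Qed.

Lemma fibre_bound_ext (x : S) f F (s : R) : @fibre_bound R asym x f s ->
  (forall h, F (su_of_asym h) = f h) ->
  forall A : {fset arr su}, [set` A] `<=` @fibre su x ->
  {in A, forall g, su_ddeg g = 0} -> \sum_(g <- A) normc (F g) ^+ 2 <= s.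
Proof.
move=> fs Ff A Ax A0.
have inj : {in A &, injective (@asym_of_su R S)}.
  by move=> a b aA bA ab; rewrite -(asym_of_suK (A0 a aA)) ab asym_of_suK ?A0.
rewrite (eq_fbigr _ (G := fun g => normc (f (asym_of_su g)) ^+ 2)); last first.
  by move=> g gA _; rewrite -Ff asym_of_suK ?A0.
rewrite -(sum_imfset (fun h => normc (f h) ^+ 2) inj).
apply: fs => h /imfsetP[g /= gA ->]; rewrite /fibre /=.
have /(congr1 (@su_src R S)) := asym_of_suK (A0 g gA).
by rewrite -(Ax g gA : su_src g = x) => <-.
Qed.

Lemma fibre_bound_extE (x : S) f (s : R) :
  @fibre_bound R asym x f s -> @fibre_bound R su x (ext f) s.
Proof.
move=> fs A Ax.
rewrite (big_fsetID _ (fun g => su_ddeg g == 0)) /= [X in _ + X]big1_fset ?addr0.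
  apply: (fibre_bound_ext fs (ext_asym f)).
    by move=> g /= /[!inE] /andP[gA _]; exact: Ax.
  by move=> g /[!inE] /andP[_ /eqP].
by move=> g /[!inE] /andP[_ g0]; rewrite ext_ddeg// normc0 expr0n.
Qed.

Lemma norm2_ext f (s : R) : (norm2 f <= s%:E)%E -> (norm2 (ext f) <= s%:E)%E.
Proof. by move=> /norm2_leP fs; apply/norm2_leP => x; exact/fibre_bound_extE/fs. Qed.

Lemma norm2_res F (s : R) : (norm2 F <= s%:E)%E -> (norm2 (res F) <= s%:E)%E.
Proof. by move=> /norm2_leP Fs; apply/norm2_leP => x; exact/fibre_bound_res/Fs. Qed.

(** Away from degree 0 the extension vanishes locally, since the degree is locally constant; in
    degree 0 continuity transfers because [su_of_asym] is open. *)
Lemma Cc_ext f : Cc f -> Cc (ext f).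
Proof.
move=> [fc fK]; split.
  move=> g; have [/eqP g0|g0] := boolP (su_ddeg g == 0); last first.
    rewrite /continuous_at (ext_ddeg f g0) => V /nbhs_singleton V0.
    apply: filterS (near_su_ddeg g) => h hg.
    by change (V (ext f h)); rewrite ext_ddeg ?hg.
  rewrite -(asym_of_suK g0) /continuous_at ext_asym => V /fc/su_of_asym_nbhs.
  apply: filterS => _ [h Vh <-].
  by change (V (ext f (su_of_asym h))); rewrite ext_asym.
have cK : compact (@su_of_asym R S @` (csupp f : set (arr asym)) : set (arr su)).
  apply: continuous_compact => //; apply: continuous_subspaceT.
  exact: su_of_asym_continuous.
apply: (subclosed_compact _ cK); first exact: closed_closure.
rewrite [X in _ `<=` X](closure_id _).1; last first.
  exact: (compact_closed (et_hausdorff Get)).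
apply: closureS => g /= fg; have g0 := ext_neq0 fg.
exists (asym_of_su g); last exact: asym_of_suK.
by apply: csuppP; move: fg; rewrite /ext g0 eqxx.
Qed.

Lemma Cc_res F : Cc F -> Cc (res F).
Proof.
move=> [Fc FK]; split.
  move=> h; apply: (@continuous_comp _ _ _ (@su_of_asym R S : arr asym -> arr su) F).
    exact: su_of_asym_continuous.
  exact: Fc.
have cK : compact (@asym_of_su R S @`
    ((csupp F : set (arr su)) `&` [set g : arr su | su_ddeg g = 0]) : set (arr asym)).
  apply: continuous_compact.
    apply: continuous_subspaceW (@asym_of_su_continuous R S).
    exact: subIsetr.
  by apply: compact_closedI => //; exact: closed_su_ddeg0.
apply: (subclosed_compact _ cK); first exact: closed_closure.
rewrite [X in _ `<=` X](closure_id _).1; last first.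
  exact: (compact_closed (@asym_hausdorff R S)).
apply: closureS => h /= Fh; exists (su_of_asym h); last exact: su_of_asymK.
by split; [exact: csuppP|exact: su_ddeg_asym].
Qed.

Lemma in_l2_ext xi : xi \in @in_l2 R asym -> ext xi \in @in_l2 R su.
Proof.
move=> /asboolP H; apply/asboolP => e /H[f fC xf].
by exists (ext f); [exact: Cc_ext|rewrite -extB; exact: norm2_ext].
Qed.

Lemma in_l2_res eta : eta \in @in_l2 R su -> res eta \in @in_l2 R asym.
Proof.
move=> /asboolP H; apply/asboolP => e /H[f fC xf].
by exists (res f); [exact: Cc_res|exact: norm2_res xf].
Qed.

Lemma row_finite_res F : row_finite F -> row_finite (res F).
Proof.
move=> Fr x; apply: (@sub_finite_set _ _
  (@asym_of_su R S @` [set g | su_rng g = x /\ F g != 0])).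
  by move=> h [hx Fh]; exists (su_of_asym h) => //; exact: su_of_asymK.
exact: finite_image.
Qed.

(** If [g] has nonzero degree then so does g^-1 h, where [ext xi] vanishes; only arrows of the
    subgroupoid contribute. *)
Lemma conv_res F xi (h : arr asym) :
  conv F (ext xi) (su_of_asym h) = conv (res F) xi h.
Proof.
rewrite /Defs.conv; pose P := [set k : arr asym | rng k = rng h].
have bij : set_bij P (@su_of_asym R S @` P) (@su_of_asym R S).
  split; first (by move=> k Pk; exists k);
    first by move=> a b _ _; exact: su_of_asym_inj.
  by move=> _ [k Pk <-]; exists k.
rewrite -(@fsbig_widen _ _ _ _ (@su_of_asym R S @` P)); first last.
- move=> g [/= gh ng]; have [g0|/eqP g0] := eqVneq (su_ddeg g) 0.
    case: ng; exists (asym_of_su g); last exact: asym_of_suK.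
    by have /(congr1 (@su_rng R S)) := asym_of_suK g0; rewrite gh.
  apply/eqP; rewrite mulf_eq0; apply/orP; right; apply/eqP.
  apply: ext_ddeg; have gr : su_src (su_inv g) = su_rng (su_of_asym h) by [].
  have e : su_mul g (su_mul (su_inv g) (su_of_asym h)) = su_of_asym h.
    exact: (@mulgVK su).
  apply/eqP => d0; apply: g0; move: (congr1 (@su_ddeg R S) e).
  rewrite su_ddegM ?d0 ?addr0; first by rewrite su_ddeg_asym.
  by rewrite su_rngM.
- by move=> _ [k Pk <-].
rewrite (reindex_fsbig _ _ _ _ bij); apply: eq_fsbigr => k /set_mem kh.
have := @su_of_asymM R S (asym_inv k) h kh; rewrite su_of_asymV => e.
change (F (su_of_asym k) * ext xi (su_mul (su_inv (su_of_asym k)) (su_of_asym h))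
  = F (su_of_asym k) * xi (asym_mul (asym_inv k) h)).
by rewrite -e ext_asym.
Qed.

Lemma csum_res (x : S) (u : arr su -> C) : (forall g, su_ddeg g != 0 -> u g = 0) ->
  @csum R su (fibre (x : obj su)) u =
  @csum R asym (fibre (x : obj asym)) (fun h => u (su_of_asym h)).
Proof.
move=> u0.
have E (w : arr su -> \bar R) : (forall g, su_ddeg g != 0 -> w g = 0%E) ->
    (\esum_(g in fibre (x : obj su)) w g =
     \esum_(h in fibre (x : obj asym)) w (su_of_asym h))%E.
  move=> w0; rewrite -(@esum_image R _ _ (fibre (x : obj asym)) (@su_of_asym R S) w);
    last by move=> a b _ _; exact: su_of_asym_inj.
  have -> : @su_of_asym R S @` fibre (x : obj asym) =
      fibre (x : obj su) `&` [set g | su_ddeg g = 0].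
    apply/seteqP; split=> [_ [h hx <-]|g [gx g0]].
      by split => //; exact: su_ddeg_asym.
    exists (asym_of_su g); last exact: asym_of_suK.
    have e : su_src (su_of_asym (asym_of_su g)) = su_src g by rewrite asym_of_suK.
    exact: etrans e gx.
  rewrite esum_mkcondr; apply: eq_esum => g _.
  case: ifPn => // /negP g0; apply: w0; apply/negP => /eqP gd.
  by apply: g0; exact/mem_set.
have E' (w : R[i] -> R) : w 0 = 0 ->
    @rsum R su (fibre (x : obj su)) (fun g => w (u g)) =
    @rsum R asym (fibre (x : obj asym)) (fun h => w (u (su_of_asym h))).
  move=> w0; rewrite /rsum; congr (fine _ - fine _); apply: E => g /u0 ->.
    by rewrite w0 maxxx.
  by rewrite w0 oppr0 maxxx.
by rewrite /csum; congr (_ +i* _)%C; exact: E'.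
Qed.

Definition extL (xi : l2 R asym) : l2 R su := L2 (in_l2_ext (l2P xi)).

Definition resL (eta : l2 R su) : l2 R asym := L2 (in_l2_res (l2P eta)).

Lemma l2_eqP (G : groupoid) (xi eta : l2 R G) : l2_val xi =1 l2_val eta -> xi = eta.
Proof. by move=> e; apply: val_inj; apply/funext. Qed.

Lemma resL_lin (c : R[i]) (eta eta' : l2 R su) :
  resL (c *: eta + eta') = c *: resL eta + resL eta'.
Proof. exact: l2_eqP. Qed.

Lemma resLK (eta : l2 R su) : (forall g, l2_val eta g != 0 -> su_ddeg g = 0) ->
  extL (resL eta) = eta.
Proof. by move=> e0; apply: val_inj; exact: ext_res. Qed.

(** With [inner_extr] this says that [resL] and [extL] are mutually adjoint, which makes compression
    compatible with adjoints. *)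
Lemma inner_extl (xi : l2 R asym) (eta : l2 R su) x : inner (extL xi) eta x = inner xi (resL eta) x.
Proof.
rewrite /inner csum_res => [|g g0].
  congr csum; apply/funext => h.
  by rewrite -[l2_val (extL xi) _]/(ext xi _) ext_asym.
by rewrite -[l2_val (extL xi) _]/(ext xi _) ext_ddeg// conjc0 mul0r.
Qed.

Lemma inner_extr (xi : l2 R asym) (eta : l2 R su) x : inner eta (extL xi) x = inner (resL eta) xi x.
Proof.
rewrite /inner csum_res => [|g g0].
  congr csum; apply/funext => h.
  by rewrite -[l2_val (extL xi) _]/(ext xi _) ext_asym.
by rewrite -[l2_val (extL xi) _]/(ext xi _) ext_ddeg// mulr0.
Qed.

End extension_restriction.

(** * Averages over the circle *)

Section circle_averages.
Context (R : realType).
Local Notation C := (R[i]^o).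
Local Notation normc := (@ComplexField.Normc.normc R).

Lemma circle_mul_subproof (z w : circle R) : `|(z : R[i]) * w| = 1.
Proof. by rewrite normrM !circleP mulr1. Qed.

Definition circle_mul (z w : circle R) := Circle (circle_mul_subproof z w).

Lemma circle1_subproof : `|1 : R[i]| = 1. Proof. exact: normr1. Qed.

Lemma circle_rootN1 (n : int) : n != 0 -> exists w : circle R, (w : R[i]) ^ n = -1.
Proof.
have H (m : nat) : (0 < m)%N -> exists w : circle R, (w : R[i]) ^+ m = -1.
  move=> m0; pose w : R[i] := m.-root (-1).
  have wm : w ^+ m = -1 by exact: rootCK.
  have w1 : `|w| = 1.
    by apply/eqP; rewrite -(@pexpr_eq1 _ `|w| m)// -normrX wm normrN1.
  by exists (Circle w1).
case: n => [[//|m]|m] n0; first exact: H.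
have [w wm] := H m.+1 isT; exists w.
by rewrite NegzE -exprnN wm invrN1.
Qed.

(* Averaging [z] and [z w], where [w ^ n = -1], removes the frequency [n]. *)
Lemma circle_average (I : eqType) (r : seq I) (k : I -> int) (c : I -> C) (a : C)
    (t : R) :
  (forall z : circle R, normc (a - \sum_(i <- r) (z : R[i]) ^ k i * c i) <= t) ->
  normc (a - \sum_(i <- r | k i == 0) c i) <= t.
Proof.
(* Induction on a list containing every nonzero frequency whose coefficient is nonzero. *)
suff H (L : seq int) : forall c : I -> C,
    {in r, forall i, k i != 0 -> c i != 0 -> k i \in L} ->
    (forall z : circle R, normc (a - \sum_(i <- r) (z : R[i]) ^ k i * c i) <= t) ->
    normc (a - \sum_(i <- r | k i == 0) c i) <= t.
  by move=> Hz; apply: (H [seq k i | i <- r]) => // i ir _ _; exact: map_f.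
elim: L => [|n L IH] {}c cL Hz.
  apply: le_trans (Hz (Circle circle1_subproof)).
  suff -> : \sum_(i <- r | k i == 0) c i =
    \sum_(i <- r) (Circle circle1_subproof : R[i]) ^ k i * c i by [].
  rewrite big_mkcond big_seq [RHS]big_seq; apply: eq_bigr => i ir.
  rewrite exp1rz mul1r; case: ifPn => // ki.
  by apply/eqP; apply: contraTT isT; rewrite eq_sym => ci; have := cL i ir ki ci.
have [n0|n0] := eqVneq n 0.
  apply: IH => // i ir ki ci; have := cL i ir ki ci.
  by rewrite inE n0 (negPf ki).
have [w wn] := circle_rootN1 n0.
(* The coefficients after averaging over z and z w: frequency n disappears and frequency 0 is
   unchanged. *)
pose c' i : C := (1 + (w : R[i]) ^ k i) / 2 * c i.
have c'0 i : k i = 0 -> c' i = c i.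
  by move=> ki; rewrite /c' ki expr0z divff ?mul1r// pnatr_eq0.
rewrite (eq_bigr c'); last by move=> i /eqP/c'0 ->.
apply: IH => [i ir ki ci'|z].
  have ci : c i != 0 by apply: contraNneq ci' => ci; rewrite /c' ci mulr0.
  have := cL i ir ki ci; rewrite inE => /orP[/eqP kn|//].
  by move: ci'; rewrite /c' kn wn subrr !mul0r eqxx.
(* Convexity: the new difference is the midpoint of two differences of modulus at most t. *)
have -> : a - \sum_(i <- r) (z : R[i]) ^ k i * c' i = 2^-1 *
    ((a - \sum_(i <- r) (z : R[i]) ^ k i * c i) +
     (a - \sum_(i <- r) (circle_mul z w : R[i]) ^ k i * c i)).
  have -> : \sum_(i <- r) (z : R[i]) ^ k i * c' i = 2^-1 *
      (\sum_(i <- r) (z : R[i]) ^ k i * c i +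
       \sum_(i <- r) (circle_mul z w : R[i]) ^ k i * c i).
    rewrite -big_split mulr_sumr; apply: eq_bigr => i _ /=.
    by rewrite exprMz_comm ?unitfE ?circle_neq0//; [rewrite /c'; field|exact: mulrC].
  by field.
have -> : (2^-1 : R[i]) = (2^-1 : R)%:C%C by rewrite rmorphV ?unitfE//= rmorph_nat.
rewrite normcM normc_real ger0_norm ?invr_ge0//.
rewrite ler_pdivrMl//; apply: le_trans (normcD _ _) _.
by rewrite mulr_natl mulr2n lerD.
Qed.

End circle_averages.

(** * Compression of fixed operators *)

Section diagonal_fixed_points.
Context (R : realType) (S : smale_space R) (x0 : S).
Local Notation asym := (asym_groupoid S).
Local Notation su := (su_groupoid S).
Local Notation C := (R[i]^o).
Local Notation normc := (@ComplexField.Normc.normc R).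
Let Get := su_groupoid_etale S.

Lemma phase_diag (z : circle R) (g : su_arr S) :
  phase (z, z) g = (z : R[i]) ^ su_ddeg g.
Proof. by rewrite /phase /= /su_ddeg expfzDr// circle_neq0. Qed.

Lemma circle_invE (z : circle R) (n : int) :
  (circle_inv z : R[i]) ^ n = (z : R[i]) ^ (- n).
Proof. by rewrite -exprz_inv. Qed.

Definition diag_op (z : circle R) (xi : l2 R su) : l2 R su :=
  U_op (circle_inv z, circle_inv z) xi.

Lemma diag_opE (z : circle R) (xi : l2 R su) g :
  l2_val (diag_op z xi) g = (z : R[i]) ^ (- su_ddeg g) * l2_val xi g.
Proof. by rewrite /= /phase_mul phase_diag circle_invE. Qed.

Lemma deltaE (z : circle R) (T : l2 R su -> l2 R su) xi g :
  l2_val (delta z T xi) g = (z : R[i]) ^ su_ddeg g * l2_val (T (diag_op z xi)) g.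
Proof. by rewrite -phase_diag. Qed.

Lemma diag_op_bound (z : circle R) (xi : l2 R su) (x : S) (s : R) :
  @fibre_bound R su x xi s -> @fibre_bound R su x (diag_op z xi) s.
Proof.
move=> xs A Ax; have := xs A Ax; rewrite [in X in _ -> X](eq_bigr
  (fun g => normc (l2_val xi g) ^+ 2))// => g _.
by rewrite /= /phase_mul normcM normc_phase mul1r.
Qed.

Lemma l2_bound (xi : l2 R su) : exists2 s : R, 0 <= s &
  (norm2 (l2_val xi) <= s%:E)%E.
Proof. by have [s s0 xs] := in_l2_bounded Get (l2P xi); exists s. Qed.

Lemma asym_l2_bound (xi : l2 R asym) : exists2 s : R, 0 <= s &
  (norm2 (l2_val xi) <= s%:E)%E.
Proof.
have [s s0 xs] := l2_bound (extL xi); exists s => //.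
by rewrite -(res_ext xi); exact: norm2_res xs.
Qed.

Lemma norm2_scale_bound (G : groupoid) (u xi : arr G -> C)
    (e s : R) : 0 <= e -> (norm2 xi <= s%:E)%E ->
  (norm2 u <= e%:E * norm2 xi)%E -> (norm2 u <= (e * s)%:E)%E.
Proof.
move=> e0 xs; move=> /le_trans; apply; rewrite EFinM.
by apply: lee_wpmul2l => //; rewrite lee_fin.
Qed.

(** The object [x] makes [norm2 xi] nonnegative, excluding the supremum of an empty family; being
    bounded by s, it is then a real number. *)
Lemma norm2_bound_scale (G : groupoid) (x : obj G) (u xi : arr G -> C)
    (e s : R) : (norm2 xi <= s%:E)%E ->
  (forall r : R, (norm2 xi <= r%:E)%E -> (norm2 u <= (e * r)%:E)%E) ->
  (norm2 u <= e%:E * norm2 xi)%E.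
Proof.
move=> xs H; have x0' : (0 <= norm2 xi)%E.
  exact: norm2_ge0 (unit_arr x).
have xf : norm2 xi \is a fin_num.
  by rewrite ge0_fin_numE// (le_lt_trans xs)// ltry.
by rewrite -[X in (_ * X)%E](fineK xf) -EFinM; apply: H; rewrite fineK.
Qed.

Definition compress (T : l2 R su -> l2 R su) (xi : l2 R asym) : l2 R asym :=
  resL (T (extL xi)).

Lemma compress_approx T (f : arr su -> C) (e : R) : 0 <= e ->
  (forall xi : l2 R su,
    (norm2 (l2_val (T xi) - conv f xi)%R <= e%:E * norm2 (l2_val xi))%E) ->
  forall xi : l2 R asym,
    (norm2 (l2_val (compress T xi) - conv (res f) xi)%R <=
     e%:E * norm2 (l2_val xi))%E.
Proof.
move=> e0 Hf xi; have [s s0 xs] := asym_l2_bound xi.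
apply: (norm2_bound_scale (x0 : obj asym) xs) => r xr.
have -> : l2_val (compress T xi) - conv (res f) xi =
    res (l2_val (T (extL xi)) - conv f (extL xi)).
  by apply/funext => h; rewrite -[RHS]/(_ - _) [X in _ - X]conv_res.
apply: norm2_res; apply: (norm2_scale_bound e0) (Hf _); exact: norm2_ext.
Qed.

Lemma compress_adjoint T T' : is_adjoint T T' ->
  is_adjoint (compress T) (compress T').
Proof. by move=> TT' xi eta x; rewrite /compress -inner_extr TT' inner_extl. Qed.

Lemma compress_Cstar T : Cstar R su T -> Cstar R asym (compress T).
Proof.
move=> [[T' TT'] HT]; split.
  by exists (compress T'); exact: compress_adjoint.
move=> e e0; have [f fC Hf] := HT e e0.
by exists (res f); [exact: Cc_res|exact: compress_approx (ltW e0) Hf].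
Qed.

Section fixed_operator.
Variable T : l2 R su -> l2 R su.
Hypothesis T_fixed : forall z, delta z T = T.

Lemma fixed_valE (z : circle R) (xi : l2 R su) g :
  l2_val (T xi) g = (z : R[i]) ^ su_ddeg g * l2_val (T (diag_op z xi)) g.
Proof. by rewrite -deltaE T_fixed. Qed.

(** An extended function is unchanged by [diag_op], so a value of its image in degree n is
    multiplied by w^n for every w; taking w^n = -1 forces it to vanish. *)
Lemma fixed_ext (xi : l2 R asym) g : l2_val (T (extL xi)) g != 0 -> su_ddeg g = 0.
Proof.
move=> Tg; apply/eqP; apply: contraNT Tg => g0.
have [w wn] := circle_rootN1 R g0.
have := fixed_valE w (extL xi) g; rewrite wn.
have -> : diag_op w (extL xi) = extL xi.
  apply: l2_eqP => h; rewrite diag_opE -[l2_val (extL xi) h]/(ext xi h).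
  have [->|/ext_neq0 ->] := eqVneq (ext xi h) 0; first by rewrite mulr0.
  by rewrite oppr0 expr0z mul1r.
rewrite mulN1r => /eqP; rewrite -addr_eq0 -mulr2n -mulr_natl mulf_eq0.
by rewrite pnatr_eq0.
Qed.

(* Averaging over the circle replaces an approximant of [T] by its restriction
   to the kernel of [su_ddeg]. *)
Lemma fixed_mean (f : arr su -> C) (xi : l2 R su) (e s : R) g : Cc f ->
  0 <= e -> (norm2 (l2_val xi) <= s%:E)%E ->
  (forall eta : l2 R su,
    (norm2 (l2_val (T eta) - conv f eta)%R <= e%:E * norm2 (l2_val eta))%E) ->
  normc (l2_val (T xi) g - conv (ext (res f)) xi g) ^+ 2 <= e * s.
Proof.
move=> fC e0 xs Hf; have s0 : 0 <= s.
  have /norm2_leP/(_ (su_rng g)) := xs; exact: fibre_bound_ge0.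
have fr := Cc_row_finite Get fC.
have fr' := Cc_row_finite Get (Cc_ext (Cc_res fC)).
have [Q Qg [HQ HQ']] := row_finite2_fset (g : arr su) fr fr'.
have fE (eta : arr su -> C) := conv_mx eta Qg HQ.
have fE' (eta : arr su -> C) := conv_mx eta Qg HQ'.
pose dd (k : arr su) : int := su_ddeg g - su_ddeg k.
have ddE k : k \in Q -> su_ddeg (mul (g : arr su) (inv k)) = dd k.
  move=> kQ; apply: (@deg_mulV su (@su_ddeg R S) (@su_ddegM R S)).
  exact/esym/Qg.
(* The average is a statement about moduli, hence the passage to a square root. *)
have sq : normc (l2_val (T xi) g - conv (ext (res f)) xi g) <= Num.sqrt (e * s).
  have -> : conv (ext (res f)) xi g =
      \sum_(k <- Q | dd k == 0) f (mul (g : arr su) (inv k)) * l2_val xi k.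
    rewrite fE' [RHS]big_mkcond; apply: eq_fbigr => k kQ _.
    case: ifPn => kd; last by rewrite ext_ddeg ?mul0r// ddE.
    rewrite /ext ddE// kd /res asym_of_suK//.
    by rewrite ddE//; exact/eqP.
  apply: (circle_average (k := dd)) => z.
  rewrite -[leLHS]ger0_norm ?normc_ge0// -sqrtr_sqr ler_wsqrtr//.
  have zs : (norm2 (l2_val (diag_op z xi)) <= s%:E)%E.
    move/norm2_leP : xs => xs; apply/norm2_leP => x; exact/diag_op_bound/xs.
  have := norm2_scale_bound e0 zs (Hf _).
  move=> /norm2_leP/(_ (src (g : arr su)))/(fibre_bound1 (erefl _)).
  (* Conjugating by the circle leaves [T] alone and multiplies the term of index k by z to the
     degree [dd k]; the phase in front has modulus 1. *)
  suff -> : l2_val (T xi) g - \sum_(k <- Q) (z : R[i]) ^ dd k *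
      (f (mul (g : arr su) (inv k)) * l2_val xi k) = (z : R[i]) ^ su_ddeg g *
      (l2_val (T (diag_op z xi)) - conv f (diag_op z xi)) g.
    by rewrite normcM exprMn -phase_diag normc_phase expr1n mul1r.
  rewrite (fixed_valE z) [in RHS]/GRing.add /= mulrBr; congr (_ - _).
  rewrite fE mulr_sumr; apply: eq_bigr => k _.
  rewrite -[X in _ = _ * (f X * _)]/(su_mul g (su_inv k)) /phase_mul phase_diag.
  rewrite circle_invE /dd expfzDr ?circle_neq0//; ring.
have es0 : 0 <= e * s by exact: mulr_ge0.
by rewrite -(sqr_sqrtr es0) ler_sqr ?nnegrE ?normc_ge0 ?sqrtr_ge0.
Qed.

End fixed_operator.

(** The interpolating functions of [conv_bounded_kernel] are supported in degree 0, so they come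
    from elements of [l2] over [H], where the norm bound is given. *)
Lemma conv_bounded_ext (f : arr asym -> C) (c : R) : 0 <= c ->
  row_finite (ext f) ->
  (forall (zeta : l2 R asym) s, (norm2 (l2_val zeta) <= s%:E)%E ->
     (norm2 (conv f zeta) <= (c * s)%:E)%E) ->
  conv_bounded c (ext f).
Proof.
move=> c0 fr H.
apply: (conv_bounded_kernel Get (@su_ddegM R S) (@near_su_ddeg R S) c0 fr).
  by move=> h; exact: ext_neq0.
move=> xi xC x0' y F s xs Fy F0.
pose zeta : l2 R asym := L2 (in_l2_Cc (Cc_res xC)).
have zs : (norm2 (l2_val zeta) <= s%:E)%E by exact: norm2_res xs.
have /norm2_leP/(_ y) := H zeta s zs.
move=> /fibre_bound_ext; apply=> // h.
by rewrite -(ext_res x0') conv_res res_ext.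
Qed.

(** Two approximants of one operator on [H] are close to each other, and this closeness survives
    extension to [G]. Both injectivity and the Cauchy property rest on it. *)
Lemma conv_approx_bound (S' : l2 R asym -> l2 R asym) (f f' : arr asym -> C)
    (e e' : R) : 0 <= e -> 0 <= e' -> Cc f -> Cc f' ->
  (forall xi : l2 R asym,
    (norm2 (l2_val (S' xi) - conv f xi)%R <= e%:E * norm2 (l2_val xi))%E) ->
  (forall xi : l2 R asym,
    (norm2 (l2_val (S' xi) - conv f' xi)%R <= e'%:E * norm2 (l2_val xi))%E) ->
  conv_bounded (2 * (e + e')) (ext f - ext f').
Proof.
move=> e0 e0' fC fC' Hf Hf'.
have fr := row_finite_res (Cc_row_finite Get (Cc_ext fC)).
have fr' := row_finite_res (Cc_row_finite Get (Cc_ext fC')).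
rewrite !res_ext in fr fr'.
rewrite -extB; apply: conv_bounded_ext; first by rewrite mulr_ge0// addr_ge0.
  rewrite extB; apply: row_finiteB; apply: Cc_row_finite => //; exact: Cc_ext.
move=> zeta s zs; rewrite convBl//.
have h := norm2_scale_bound e0 zs (Hf zeta).
have h' := norm2_scale_bound e0' zs (Hf' zeta).
have -> : conv f zeta - conv f' zeta =
    (l2_val (S' zeta) - conv f' zeta) - (l2_val (S' zeta) - conv f zeta).
  by apply/funext => k; rewrite !fctE; ring.
apply: le_trans (norm2_sub h' h) _.
by rewrite lee_fin -mulrDl mulrA (addrC e').
Qed.

End diagonal_fixed_points.

(** * Bijectivity of the compression *)

Section compression.
Context (R : realType) (S : smale_space R) (x0 : S).
Local Notation asym := (asym_groupoid S).
Local Notation su := (su_groupoid S).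
Local Notation C := (R[i]^o).
Local Notation normc := (@ComplexField.Normc.normc R).
Let Get := su_groupoid_etale S.

Lemma harmonic_bound (a b : C) (c : R) :
  (forall n, normc (a - b) ^+ 2 <= harmonic n * c) -> a = b.
Proof.
move=> H; apply/eqP; rewrite -subr_eq0; apply/eqP/ComplexField.Normc.eq0_normc/eqP.
have lim : (fun n => harmonic n * c) @ \oo --> (0 * c : R).
  by apply: cvgMr_tmp; exact: cvg_harmonic.
rewrite mul0r in lim.
rewrite -sqrf_eq0 eq_le sqr_ge0 andbT.
rewrite -(cvg_lim (@Rhausdorff R) lim); apply: limr_ge; first exact: cvgP lim.
exact: nearW.
Qed.

(** Convolution by a function of degree 0 preserves degrees, so it is fixed by [delta]. *)
Lemma conv_diag (f : arr asym -> C) (z : circle R) (xi : l2 R su) (g : su_arr S) :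
  Cc f ->
  (z : R[i]) ^ su_ddeg g * conv (ext f) (diag_op z xi) g = conv (ext f) xi g.
Proof.
move=> fC; have fr := Cc_row_finite Get (Cc_ext fC).
have [Q Qg [HQ _]] := row_finite2_fset (g : arr su) fr fr.
rewrite !(conv_mx _ Qg HQ) mulr_sumr; apply: eq_fbigr => k kQ _.
have [->|/ext_neq0] := eqVneq (ext f (mul (g : arr su) (inv k))) 0.
  by rewrite !mul0r mulr0.
rewrite (@deg_mulV su (@su_ddeg R S) (@su_ddegM R S)); last exact/esym/Qg.
move=> /eqP; rewrite subr_eq0 => /eqP ->.
rewrite mulrCA; congr (_ * _).
rewrite -[LHS]/((z : R[i]) ^ su_ddeg k * (phase (circle_inv z, circle_inv z) k * l2_val xi k)).
rewrite phase_diag circle_invE mulrA -expfzDr ?circle_neq0// subrr expr0z.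
exact: mul1r.
Qed.

(** Each operator is near the convolution by its truncated approximant, and the two truncations are
    near each other because both approximate the same compression. *)
Lemma compress_inj T T' : fixed_point_algebra S T -> fixed_point_algebra S T' ->
  compress T = compress T' -> T = T'.
Proof.
move=> [[_ HT] Tf] [[_ HT'] T'f] TT'; apply/funext => xi; apply: l2_eqP => g.
have [s s0 xs] := l2_bound xi.
(* With h the current error, the two approximations together contribute 4 h s and the difference of
   convolutions 4 h s; splitting these two doubles their sum. *)
apply: (@harmonic_bound _ _ (16 * s)) => n.
have e0 : 0 <= (harmonic n : R) by exact: harmonic_ge0.
have e0' : 0 < (harmonic n : R) by exact: harmonic_gt0.
have [f fC Hf] := HT _ e0'; have [f' fC' Hf'] := HT' _ e0'.
have h := fixed_mean Tf g fC e0 xs Hf.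
have h' := fixed_mean T'f g fC' e0 xs Hf'.
have Hr := compress_approx x0 e0 Hf; rewrite TT' in Hr.
have Hr' := compress_approx x0 e0 Hf'.
have cb := conv_approx_bound e0 e0 (Cc_res fC) (Cc_res fC') Hr Hr'.
have fr := Cc_row_finite Get (Cc_ext (Cc_res fC)).
have fr' := Cc_row_finite Get (Cc_ext (Cc_res fC')).
have c0 : 0 <= 2 * (harmonic n + harmonic n : R) by rewrite mulr_ge0// addr_ge0.
have := conv_bounded_norm2 c0 (row_finiteB fr fr') cb xs.
move=> /norm2_leP/(_ (src (g : arr su)))/(fibre_bound1 (erefl _)).
rewrite convBl// => hd.
have -> : l2_val (T xi) g - l2_val (T' xi) g =
    ((l2_val (T xi) g - conv (ext (res f)) xi g) -
     (l2_val (T' xi) g - conv (ext (res f')) xi g)) +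
    (conv (ext (res f)) xi - conv (ext (res f')) xi) g.
  rewrite !fctE; ring.
apply: le_trans (normc_sqrD _ _) _.
have := normc_sqrB (l2_val (T xi) g - conv (ext (res f)) xi g)
  (l2_val (T' xi) g - conv (ext (res f')) xi g).
set u := normc _ ^+ 2 in h *; set u' := normc _ ^+ 2 in h' *.
set v := normc _ ^+ 2; set w := normc _ ^+ 2 in hd *.
lra.
Qed.

(** [T] is the limit of the convolutions by the extended approximants of [S']. It is fixed because
    each of these convolutions is, and its compression and [S'] are limits of the same convolutions
    on [H]. *)
Lemma compress_surj S' : ruelle_a S S' ->
  exists2 T, fixed_point_algebra S T & compress T = S'.
Proof.
move=> [_ HS].
have /choice[f Hf] (n : nat) : exists f, Cc f /\ forall xi : l2 R asym,
    (norm2 (l2_val (S' xi) - conv f xi)%R <= (harmonic n)%:E * norm2 (l2_val xi))%E.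
  by have [f fC Hf] := HS _ (harmonic_gt0 n); exists f.
have fC n : Cc (ext (f n)) by apply: Cc_ext; have [] := Hf n.
have fb n m : conv_bounded (2 * harmonic n + 2 * harmonic m) (ext (f n) - ext (f m)).
  rewrite -mulrDr; have [fn Hn] := Hf n; have [fm Hm] := Hf m.
  by apply: conv_approx_bound Hn Hm => //; exact: harmonic_ge0.
have e0 n : 0 <= 2 * (harmonic n : R) by rewrite mulr_ge0// harmonic_ge0.
have e_lim : (fun n => 2 * (harmonic n : R)) @ \oo --> (0 : R).
  by rewrite -[X in _ --> X](mulr0 2); apply: cvgMl_tmp; exact: cvg_harmonic.
have [T [T' [TT' HT]]] := limit_operator Get fC e0 e_lim fb.
have Tg n (xi : l2 R su) s (g : su_arr S) : (norm2 (l2_val xi) <= s%:E)%E ->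
    normc (l2_val (T xi) g - conv (ext (f n)) xi g) ^+ 2 <= harmonic n * (4 * s).
  move=> /norm2_leP/(_ (src (g : arr su)))/(HT n)/(fibre_bound1 (erefl _)).
  by rewrite -[X in normc X]/(_ - _) => hT;
    suff -> : harmonic n * (4 * s) = 2 * (2 * harmonic n) * s by []; ring.
exists T; first split.
- split; first by exists T'.
  move=> e e_gt0.
  (* The division by 4 absorbs one factor 2 from comparing approximants and another from passing to
     the limit. *)
  have [n _ Hn] := cvgr_lt _ (@cvg_harmonic R) (e / 4) (divr_gt0 e_gt0 (ltr0n _ 4)).
  exists (ext (f n)) => // xi; have [s _ xs] := l2_bound xi.
  apply: (norm2_bound_scale (x0 : obj su) xs) => r xr; apply/norm2_leP => x F Fx.
  have r0 : 0 <= r.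
    by rewrite -lee_fin; apply: le_trans xr; exact: norm2_ge0 (unit_arr (x0 : obj su)).
  have /norm2_leP/(_ x)/(HT n)/(_ F Fx) := xr.
  move=> /le_trans; apply; apply: ler_wpM2r => //.
  have : (harmonic n : R) < e / 4 by exact: Hn (leqnn n).
  by rewrite ltr_pdivlMr//; lra.
- move=> z; apply/funext => xi; apply: l2_eqP => g; have [s s0 xs] := l2_bound xi.
  apply: (@harmonic_bound _ _ (16 * s)) => n.
  have zs : (norm2 (l2_val (diag_op z xi)) <= s%:E)%E.
    by move/norm2_leP : xs => xs; apply/norm2_leP => x; exact/diag_op_bound/xs.
  rewrite deltaE.
  have -> : (z : R[i]) ^ su_ddeg g * l2_val (T (diag_op z xi)) g - l2_val (T xi) g =
    (z : R[i]) ^ su_ddeg g *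
      (l2_val (T (diag_op z xi)) g - conv (ext (f n)) (diag_op z xi) g) -
    (l2_val (T xi) g - conv (ext (f n)) xi g).
    by rewrite -(conv_diag z xi g (Hf n).1); ring.
  apply: le_trans (normc_sqrB _ _) _.
  rewrite -phase_diag normcM normc_phase mul1r.
  have := Tg n _ _ g zs; have := Tg n _ _ g xs; lra.
apply/funext => xi; apply: l2_eqP => h; have [s s0 xs] := asym_l2_bound xi.
apply: (@harmonic_bound _ _ (16 * s)) => n.
have := Tg n (extL xi) s (su_of_asym h) (norm2_ext xs).
rewrite conv_res res_ext => hT.
have := norm2_scale_bound (harmonic_ge0 n) xs ((Hf n).2 xi).
move=> /norm2_leP/(_ (src (h : arr asym)))/(fibre_bound1 (erefl _)).
rewrite -[X in normc X]/(_ - _) => hS.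
have -> : l2_val (compress T xi) h - l2_val (S' xi) h =
  (l2_val (T (extL xi)) (su_of_asym h) - conv (f n) xi h) -
  (l2_val (S' xi) h - conv (f n) xi h).
  by rewrite /= /res; ring.
apply: le_trans (normc_sqrB _ _) _.
have hs : 0 <= harmonic n * s by rewrite mulr_ge0// harmonic_ge0.
lra.
Qed.

End compression.

Theorem theorem7p9 (R : realType) (S : smale_space R)
  (S_irreducible : irreducible S) (S_infinite : infinite_set [set: S]) :
  star_isomorphic (fixed_point_algebra S) (ruelle_a S).
Proof.
(* A point supplies an arrow, without which the suprema defining norms would be over empty
   families. *)
have [x0 _] : [set: S] !=set0 by exact: infinite_setN0.
exists (@compress R S); split.
- split.
  + by move=> T [TC _]; exact: compress_Cstar.
  + by move=> T T' /set_mem TA /set_mem T'A; exact: compress_inj.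
  + by move=> S' /(compress_surj x0)[T TA <-]; exists T.
- by move=> c T T' _ _; apply/funext => xi; exact: resL_lin.
- move=> T T' _ [_ T'f]; apply/funext => xi.
  (* A fixed operator sends extended functions to functions supported in degree 0, so restricting
     and extending again between the two factors loses nothing. *)
  by rewrite /compress /= resLK//; exact: fixed_ext.
- by move=> T T' _ _; exact: compress_adjoint.
Qed.
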